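(* Let $n\ge2$ and $x\in\mathbb{N}^n$, and let $X^n$ be the crystal process started at $x$. Let $v^2=\frac{2\beta_0\beta_1}{\beta_0+\beta_1}$ and $v^{2,\infty}=\frac{2\beta_1\beta_2}{\beta_1+\beta_2}$. (i) If $\beta_2<\beta_0\le\beta_1$, then $t^{-1}X^n_t$ converges $\mathbb{P}_x$-a.s. as $t\to\infty$ and its limit belongs a.s. to $\mathcal E_1$, the set of $n$-tuples of the form $(a_1,\beta_2,a_2,\beta_2,\dots,a_{k-1},\beta_2,a_k)$ with $k\ge1$ and each block $a_i$ equal to $(\beta_0)$ or $(v^2,v^2)$. (ii) If $\beta_2<\beta_1<\beta_0$, then $t^{-1}X^n_t$ converges $\mathbb{P}_x$-a.s. and its limit belongs a.s. to $\mathcal E_2$, the set of $n$-tuples $(\beta_{i_1},\dots,\beta_{i_n})$ with $i_j\in\{0,1,2\}$, $i_j\ne i_{j+1}$ for $1\le j\le n-1$, and $i_1\ne2$, $i_n\ne2$. (iii) If $\beta_1\le\beta_2<\beta_0$, then $t^{-1}X^n_t$ converges $\mathbb{P}_x$-a.s. and its limit belongs a.s. to $\mathcal E_3$, the set of $n$-tuples of the form $(e_L,\beta_0,a_1,\beta_0,a_2,\dots,a_{k-1},\beta_0,a_k,\beta_0,e_R)$ with $k\ge0$ (for $k=0$ the tuple is $(e_L,\beta_0,e_R)$), each block $a_i$ equal to $(\beta_2)$ or $(v^{2,\infty},v^{2,\infty})$, and each of $e_L,e_R$ equal to $(\beta_1)$ or the empty tuple.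
   Context: Fix $n\ge2$ and $\beta=(\beta_0,\beta_1,\beta_2)\in(0,\infty)^3$. For $x\in\mathbb{N}^n$, with the zero boundary convention $x(0)=x(n+1)=0$, let $V_j(x)=\mathbf 1_{\{x(j-1)>x(j)\}}+\mathbf 1_{\{x(j+1)>x(j)\}}\in\{0,1,2\}$. The crystal process $X^n$ is the continuous-time Markov chain on $\mathbb{N}^n$ jumping from $x$ to $x+e_j$ at rate $\beta_{V_j(x)}$ ($j=1,\dots,n$) with no other transitions; $\mathbb{P}_x$ is its law from $x$. $t^{-1}X^n_t$ denotes the vector $(t^{-1}X^n_t(1),\dots,t^{-1}X^n_t(n))$, and tuples are concatenated blockwise. *)

(* Defs.v *)
From HB Require Import structures.
From mathcomp Require Import all_boot all_order all_algebra.
From mathcomp Require Import all_classical all_reals all_analysis.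
Set Implicit Arguments. Unset Strict Implicit. Unset Printing Implicit Defensive.
Import Order.TTheory GRing.Theory Num.Theory.
Import numFieldNormedType.Exports.
Local Open Scope classical_set_scope.
Local Open Scope ring_scope.

Section Crystal.
Variable R : realType.
Variables (b0 b1 b2 : R).
Variable n : nat.

(* states x in N^n, coordinate j+1 of the paper is x j for j : 'I_n *)
Definition state := {ffun 'I_n -> nat}.

(* 1-based coordinate access with the zero boundary x(0) = x(n+1) = 0 *)
Definition coord (x : state) (k : nat) : nat :=
  if k is k'.+1 then (if insub k' is Some i then x i else 0%N) else 0%N.

(* V_j(x) for the paper's j = i+1 *)
Definition Vj (x : state) (i : 'I_n) : nat :=
  ((coord x i > coord x i.+1)%N : nat) + ((coord x i.+2 > coord x i.+1)%N : nat).

Definition beta (v : nat) : R :=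
  if v == 0%N then b0 else if v == 1%N then b1 else b2.

Definition incr (x : state) (j : 'I_n) : state := [ffun i => (x i + (i == j))%N].

(* entries of the k-th power of the generator Q, where
   Q(x, x+e_j) = beta_{V_j(x)}, Q(x,x) = - sum_j beta_{V_j(x)}, Q = 0 elsewhere;
   computed via Q^{k+1} = Q Q^k (Q is row-finite). *)
Fixpoint Qpow (k : nat) (y z : state) : R :=
  match k with
  | 0 => ((y == z) : nat)%:R
  | k'.+1 => \sum_(j < n) beta (Vj y j) * (Qpow k' (incr y j) z - Qpow k' y z)
  end.

(* transition function P_t = exp(tQ) (rates are bounded) *)
Definition Ptrans (t : R) (y z : state) : R :=
  limn (series (fun k => t ^+ k / (k`!)%:R * Qpow k y z)).

(* X is (a right-continuous version of) the crystal process started at x under P: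
   its finite-dimensional distributions are those of the Markov chain with
   generator Q and initial state x. *)
Definition crystal_process (d : measure_display) (T : measurableType d)
  (P : probability T R) (X : R -> T -> state) (x : state) : Prop :=
  [/\ (forall t y, measurable [set w | X t w = y]),
      (forall w t, 0 <= t -> exists2 e : R, 0 < e &
          forall s, t <= s < t + e -> X s w = X t w) &
      (forall (k : nat) (ts : nat -> R) (ys : nat -> state),
          0 <= ts 0%N -> (forall i, (i < k)%N -> ts i <= ts i.+1) ->
          P [set w | forall i, (i <= k)%N -> X (ts i) w = ys i] =
          (Ptrans (ts 0%N) x (ys 0%N) *
           \prod_(i < k) Ptrans (ts i.+1 - ts i) (ys i) (ys i.+1))%:E)].

Definition speed_limit (X : R -> state) (l : 'I_n -> R) : Prop :=
  forall i, ((X t i)%:R / t) @[t --> +oo] --> l i.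

Definition v2 : R := 2 * b0 * b1 / (b0 + b1).
Definition v2inf : R := 2 * b1 * b2 / (b1 + b2).

Definition sep_join (s : R) (bs : seq (seq R)) : seq R :=
  if bs is b :: bs' then b ++ flatten [seq s :: a | a <- bs'] else [::].

Definition E1 (l : seq R) : Prop :=
  exists bs : seq (seq R), [/\ bs != [::],
    all (fun a => (a == [:: b0]) || (a == [:: v2; v2])) bs &
    l = sep_join b2 bs].

Definition E2 (l : seq R) : Prop :=
  exists ix : seq nat, [/\ size ix = n, all (fun i => (i < 3)%N) ix,
    (forall j, (j.+1 < n)%N -> nth 0%N ix j != nth 0%N ix j.+1),
    (nth 0%N ix 0 != 2%N) && (nth 0%N ix n.-1 != 2%N) &
    l = map beta ix].

Definition E3 (l : seq R) : Prop :=
  exists (bs : seq (seq R)) (eL eR : seq R),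
    [/\ all (fun a => (a == [:: b2]) || (a == [:: v2inf; v2inf])) bs,
        (eL == [::]) || (eL == [:: b1]), (eR == [::]) || (eR == [:: b1]) &
        l = eL ++ [:: b0] ++ flatten [seq a ++ [:: b0] | a <- bs] ++ eR].

Definition tup (l : 'I_n -> R) : seq R := map l (enum 'I_n).

End Crystal.

(* Main.v *)
(* Conditioning on a finite-dimensional cylinder event restarts the chain, and
   over a short time h at most one jump occurs up to probability O(h^2). Hence a
   bounded function g whose generator satisfies gen g <= 0 (or gen g <= kap g)
   on a set controls, after refining the dyadic mesh, the probability of leaving
   the set (or of staying in it while g is large).

   (1) If the centre of a strict local maximum is faster than its neighbours, the
   function min(1, rho^dl + rho^dr) of its two height differences is a
   supermartingale for a suitable rho < 1, so a high maximum stays one forever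
   with positive probability. Since a weak local maximum becomes a high one with
   positive probability, each site is eventually always a strict local maximum
   or eventually never a weak one; the same holds for minima.

   (2) If sites p, q, r evolve so that q is never a weak local minimum and
   b0 <= b1, then u = (x_q - x_p)^+ and v = (x_q - x_r)^+ make ln (8 (u^2 + v^2))
   a supermartingale that cannot stay bounded, so this lasts only finitely long;
   this excludes three consecutive sites between minima in case (i), and its
   mirror image does so for maxima in case (iii). Two sites both moving at rate
   b1 cannot keep their order forever because their distance is a martingale.

   (3) Once the final pattern is fixed, exponential martingales give the speeds:
   for a block of two sites with rates bh <= bl the drift of
   x_p + x_q + th |x_p - x_q| is constant for th = (bl - bh)/(bh + bl), while
   |x_p - x_q| = o(t) by the growth rate of cosh(theta (x_p - x_q)). *)
Require Import Defs.
From HB Require Import structures.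
From mathcomp Require Import all_boot all_order all_algebra.
From mathcomp Require Import all_classical all_reals all_analysis.
From mathcomp Require Import ring lra zify.
Import Order.TTheory GRing.Theory Num.Theory.
Import numFieldNormedType.Exports.
Local Open Scope classical_set_scope.
Local Open Scope ring_scope.

(** The hypothesis on X concerns finite-dimensional distributions, so stopping at the first visit to
    a set is expressed by an induction over mesh steps that conditions on one more value of the path
    at a time. States more than one jump away are controlled only through their O(h^2) mass; hence
    test functions take values in [0,1], and an unbounded f is replaced by min(1, f/a), which
    preserves the inequality gen f <= 0. The equality cases b0 = b1 in (i) and b1 = b2 in (iii)
    shape the triple argument. There (u, v) is, inside the quadrant, a driftless planar walk with
    jumps (1,1), (-1,0), (0,-1) or their opposites, and for unit rates ln (u^2 + v^2) has generator
    close to -4uv / (u^2 + v^2)^2 <= 0. The logarithm gives no rate of escape. It is played against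
    a uniformly positive chance of being pushed to any level lam: staying forever would force the
    level lam to be reached, which has probability at most f/lam. Extrema come in a strict and a
    weak form so that the dichotomy leaves no room for ties: a site that is not a persistent
    extremum eventually satisfies a strict inequality with some neighbour at every time. *)

Lemma le_geometric {R : realType} (a b c r : R) : 0 <= r -> r < 1 ->
  (forall k, a <= b + r ^+ k * c) -> a <= b.
Proof.
move=> r0 r1 H.
have cv : b + r ^+ k * c @[k --> \oo] --> b + 0 * c.
  apply: cvgD; first exact: cvg_cst.
  by apply: cvgMl; apply: cvg_expr; rewrite ger0_norm.
have := ler_cvg_to (cvg_cst a) cv; rewrite mul0r addr0; apply.
by apply: nearW => k.
Qed.

(** * Probabilities as real numbers *)

Section RealValuedProbability.
Context {d : measure_display} {T : measurableType d} {R : realType}.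
Variable P : probability T R.
Implicit Types A B D F : set T.

(** Real values bring all estimates within reach of [lra]; nothing is lost because P is finite. *)
Definition prob A : R := fine (P A).

Lemma prE A : measurable A -> P A = (prob A)%:E.
Proof. by move=> mA; rewrite /prob fineK // fin_num_measure. Qed.

Lemma pr_ge0 A : 0 <= prob A.
Proof. by rewrite /prob fine_ge0. Qed.

Lemma pr_le A B : measurable A -> measurable B -> A `<=` B -> prob A <= prob B.
Proof.
by move=> mA mB AB; rewrite -lee_fin -!prE //; apply: le_measure; rewrite ?inE.
Qed.

Lemma pr_le1 A : measurable A -> prob A <= 1.
Proof. by move=> mA; rewrite -lee_fin -prE // probability_le1. Qed.

Lemma pr_set0 : prob set0 = 0.
Proof. by rewrite /prob measure0. Qed.

Lemma prU_le A B : measurable A -> measurable B -> prob (A `|` B) <= prob A + prob B.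
Proof.
move=> mA mB; rewrite -lee_fin EFinD -!prE //; last exact: measurableU.
by apply: measureU2.
Qed.

Lemma pr_setID A B : measurable A -> measurable B ->
  prob A = prob (A `&` B) + prob (A `\` B).
Proof.
move=> mA mB; apply/EFin_inj.
have : P A = (P (A `\` B) + P (A `&` B))%E by exact: measureDI.
rewrite (prE A) // (prE (A `&` B)); last exact: measurableI.
by rewrite (prE (A `\` B)) -?EFinD 1?addrC //; exact: measurableD.
Qed.

Lemma pr_sum_disjoint (I : eqType) (s : seq I) (F : I -> set T) D : uniq s ->
  measurable D -> (forall i, measurable (F i)) ->
  (forall i, i \in s -> F i `<=` D) ->
  trivIset setT F -> \sum_(i <- s) prob (F i) <= prob D.
Proof.
move=> + + mF + tF; elim: s D => [|i s IH] D; first by rewrite big_nil pr_ge0.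
move=> /= /andP[is_ us] mD FD; rewrite big_cons (pr_setID _ _ mD (mF i)).
apply: lerD.
  apply: pr_le => //; first exact: measurableI.
  by move=> w Fw; split => //; apply: FD Fw; rewrite mem_head.
apply: IH => //; first exact: measurableD.
move=> j js w Fw; split; first by apply: FD Fw; rewrite inE js orbT.
move=> Fi; move: is_; suff -> : i = j by rewrite js.
by apply: tF => //; exists w.
Qed.

(** This is conditioning on a countably valued variable: a bound by q given each value of Z sums to
    a bound by q on all of D. Coding the values by [pickle] turns them into a sequence, so that
    sigma-additivity applies. *)
Lemma pr_partition (I : countType) (Z : T -> I) (q : R) D F :
  measurable D -> measurable F -> (forall v, measurable [set w | Z w = v]) ->
  0 <= q ->
  (forall v, prob (D `&` [set w | Z w = v] `&` F) <= q * prob (D `&` [set w | Z w = v])) ->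
  prob (D `&` F) <= q * prob D.
Proof.
move=> mD mF mZ q0 H.
have mp i : measurable [set w | pickle (Z w) = i].
  have [v|nv] := pselect (exists v : I, pickle v = i).
    case: v => v pv; rewrite (_ : [set _ | _] = [set w | Z w = v]) //.
    apply/seteqP; split => w /=; last by move=> ->.
    by rewrite -pv => /(pcan_inj pickleK).
  rewrite (_ : [set _ | _] = set0) //; apply/seteqP; split => w //= pw.
  by apply: nv; exists (Z w).
have cov A : measurable A -> P A = (\sum_(0 <= i <oo) P (A `&` [set w | pickle (Z w) = i]))%E.
  move=> mA; rewrite -measure_semi_bigcup //.
  - congr (P _); apply/seteqP; split => w; last by case=> i _ [].
    by move=> Aw; exists (pickle (Z w)).
  - by move=> i; apply: measurableI.
  - move=> i j _ _ [w [[_ <-] [_ <-]]] //.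
  - by apply: bigcupT_measurable => i; apply: measurableI.
rewrite -lee_fin EFinM -!prE //; last exact: measurableI.
rewrite (cov _ (measurableI _ _ mD mF)) (cov _ mD) -nneseriesZl //.
apply: lee_nneseries => // i _.
have [[v pv]|nv] := pselect (exists v : I, pickle v = i).
  have -> : [set w | pickle (Z w) = i] = [set w | Z w = v].
    apply/seteqP; split => w /=; last by move=> ->.
    by rewrite -pv => /(pcan_inj pickleK).
  rewrite setIAC !prE ?lee_fin //; try (by do ?apply: measurableI).
have -> : [set w | pickle (Z w) = i] = set0.
  by apply/seteqP; split => w //= pw; apply: nv; exists (Z w).
by rewrite !setI0 measure0 mule0.
Qed.

Lemma pr_bigcup_le (F : (set T)^nat) c : (forall i, measurable (F i)) ->
  {homo F : n m / (n <= m)%N >-> n `<=` m} ->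
  (forall i, prob (F i) <= c) -> prob (\bigcup_i F i) <= c.
Proof.
move=> mF hF Fc; have mU : measurable (\bigcup_i F i) by exact: bigcupT_measurable.
have h : {homo F : n m / (n <= m)%N >-> (n <= m)%O} by move=> n m /hF ?; exact/subsetPset.
have cv := nondecreasing_cvg_mu (mu := P) mF mU h.
rewrite -lee_fin -prE // -(cvg_lim _ cv) //.
apply: lime_le; first by apply/cvg_ex; exists (P (\bigcup_i F i)).
by apply: nearW => i /=; rewrite prE // lee_fin.
Qed.

Lemma pr_bigcap_decr (F : (set T)^nat) : (forall i, measurable (F i)) ->
  {homo F : n m / (n <= m)%N >-> m `<=` n} ->
  forall c, (forall i, c <= prob (F i)) -> c <= prob (\bigcap_i F i).
Proof.
move=> mF hF c Fc; have mU : measurable (\bigcap_i F i) by apply: bigcap_measurable => //; exists 0%N.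
have h : {homo F : n m / (n <= m)%N >-> (m <= n)%O} by move=> n m /hF ?; exact/subsetPset.
have fin : (P (F 0%N) < +oo)%E by rewrite -ge0_fin_numE ?fin_num_measure.
have cv := nonincreasing_cvg_mu (mu := P) fin mF mU h.
rewrite -lee_fin -prE // -(cvg_lim _ cv) //.
apply: lime_ge; first by apply/cvg_ex; exists (P (\bigcap_i F i)).
by apply: nearW => i /=; rewrite prE // lee_fin.
Qed.

Lemma pr_negligible A : measurable A -> prob A <= 0 -> P.-negligible A.
Proof.
move=> mA A0; have PA0 : P A = 0%E.
  by rewrite prE //; congr EFin; apply/eqP; rewrite eq_le A0 pr_ge0.
exact/negligibleP.
Qed.

Lemma negligible_countable_bigcup (I : countType) (F : I -> set T) :
  (forall i, P.-negligible (F i)) -> P.-negligible (\bigcup_i F i).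
Proof.
move=> nF.
pose G (k : nat) := if unpickle k is Some i then F i else set0.
apply: (@negligibleS _ _ _ _ (\bigcup_k G k)); last first.
  apply: negligible_bigcup => k; rewrite /G; case: unpickle => // ; exact: negligible_set0.
by move=> w [i _ Fw]; exists (pickle i) => //; rewrite /G pickleK.
Qed.

(** Borel-Cantelli for geometrically small events. Over a finite window M <= t < M + K the bounds
    telescope to [c * (r ^+ M - r ^+ (M + K)) / (1 - r)], and K then goes to infinity by monotone
    continuity. *)
Lemma pr_limsup_geometric (F : (set T)^nat) (c r : R) : 0 <= r < 1 ->
  (forall t, measurable (F t)) -> (forall t, prob (F t) <= c * r ^+ t) ->
  P.-negligible (lim_sup_set F).
Proof.
move=> /andP[r0 r1] mF Fc; have r1' : 0 < 1 - r by rewrite subr_gt0.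
pose G M K := \bigcup_(t in [set t | (M <= t < M + K)%N]) F t.
have mG M K : measurable (G M K) by apply: bigcup_measurable.
have GK M K : prob (G M K) <= c * (r ^+ M - r ^+ (M + K)) / (1 - r).
  elim: K => [|K IH].
    rewrite addn0 subrr mulr0 mul0r (_ : G M 0%N = set0) ?pr_set0 //.
    by apply/seteqP; split => // w [t /=]; rewrite addn0; lia.
  apply: (@le_trans _ _ (prob (G M K `|` F (M + K)%N))).
    apply: pr_le => //; first exact: measurableU.
    move=> w [t /= tM Ft]; case: (eqVneq t (M + K)%N) => [<-|ne]; first by right.
    by left; exists t => //=; lia.
  apply: (le_trans (prU_le _ _ (mG M K) (mF _))).
  apply: (le_trans (lerD IH (Fc _))).
  rewrite ler_pdivlMr // mulrDl divfK ?gt_eqF // addnS exprSr.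
  by rewrite le_eqVlt; apply/orP; left; apply/eqP; ring.
have GM M : prob (\bigcup_(t >= M) F t) <= 0 + r ^+ M * (c / (1 - r)).
  rewrite (_ : \bigcup_(t >= M) F t = \bigcup_K G M K).
    apply: pr_bigcup_le => // [K K' KK' w [t tM Ft]|K].
      by exists t => //=; move: tM => /=; lia.
    apply: (le_trans (GK M K)).
    have c0 : 0 <= c.
      by have := le_trans (pr_ge0 _) (Fc 0%N); rewrite expr0 mulr1.
    rewrite add0r mulrA ler_pM2r ?invr_gt0 // mulrC ler_wpM2r //.
    by rewrite gerBl exprn_ge0.
  apply/seteqP; split => w.
    by move=> [t /= Mt Ft]; exists t.+1 => //; exists t => //=; lia.
  by move=> [K _ [t /= Mt Ft]]; exists t => //=; lia.
have mL : measurable (lim_sup_set F).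
  by apply: bigcapT_measurable => M; exact: bigcup_measurable.
apply: pr_negligible => //; apply: (le_geometric _ _ _ _ r0 r1) => M.
apply: (le_trans _ (GM M)); apply: pr_le => //; first exact: bigcup_measurable.
by move=> w /(_ M I).
Qed.

End RealValuedProbability.

Lemma ae_forall_countable {d : measure_display} {T : measurableType d} {R : realType}
  (P : probability T R) (I : countType) (Q : I -> T -> Prop) :
  (forall i, {ae P, forall w, Q i w}) -> {ae P, forall w, forall i, Q i w}.
Proof.
move=> H; apply: negligibleS (negligible_countable_bigcup P _ (fun i => ~` [set w | Q i w]) H).
by move=> w /= /existsNP[i nQ]; exists i.
Qed.

(** Moves a side condition on indices, such as adjacency of sites, under the almost-sure quantifier,
    so that all index tuples can be intersected at once. *)
Lemma ae_imply {d : measure_display} {T : measurableType d} {R : realType}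
  (P : probability T R) (A : Prop) (Q : T -> Prop) :
  (A -> {ae P, forall w, Q w}) -> {ae P, forall w, A -> Q w}.
Proof.
have [a H|na _] := pselect A; last by apply: aeW => w.
by apply: filterS (H a) => w.
Qed.

(** * The generator and the short-time expansion of the transition function *)

Section States.
Context {n : nat}.
Implicit Types y z : state n.

Lemma incrE y j i : incr y j i = (y i + (i == j))%N.
Proof. by rewrite ffunE. Qed.

Lemma incr_neq y j : incr y j != y.
Proof. by apply/eqP => /ffunP/(_ j); rewrite ffunE eqxx /= => ?; lia. Qed.

Lemma incr_inj y : injective (incr y).
Proof.
move=> i j /ffunP/(_ i); rewrite !ffunE eqxx; case: eqP => //= _ ?; lia.
Qed.

Definition nbrs y : seq (state n) := y :: [seq incr y j | j <- enum 'I_n].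

Lemma uniq_nbrs y : uniq (nbrs y).
Proof.
rewrite /= map_inj_uniq ?enum_uniq ?andbT; last exact: incr_inj.
by apply/mapP => -[j _ /esym/eqP]; rewrite (negbTE (incr_neq _ _)).
Qed.

Lemma size_nbrs y : size (nbrs y) = n.+1.
Proof. by rewrite /= size_map size_enum_ord. Qed.

Definition incrs y (js : seq 'I_n) : state n := foldl (@incr n) y js.

End States.

Section Generator.
Context {R : realType} (b0 b1 b2 : R) {n : nat}.
Hypotheses (b0_gt0 : 0 < b0) (b1_gt0 : 0 < b1) (b2_gt0 : 0 < b2).
Implicit Types (y z : state n) (g : state n -> R).

Local Notation bt := (beta b0 b1 b2).
Local Notation Q := (Qpow b0 b1 b2).
Local Notation Pt := (Ptrans b0 b1 b2).

Definition generator g y : R := \sum_(j < n) bt (Vj y j) * (g (incr y j) - g y).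

(** Bounds the l^1 norm of each row of Q: the diagonal entry and the n jump rates each contribute at
    most half of it. *)
Definition row_bound : R := 2 * n%:R * (b0 + b1 + b2).
Definition taylor_const : R := expR row_bound.

Lemma beta_gt0 v : 0 < bt v.
Proof. by rewrite /beta; case: ifP => // _; case: ifP. Qed.

Lemma beta_le v : bt v <= b0 + b1 + b2.
Proof.
move: b0_gt0 b1_gt0 b2_gt0 => ? ? ?.
by rewrite /beta; case: ifP => _; [lra|case: ifP => _; lra].
Qed.

Lemma row_bound_ge0 : 0 <= row_bound.
Proof. by rewrite /row_bound !mulr_ge0 // !addr_ge0 ?ltW. Qed.

Lemma taylor_const_gt0 : 0 < taylor_const.
Proof. exact: expR_gt0. Qed.

Lemma Qpow_bound k y z : `|Q k y z| <= row_bound ^+ k.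
Proof.
elim: k y => [|k IH] y /=; first by rewrite expr0; case: eqP; rewrite ?normr1 ?normr0.
apply: (le_trans (ler_norm_sum _ _ _)).
have -> : row_bound ^+ k.+1 = \sum_(j < n) (b0 + b1 + b2) * (2 * row_bound ^+ k).
  by rewrite sumr_const card_ord exprS /row_bound -mulr_natl; ring.
apply: ler_sum => j _; rewrite normrM.
apply: ler_pM => //; first by rewrite gtr0_norm ?beta_gt0 // beta_le.
apply: (le_trans (ler_normB _ _)).
move: (IH (incr y j)) (IH y) => ? ?; lra.
Qed.

(** Jumps only raise coordinates. Through [Ptrans_supp] this makes the paths almost surely
    nondecreasing. *)
Lemma Qpow_supp k y z : ~~ [forall i, y i <= z i]%N -> Q k y z = 0.
Proof.
elim: k y => [|k IH] y yz /=.
  by case: eqP => // yzE; move: yz; rewrite yzE => /negP[]; apply/forallP.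
apply: big1 => j _; rewrite !IH ?subr0 ?mulr0 //.
move: yz => /forallPn[i]; rewrite -ltnNge => zi.
by apply/forallPn; exists i; rewrite incrE -ltnNge; lia.
Qed.

Lemma Ptrans_supp t y z : ~~ [forall i, y i <= z i]%N -> Pt t y z = 0.
Proof.
move=> yz; rewrite /Ptrans; apply/cvg_lim => //.
rewrite (_ : series _ = fun=> 0); first exact: cvg_cst.
by apply/funext => N; rewrite /series /= big1 // => k _; rewrite Qpow_supp ?mulr0.
Qed.

(** For h <= 1 the terms of order k >= 2 are at most h^2 times those of the exponential series at
    [row_bound]. Together with [Ptrans_supp], this is the information on the power series that
    enters the estimates. *)
Lemma Ptrans_taylor (h : R) y z : 0 <= h <= 1 ->
  `|Pt h y z - ((y == z)%:R + h * Q 1 y z)| <= taylor_const * h ^+ 2.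
Proof.
move=> /andP[h0 h1]; set q := Q 1 y z.
pose u k := h ^+ k / (k`!)%:R * Q k y z.
pose e := exp_coeff row_bound.
have e0 k : 0 <= e k by rewrite /e /exp_coeff /= divr_ge0 // exprn_ge0 // row_bound_ge0.
have ue k : `|u k| <= h ^+ k * e k.
  rewrite /u normrM /e /exp_coeff /= ger0_norm; last by rewrite divr_ge0 // exprn_ge0.
  rewrite -mulrA ler_wpM2l ?exprn_ge0 // mulrC ler_wpM2r ?invr_ge0 //.
  exact: Qpow_bound.
have ue1 k : `|u k| <= e k.
  by rewrite (le_trans (ue k)) // ler_piMl // exprn_ile1.
have cu : cvgn (series u).
  apply: normed_cvg; apply: (@series_le_cvg _ _ e) => //.
    by move=> k /=; exact: normr_ge0.
  exact: is_cvg_series_exp_coeff.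
have ce : cvgn (series e) by exact: is_cvg_series_exp_coeff.
have H N : (2 <= N)%N ->
  `|series u N - ((y == z)%:R + h * q)| <= h ^+ 2 * series e N.
  move=> N2; rewrite /series /= big_ltn; last lia.
  rewrite [X in _ + X - _]big_ltn //.
  have -> : u 0%N = (y == z)%:R by rewrite /u expr0 fact0 divr1 mul1r.
  have -> : u 1%N = h * q by rewrite /u expr1 factS fact0 muln1 divr1.
  rewrite [X in `|X|](_ : _ = \sum_(2 <= k < N) u k); last by ring.
  apply: (le_trans (ler_norm_sum _ _ _)).
  rewrite mulr_sumr (@big_cat_nat _ _ _ 2 0 N) //= -[leLHS]add0r; apply: lerD.
    by apply: sumr_ge0 => i _; rewrite mulr_ge0 // exprn_ge0.
  rewrite big_nat [leRHS]big_nat; apply: ler_sum => k /andP[k2 _].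
  rewrite (le_trans (ue k)) // ler_wpM2r //.
  by rewrite -(subnK k2) exprD ler_piMl ?exprn_ge0 // exprn_ile1.
rewrite /taylor_const [leRHS]mulrC.
have c1 : `|series u N - ((y == z)%:R + h * q)| @[N --> \oo] -->
    `|Pt h y z - ((y == z)%:R + h * q)|.
  by apply: cvg_norm; apply: cvgB; [exact: cu|exact: cvg_cst].
have c2 : h ^+ 2 * series e N @[N --> \oo] --> h ^+ 2 * expR row_bound.
  by apply: cvgM; [exact: cvg_cst|exact: ce].
apply: (ler_cvg_to c1 c2); exists 2%N => // N /= N2; exact: H.
Qed.

Lemma Qpow1_diag y : Q 1 y y = - \sum_(j < n) bt (Vj y j).
Proof.
rewrite /= -sumrN; apply: eq_bigr => j _.
by rewrite eqxx (negbTE (incr_neq _ _)) sub0r mulrN1.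
Qed.

Lemma Qpow1_incr y j : Q 1 y (incr y j) = bt (Vj y j).
Proof.
rewrite /= (bigD1 j) //= eqxx eq_sym (negbTE (incr_neq _ _)) subr0 mulr1.
rewrite big1 ?addr0 // => i ij.
by rewrite (inj_eq (incr_inj y)) (negbTE ij) subr0 mulr0.
Qed.

Lemma sum_nbrs y (F : state n -> R) :
  \sum_(z <- nbrs y) F z = F y + \sum_(j < n) F (incr y j).
Proof. by rewrite big_cons big_map big_enum. Qed.

(** One Taylor error for each of the n + 1 states in [nbrs y]. The case g = 1 says that these states
    carry all the mass up to O(h^2). *)
Lemma sum_Ptrans_nbrs (h : R) y g (M : R) : 0 <= h <= 1 ->
  (forall z, 0 <= g z <= M) ->
  `|\sum_(z <- nbrs y) Pt h y z * g z - (g y + h * generator g y)| <=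
    n.+1%:R * M * taylor_const * h ^+ 2.
Proof.
move=> h01 gM.
have -> : g y + h * generator g y =
    \sum_(z <- nbrs y) ((y == z)%:R + h * Q 1 y z) * g z.
  rewrite sum_nbrs eqxx Qpow1_diag.
  have -> : \sum_(j < n) ((y == incr y j)%:R + h * Q 1 y (incr y j)) * g (incr y j)
     = h * \sum_(j < n) bt (Vj y j) * g (incr y j).
    rewrite mulr_sumr; apply: eq_bigr => j _.
    by rewrite Qpow1_incr eq_sym (negbTE (incr_neq _ _)) add0r mulrA.
  rewrite /generator; under eq_bigr do rewrite mulrBr.
  rewrite sumrB -mulr_suml mulr1n; ring.
rewrite -sumrB; apply: (le_trans (ler_norm_sum _ _ _)).
have -> : n.+1%:R * M * taylor_const * h ^+ 2 =
    \sum_(z <- nbrs y) taylor_const * h ^+ 2 * M.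
  by rewrite big_const_seq count_predT size_nbrs iter_addr_0 -mulr_natl; ring.
apply: ler_sum => z _; rewrite -mulrBl normrM; apply: ler_pM => //.
  exact: Ptrans_taylor.
by rewrite ger0_norm; case/andP: (gM z).
Qed.

End Generator.

(** * A logarithmic Lyapunov function *)

(* The maximum with 1 makes ln (lyap 0 0) = 0 nonnegative; the factor 8 is what
   the inequalities need next to the origin. *)
Definition lyap (u v : nat) : nat := maxn 1 (8 * (u ^ 2 + v ^ 2)).

Lemma lyap_gt0 u v : (0 < lyap u v)%N.
Proof. by rewrite /lyap leq_max. Qed.

Lemma lyapC u v : lyap u v = lyap v u.
Proof. by rewrite /lyap addnC. Qed.

Lemma lyapE u v : (0 < u)%N || (0 < v)%N -> lyap u v = (8 * (u ^ 2 + v ^ 2))%N.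
Proof.
move=> uv; apply/maxn_idPr; rewrite muln_gt0 /= addn_gt0 !expn_gt0.
by case/orP: uv => ->; rewrite ?orbT.
Qed.

Lemma leq_lyap u v u' v' : (u <= u')%N -> (v <= v')%N -> (lyap u v <= lyap u' v')%N.
Proof.
move=> uu vv; rewrite /lyap geq_max leq_max /= leq_max; apply/orP; right.
by rewrite leq_mul2l leq_add ?leq_exp2r.
Qed.

(** At (u, v) = (a+1, c+1) the three factors are the values after a jump of the centre, the left and
    the right site, so the product inequality is superharmonicity of ln [lyap] under equal rates.
    The remainder has nonnegative coefficients; its top-degree part 512 * 4ac(a^2 + c^2) is the
    discrete trace of the term -4uv / (u^2 + v^2)^2. *)
Lemma lyap_peak a c :
  (lyap a.+2 c.+2 * lyap a c.+1 * lyap a.+1 c <= lyap a.+1 c.+1 ^ 3)%N.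
Proof.
rewrite !lyapE ?orbT //.
suff -> : ((8 * (a.+1 ^ 2 + c.+1 ^ 2)) ^ 3 =
  8 * (a.+2 ^ 2 + c.+2 ^ 2) * (8 * (a ^ 2 + c.+1 ^ 2)) * (8 * (a.+1 ^ 2 + c ^ 2)) +
  512 * (4 * c + 11 * c ^ 2 + 6 * c ^ 3 + 4 * a + 6 * a * c ^ 2 + 4 * a * c ^ 3 +
   11 * a ^ 2 + 6 * a ^ 2 * c + 6 * a ^ 3 + 4 * a ^ 3 * c))%N by exact: leq_addr.
ring.
Qed.

Lemma lyap_pit a c :
  (lyap a c * lyap a.+2 c.+1 * lyap a.+1 c.+2 <= lyap a.+1 c.+1 ^ 3)%N.
Proof.
have [|] := boolP ((0 < a)%N || (0 < c)%N); last first.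
  (* At a = c = 0 the maximum with 1 is active, and the claim reads 1 * 40 * 40 <= 16 ^ 3. *)
  by case: a c => [|a] [|c].
move=> ac; rewrite !lyapE ?orbT //.
suff -> : ((8 * (a.+1 ^ 2 + c.+1 ^ 2)) ^ 3 =
  8 * (a ^ 2 + c ^ 2) * (8 * (a.+2 ^ 2 + c.+1 ^ 2)) * (8 * (a.+1 ^ 2 + c.+2 ^ 2)) +
  512 * (8 + 24 * c + 11 * c ^ 2 + 2 * c ^ 3 + 24 * a + 48 * a * c + 18 * a * c ^ 2 +
   4 * a * c ^ 3 + 11 * a ^ 2 + 18 * a ^ 2 * c + 2 * a ^ 3 + 4 * a ^ 3 * c))%N by exact: leq_addr.
ring.
Qed.

(** The centre is level with its right neighbour: its jump makes v equal to 1, while a jump of the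
    right neighbour leaves the truncated difference v at 0 and gives no factor. *)
Lemma lyap_peak_flat a : (lyap a.+2 1 * lyap a 0 <= lyap a.+1 0 ^ 2)%N.
Proof.
case: a => [|a]; first by [].
rewrite !lyapE ?orbT //.
suff -> : ((8 * (a.+2 ^ 2 + 0 ^ 2)) ^ 2 =
  8 * (a.+3 ^ 2 + 1 ^ 2) * (8 * (a.+1 ^ 2 + 0 ^ 2)) + 64 * (a.+1 ^ 2 + 4 * a.+1 + 1))%N by exact: leq_addr.
ring.
Qed.

Lemma lyap_slope a : (lyap a.+2 0 * lyap a 0 <= lyap a.+1 0 ^ 2)%N.
Proof.
apply: leq_trans (lyap_peak_flat a); rewrite leq_mul2r; apply/orP; right.
exact: leq_lyap.
Qed.

(** This case determines the constant 8 in [lyap]: at a = 0, a factor k would require 4k * 1 * 2k <=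
    k^3, that is k >= 8, with equality for 8. *)
Lemma lyap_pit_flat a : (lyap a.+2 0 * lyap a 0 * lyap a.+1 1 <= lyap a.+1 0 ^ 3)%N.
Proof.
case: a => [|a]; first by [].
rewrite !lyapE ?orbT //.
suff -> : ((8 * (a.+2 ^ 2 + 0 ^ 2)) ^ 3 =
  8 * (a.+3 ^ 2 + 0 ^ 2) * (8 * (a.+1 ^ 2 + 0 ^ 2)) * (8 * (a.+2 ^ 2 + 1 ^ 2)) +
  512 * (1 + 6 * a.+1 + 7 * a.+1 ^ 2 + 4 * a.+1 ^ 3 + a.+1 ^ 4))%N by exact: leq_addr.
ring.
Qed.

(** * Coordinates and local extrema *)

(* [coord] alone now denotes the coordinates of a vector space. *)
Local Notation coord := Defs.coord.
Arguments Defs.coord : simpl never.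

(** The distance |a - b|: one of the two truncated differences is always 0. *)
Definition ndist (a b : nat) : nat := (a - b) + (b - a).

Lemma ndist_lt a b : (a < b)%N -> exists e, [/\ ndist a b = e.+1, ndist a.+1 b = e &
  ndist a b.+1 = e.+2].
Proof. by move=> ab; exists (b - a).-1; rewrite /ndist; split; lia. Qed.

Lemma ndistC a b : ndist a b = ndist b a.
Proof. exact: addnC. Qed.

Section Coordinates.
Context {n : nat}.
Implicit Types (y : state n) (i j l : 'I_n).

Lemma coordE y i : coord y i.+1 = y i.
Proof. by rewrite /coord valK. Qed.

Lemma coord_incr y j k : coord (incr y j) k = (coord y k + (k == j.+1))%N.
Proof.
case: k => [|k]; first by [].
rewrite /coord; case: insubP => [i _ ik|nk]; first by rewrite incrE eqSS -ik.
by rewrite eqSS; case: eqP => // kj; move: nk; rewrite kj ltn_ord.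
Qed.

(** Separates true sites from boundary positions, whose height stays 0 because they never jump;
    estimates at an end site then treat that neighbour as frozen. *)
Lemma coordP k : (exists l : 'I_n, k = l.+1) \/ (forall y, coord y k = 0%N).
Proof.
case: k => [|k]; first by right.
have [kn|nk] := ltnP k n; first by left; exists (Ordinal kn).
by right=> y; rewrite /coord insubF // ltnNge nk.
Qed.

Lemma incrsE y js i : incrs y js i = (y i + count_mem i js)%N.
Proof.
elim: js y => [|j js IH] y; first by rewrite addn0.
by rewrite /= IH incrE addnA eq_sym.
Qed.

Lemma VjE y i : Vj y i = ((y i < coord y i)%N + (y i < coord y i.+2)%N)%N.
Proof. by rewrite /Vj coordE. Qed.

(** With boundary height 0, an end site can be a strict peak but never a strict pit; this asymmetry
    is the source of the different end conditions in the three limit sets. *)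
Definition strict_peak (i : 'I_n) : set (state n) :=
  [set y : state n | (coord y i < y i)%N /\ (coord y i.+2 < y i)%N].
Definition weak_peak (i : 'I_n) : set (state n) :=
  [set y : state n | (coord y i <= y i)%N /\ (coord y i.+2 <= y i)%N].
Definition strict_pit (i : 'I_n) : set (state n) :=
  [set y : state n | (y i < coord y i)%N /\ (y i < coord y i.+2)%N].
Definition weak_pit (i : 'I_n) : set (state n) :=
  [set y : state n | (y i <= coord y i)%N /\ (y i <= coord y i.+2)%N].

Lemma strict_peak_Vj y i : strict_peak i y -> Vj y i = 0%N.
Proof.
move=> [pl pr]; rewrite VjE.
have -> : (y i < coord y i)%N = false by lia.
by have -> : (y i < coord y i.+2)%N = false by lia.
Qed.

Lemma strict_pit_Vj y i : strict_pit i y -> Vj y i = 2%N.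
Proof. by rewrite VjE => -[-> ->]. Qed.

Lemma neighbor_of_peak_Vj y (i l : 'I_n) : strict_peak i y ->
  (l.+1 = i :> nat) \/ (l = i.+1 :> nat) -> (0 < Vj y l)%N.
Proof.
rewrite VjE => -[pl pr] [E|E].
  by rewrite E coordE; move: pl; rewrite -E coordE => ->; rewrite addn1.
by rewrite E coordE; move: pr; rewrite -E coordE => ->.
Qed.

Lemma neighbor_of_pit_Vj y (i l : 'I_n) : strict_pit i y ->
  (l.+1 = i :> nat) \/ (l = i.+1 :> nat) -> (Vj y l <= 1)%N.
Proof.
rewrite VjE => -[pl pr] [E|E].
  rewrite E coordE; move: pl; rewrite -E coordE => lt.
  by rewrite [(_ < y i)%N]ltnNge (ltnW lt) addn0 leq_b1.
rewrite E coordE; move: pr; rewrite -E coordE => lt.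
by rewrite [(_ < y i)%N]ltnNge (ltnW lt) leq_b1.
Qed.

End Coordinates.

Lemma coord_out {n : nat} (y : state n) k : (n < k)%N -> coord y k = 0%N.
Proof. by case: k => // k nk; rewrite /coord insubF // ltnNge -ltnS nk. Qed.

Lemma coord_pred {n : nat} (i j : 'I_n) (y : state n) : i.+1 = j :> nat ->
  coord y j = y i.
Proof. by move=> <-; rewrite coordE. Qed.

Lemma coord_succ {n : nat} (i j : 'I_n) (y : state n) : i.+1 = j :> nat ->
  coord y i.+2 = y j.
Proof. by move=> ->; rewrite coordE. Qed.

Lemma ord_next {n : nat} (i : 'I_n) : (i.+1 < n)%N -> exists j : 'I_n, i.+1 = j :> nat.
Proof. by move=> h; exists (Ordinal h). Qed.

Lemma ord_prev {n : nat} (i : 'I_n) : (0 < i)%N -> exists j : 'I_n, j.+1 = i :> nat.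
Proof.
move=> i0; have h : (i.-1 < n)%N by apply: leq_ltn_trans (leq_pred i) (ltn_ord i).
by exists (Ordinal h); rewrite /= prednK.
Qed.

(** * Decomposing the limit into blocks *)

Section SeparatedBlocks.
Context {R : realType}.

Lemma sep_join_cons (s : R) b bs : bs != [::] ->
  sep_join s (b :: bs) = b ++ s :: sep_join s bs.
Proof. by case: bs. Qed.

(** [m] marks the persistent pits. Reading from a site a that starts a gap, the gap has length one
    if a+1 is marked; otherwise the condition on triples forces the mark at a+2. Marking every
    position past the end lets the last gap close like the others, and the unmarked last site
    forbids a trailing separator. The recursion drops two or three sites, hence the induction on a
    bound N for r. *)
Lemma hill_blocks (m : nat -> bool) (Lf : nat -> R) (n : nat) (c0 c2 v : R) : 
  (forall k, (n <= k)%N -> m k) -> ~~ m n.-1 ->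
  (forall k, (k.+1 < n)%N -> ~~ (m k && m k.+1)) ->
  (forall k, (k.+2 < n)%N -> [|| m k, m k.+1 | m k.+2]) ->
  (forall k, (k < n)%N -> Lf k = if m k then c2 else
      if ((k == 0%N) || m k.-1) && m k.+1 then c0 else v) ->
  forall r a, (a + r = n)%N -> (0 < r)%N -> (a == 0%N) || m a.-1 -> ~~ m a ->
  exists bs : seq (seq R), [/\ bs != [::],
    all (fun b => (b == [:: c0]) || (b == [:: v; v])) bs &
    map Lf (iota a r) = sep_join c2 bs].
Proof.
move=> mn mlast madj mtri LE r; have [N] := ubnP r; elim: N r => // N IH r rN a an r0 ma na.
have La : Lf a = if m a.+1 then c0 else v.
  by rewrite LE ?(negbTE na) ?ma //; lia.
have [m1|m1] := boolP (m a.+1).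
  rewrite m1 in La.
  case: r rN an r0 => // -[|r] rN an _.
    by exists [:: [:: c0]]; rewrite /= eqxx La.
  case: r rN an => [|r] rN an.
    by move: mlast; rewrite -an addn2 /= m1.
  have n2 : ~~ m a.+2 by have := madj a.+1; rewrite m1 /=; apply; lia.
  have i1 : (r.+1 < N)%N by lia.
  have i2 : (a.+2 + r.+1 = n)%N by lia.
  have [bs [bs0 bsA bsE]] := IH r.+1 i1 a.+2 i2 isT m1 n2.
  exists ([:: c0] :: bs); split => //; first by rewrite /= eqxx.
  by rewrite sep_join_cons // -bsE /= La (LE a.+1) ?m1 //; lia.
rewrite (negbTE m1) in La.
case: r rN an r0 => // -[|r] rN an _.
  by move: m1; rewrite mn // -an addn1.
have La1 : Lf a.+1 = v.
  rewrite LE ?(negbTE m1) /= ?(negbTE na) //; lia.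
case: r rN an => [|r] rN an.
  by exists [:: [:: v; v]]; rewrite /= eqxx orbT La La1.
have m2 : m a.+2.
  by have := mtri a; rewrite (negbTE na) (negbTE m1) /=; apply; lia.
case: r rN an => [|r] rN an.
  by move: mlast; rewrite -an addn3 /= m2.
have n3 : ~~ m a.+3 by have := madj a.+2; rewrite m2 /=; apply; lia.
have i1 : (r.+1 < N)%N by lia.
have i2 : (a.+3 + r.+1 = n)%N by lia.
have [bs [bs0 bsA bsE]] := IH r.+1 i1 a.+3 i2 isT m2 n3.
exists ([:: v; v] :: bs); split => //; first by rewrite /= eqxx orbT.
by rewrite sep_join_cons // -bsE /= La La1 (LE a.+2) ?m2 //; lia.
Qed.

(** [m] marks the persistent peaks, and the recursion starts just after a peak, so that each block
    is followed by its separator [c0]. What may remain after the last peak is a single end site of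
    speed [c1]. *)
Lemma valley_blocks (m : nat -> bool) (Lf : nat -> R) (n : nat) (c0 c1 c2 v : R) :
  (1 < n)%N ->
  (forall k, (k.+1 < n)%N -> ~~ (m k && m k.+1)) ->
  (forall k, (k.+2 < n)%N -> [|| m k, m k.+1 | m k.+2]) ->
  m n.-2 || m n.-1 ->
  (forall k, (k < n)%N -> Lf k = if m k then c0 else
      if (k == 0%N) || (k == n.-1) then c1 else
      if m k.-1 && m k.+1 then c2 else v) ->
  forall r a, (a.+1 + r = n)%N -> m a ->
  exists (bs : seq (seq R)) (eR : seq R),
    [/\ all (fun b => (b == [:: c2]) || (b == [:: v; v])) bs,
     (eR == [::]) || (eR == [:: c1]) &
    map Lf (iota a.+1 r) = flatten [seq b ++ [:: c0] | b <- bs] ++ eR].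
Proof.
move=> n1 madj mtri mlast LE r; have [N] := ubnP r; elim: N r => // N IH r rN a an ma.
case: r rN an => [|r] rN an; first by exists [::], [::].
have na : ~~ m a.+1 by have := madj a; rewrite ma /=; apply; lia.
case: r rN an => [|r] rN an.
  exists [::], [:: c1]; rewrite eqxx orbT; split => //=.
  rewrite LE ?(negbTE na) //; last lia.
  by rewrite (_ : a.+1 == n.-1) ?orbT //; lia.
have La : Lf a.+1 = if m a.+2 then c2 else v.
  rewrite LE ?(negbTE na) /= ?ma //; last lia.
  by rewrite (_ : (a.+1 == n.-1) = false) //; lia.
have [m2|m2] := boolP (m a.+2).
  have i1 : (r < N)%N by lia.
  have i2 : (a.+3 + r = n)%N by lia.
  have [bs [eR [bsA eRE bsE]]] := IH r i1 a.+2 i2 m2.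
  exists ([:: c2] :: bs), eR; split => //; first by rewrite /= eqxx.
  by move: bsE => /= <-; rewrite La m2 (LE a.+2) ?m2 //; lia.
case: r rN an => [|r] rN an.
  (* Two unmarked sites cannot end the row, so a pair is always closed by a peak. *)
  by move: mlast; rewrite -an addn2 /= (negbTE na) (negbTE m2).
have La2 : Lf a.+2 = v.
  rewrite LE ?(negbTE m2) /= ?(negbTE na) //; last lia.
  by rewrite (_ : (a.+2 == n.-1) = false) //; lia.
have m3 : m a.+3.
  by have := mtri a.+1; rewrite (negbTE na) (negbTE m2) /=; apply; lia.
have i1 : (r < N)%N by lia.
have i2 : (a.+4 + r = n)%N by lia.
have [bs [eR [bsA eRE bsE]]] := IH r i1 a.+3 i2 m3.
exists ([:: v; v] :: bs), eR; split => //; first by rewrite /= eqxx orbT.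
by move: bsE => /= <-; rewrite La (negbTE m2) La2 (LE a.+3) ?m3 //; lia.
Qed.

End SeparatedBlocks.

(** * Estimates along cylinder events *)

Section CrystalProcess.
Context {R : realType} (b0 b1 b2 : R) {n : nat}.
Context {d : measure_display} {T : measurableType d} (P : probability T R).
Context (X : R -> T -> state n) (x : state n).
Hypotheses (b0_gt0 : 0 < b0) (b1_gt0 : 0 < b1) (b2_gt0 : 0 < b2).
Hypothesis hX : crystal_process b0 b1 b2 P X x.
Implicit Types (y z : state n) (g : state n -> R) (C E : set T) (S H : set (state n)).

Local Notation Pt := (Ptrans b0 b1 b2).
Local Notation pr := (prob P).
Local Notation gen := (generator b0 b1 b2).
Local Notation bt := (beta b0 b1 b2).

Let bt_gt0 := beta_gt0 b0 b1 b2 b0_gt0 b1_gt0 b2_gt0.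

Definition at_time (t : R) (S : set (state n)) : set T := [set w | S (X t w)].

Lemma measurable_eq_at t y : measurable [set w | X t w = y].
Proof. by case: hX. Qed.

Lemma measurable_at t S : measurable (at_time t S).
Proof.
have -> : at_time t S = \bigcup_z [set w | S z /\ X t w = z].
  by apply/seteqP; split => w; [exists (X t w)|case=> z _ [Sz xz]; rewrite /at_time /= xz].
apply: countable_bigcupT_measurable => [|z]; first exact: countableP.
have [Sz|nSz] := pselect (S z).
  rewrite (_ : [set w | _] = [set w | X t w = z]); first exact: measurable_eq_at.
  by apply/seteqP; split => w //=; case.
by rewrite (_ : [set w | _] = set0) //; apply/seteqP; split => w //=; case.
Qed.

(* [cyl C s y]: the event C prescribes the path at finitely many times, the last
   being s with value y; probabilities restricted to C replace the law started at y. *)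
Definition cyl (C : set T) (s : R) (y : state n) : Prop :=
  exists k (ts : nat -> R) (ys : nat -> state n),
  [/\ 0 <= ts 0%N, (forall i, (i < k)%N -> ts i <= ts i.+1), s = ts k, y = ys k &
      C = [set w | forall i, (i <= k)%N -> X (ts i) w = ys i]].

Lemma cyl_measurable C s y : cyl C s y -> measurable C.
Proof.
case=> k [ts [ys [_ _ _ _ ->]]].
have -> : [set w | forall i, (i <= k)%N -> X (ts i) w = ys i] =
    \bigcap_(i in [set i | (i <= k)%N]) [set w | X (ts i) w = ys i].
  by apply/seteqP; split.
by apply: bigcap_measurableType => i _; exact: measurable_eq_at.
Qed.

Lemma cyl_sub C s y : cyl C s y -> C `<=` [set w | X s w = y].
Proof. by case=> k [ts [ys [_ _ -> -> ->]]] w /(_ k (leqnn k)). Qed.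

Lemma cyl_at (s : R) y : 0 <= s -> cyl [set w | X s w = y] s y.
Proof.
move=> s0; exists 0%N, (fun=> s), (fun=> y); split => //.
by apply/seteqP; split => w /=; [move=> ? i _|move=> /(_ 0%N); apply].
Qed.

(** The Markov property in product form: prescribing one more value appends one factor to the
    product of transition probabilities. *)
Lemma cyl_path C (s : R) y (u : R) z : cyl C s y -> 0 <= u ->
  cyl (C `&` [set w | X (s + u) w = z]) (s + u) z /\
  pr (C `&` [set w | X (s + u) w = z]) = pr C * Pt u y z.
Proof.
case=> k [ts [ys [t0 tm -> -> ->]]] u0.
pose ts' i := if (i <= k)%N then ts i else ts k + u.
pose ys' i := if (i <= k)%N then ys i else z.
have t0' : 0 <= ts' 0%N by rewrite /ts'.
have tm' i : (i < k.+1)%N -> ts' i <= ts' i.+1.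
  rewrite ltnS => ik; rewrite /ts' ik; case: ltnP => ki; first exact: tm.
  have -> : i = k by apply/eqP; rewrite eqn_leq ik ki.
  by rewrite lerDl.
have E : [set w | forall i, (i <= k)%N -> X (ts i) w = ys i] `&`
     [set w | X (ts k + u) w = z] =
   [set w | forall i, (i <= k.+1)%N -> X (ts' i) w = ys' i].
  apply/seteqP; split => w /=.
    move=> [H1 H2] i; rewrite leq_eqVlt => /orP[/eqP ->|].
      by rewrite /ts' /ys' ltnn.
    by rewrite ltnS => ik; rewrite /ts' /ys' ik; exact: H1.
  move=> H; split => [i ik|].
    by have := H i (leqW ik); rewrite /ts' /ys' ik.
  by have := H k.+1 (leqnn _); rewrite /ts' /ys' ltnn.
have tk : ts k + u = ts' k.+1 by rewrite /ts' ltnn.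
have zk : z = ys' k.+1 by rewrite /ys' ltnn.
split; first by rewrite E; exists k.+1, ts', ys'.
rewrite E /prob; case: hX => _ _ fdd.
rewrite (fdd k.+1 ts' ys') // (fdd k ts ys) //= big_ord_recr /= mulrA.
congr (_ * _ * _); last first.
- by rewrite /ts' /ys' leqnn ltnn addrAC subrr add0r.
- by apply: eq_bigr => i _; rewrite /ts' /ys' !(ltn_ord i) (ltnW (ltn_ord i)).
Qed.

Lemma cyl_next C (s : R) y (u : R) z : cyl C s y -> 0 <= u ->
  cyl (C `&` [set w | X (s + u) w = z]) (s + u) z.
Proof. by move=> cC u0; have [] := cyl_path _ _ _ _ z cC u0. Qed.

Lemma cyl_markov C (s : R) y (u : R) z : cyl C s y -> 0 <= u ->
  pr (C `&` [set w | X (s + u) w = z]) = pr C * Pt u y z.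
Proof. by move=> cC u0; have [] := cyl_path _ _ _ _ z cC u0. Qed.

Definition step_const : R := n.+1%:R * taylor_const b0 b1 b2 (n := n).

Lemma step_const_ge0 : 0 <= step_const.
Proof. by rewrite mulr_ge0 // ltW // taylor_const_gt0. Qed.

Lemma cyl_nbrs C (s : R) y (h : R) g : cyl C s y -> 0 <= h <= 1 ->
  (forall z, 0 <= g z <= 1) ->
  `|\sum_(z <- nbrs y) g z * pr (C `&` [set w | X (s + h) w = z]) -
    pr C * (g y + h * gen g y)| <= pr C * (step_const * h ^+ 2).
Proof.
move=> cC /[dup] h01 /andP[h0 _] g01.
under eq_bigr do rewrite (cyl_markov _ _ _ _ _ cC h0) mulrCA [g _ * _]mulrC.
rewrite -mulr_sumr -mulrBr normrM ger0_norm ?pr_ge0 //.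
rewrite ler_wpM2l ?pr_ge0 //.
have := sum_Ptrans_nbrs b0 b1 b2 b0_gt0 b1_gt0 b2_gt0 h y g 1 h01 g01.
by rewrite mulr1.
Qed.

Lemma gen_cst (c : R) y : gen (fun=> c) y = 0.
Proof. by rewrite /generator big1 // => j _; rewrite subrr mulr0. Qed.

(* The event that two jumps occur before time h has probability O(h^2). *)
Lemma cyl_step C (s : R) y (h : R) g (a b : R) E : cyl C s y -> 0 <= h <= 1 -> measurable E ->
  (forall z, 0 <= g z <= 1) -> 0 <= a -> 0 <= b ->
  (forall z, pr (C `&` [set w | X (s + h) w = z] `&` E) <=
     (a * g z + b) * pr (C `&` [set w | X (s + h) w = z])) ->
  pr (C `&` E) <=
    pr C * (a * (g y + h * gen g y) + b + (a + 1) * step_const * h ^+ 2).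
Proof.
move=> cC h01 mE g01 a0 b0_ H.
have mC := cyl_measurable _ _ _ cC.
pose A z := [set w | X (s + h) w = z].
have mA z : measurable (A z) by exact: measurable_eq_at.
have mCA z : measurable (C `&` A z) by exact: measurableI.
pose far := at_time (s + h) [set z | z \notin nbrs y].
have mfar : measurable far by exact: measurable_at.
have tCA : trivIset setT (fun z => C `&` A z) by move=> z z' _ _ [w [[_ <-] [_ <-]]].
have sumle : \sum_(z <- nbrs y) pr (C `&` A z) <= pr C - pr (C `&` far).
  rewrite (pr_setID P C far) // addrAC subrr add0r.
  apply: (pr_sum_disjoint P _ _ (fun z => C `&` A z)) => //; first exact: uniq_nbrs.
    exact: measurableD.
  by move=> z zy w [Cw Aw]; split => //; rewrite /far /at_time /= Aw zy.
(* By [cyl_nbrs] with g = 1 the neighbours carry nearly all of C, so the disjoint remainder has mass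
   O(h^2). *)
have farle : pr (C `&` far) <= pr C * (step_const * h ^+ 2).
  have := cyl_nbrs C s y h (fun=> 1) cC h01.
  rewrite gen_cst mulr0 addr0 mulr1 ler01 lexx.
  under eq_bigr do rewrite mul1r.
  by move=> /(_ (fun=> isT)); rewrite ler_norml => /andP[+ _]; move: sumle; lra.
have cover : pr (C `&` E) <= \sum_(z <- nbrs y) pr (C `&` A z `&` E) + pr (C `&` far).
  have : C `&` E `<=` (\big[setU/set0]_(z <- nbrs y) (C `&` A z `&` E)) `|` (C `&` far).
    move=> w [Cw Ew]; case: (boolP (X (s + h) w \in nbrs y)) => hw.
      by left; rewrite -bigcup_seq; exists (X (s + h) w).
    by right.
  have mU : measurable (\big[setU/set0]_(z <- nbrs y) (C `&` A z `&` E)).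
    by apply: bigsetU_measurable => z _; exact: measurableI.
  have mF : measurable (C `&` far) by exact: measurableI.
  move=> sub; apply: (le_trans (pr_le P _ _ _ _ sub)); [exact: measurableI|exact: measurableU|].
  apply: (le_trans (prU_le P _ _ mU mF)); rewrite lerD2r.
  elim: (nbrs y) => [|z l IH]; first by rewrite !big_nil pr_set0.
  rewrite !big_cons; apply: (le_trans (prU_le P _ _ _ _)).
  - exact: measurableI.
  - by apply: bigsetU_measurable => z' _; exact: measurableI.
  - by rewrite lerD2l.
apply: (le_trans cover).
have S1 : \sum_(z <- nbrs y) pr (C `&` A z `&` E) <=
    a * \sum_(z <- nbrs y) g z * pr (C `&` A z) + b * \sum_(z <- nbrs y) pr (C `&` A z).
  rewrite !mulr_sumr -big_split /=; apply: ler_sum => z _.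
  by rewrite mulrA -mulrDl; exact: H.
have S2 := cyl_nbrs C s y h g cC h01 g01.
have S3 : \sum_(z <- nbrs y) g z * pr (C `&` A z) <=
   pr C * (g y + h * gen g y) + pr C * (step_const * h ^+ 2).
  by move: S2; rewrite ler_norml => /andP[_ +]; rewrite -/A; lra.
have S4 : a * \sum_(z <- nbrs y) g z * pr (C `&` A z) <=
   a * (pr C * (g y + h * gen g y) + pr C * (step_const * h ^+ 2)) by rewrite ler_wpM2l.
have S5 : b * \sum_(z <- nbrs y) pr (C `&` A z) <= b * pr C.
  by rewrite ler_wpM2l // (le_trans sumle) // gerBl pr_ge0.
(* In the coefficient a + 1, the summand a multiplies the Taylor error of g and the summand 1 pays
   for [far]. *)
move: S1 S4 S5 farle; lra.
Qed.

Definition hit_within S H (h : R) (k : nat) (s : R) : set T :=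
  [set w | exists i, [/\ (i <= k)%N, H (X (s + i%:R * h) w) &
     forall j, (j < i)%N -> S (X (s + j%:R * h) w)]].

Definition stay S (h : R) (k : nat) (s : R) : set T :=
  [set w | forall i, (i < k)%N -> S (X (s + i%:R * h) w)].

Lemma measurable_hit_within S H h k s : measurable (hit_within S H h k s).
Proof.
have -> : hit_within S H h k s = \bigcup_(i in [set i | (i <= k)%N])
   (at_time (s + i%:R * h) H `&`
    \bigcap_(j in [set j | (j < i)%N]) at_time (s + j%:R * h) S).
  apply/seteqP; split => w.
    by case=> i [ik Hi Sj]; exists i => //; split => // j /= ji; exact: Sj.
  by case=> i /= ik [Hi Sj]; exists i; split => // j ji; exact: Sj.
apply: bigcup_measurable => i _; apply: measurableI; first exact: measurable_at.
by apply: bigcap_measurableType => j _; exact: measurable_at.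
Qed.

Lemma measurable_stay S h k s : measurable (stay S h k s).
Proof.
have -> : stay S h k s = \bigcap_(j in [set j | (j < k)%N]) at_time (s + j%:R * h) S.
  by apply/seteqP; split.
by apply: bigcap_measurableType => j _; exact: measurable_at.
Qed.

(** Optional stopping on a mesh: g is 1 on H and nonincreasing in mean on S before H is reached, so
    its starting value bounds the hitting probability. Each step costs 2 * [step_const] * h^2, so
    the total error is of order h over a fixed time span k * h. *)
Lemma pr_hit_within S H g (h : R) : 0 <= h <= 1 ->
  (forall y, 0 <= g y <= 1) -> (forall y, H y -> g y = 1) ->
  (forall y, S y -> ~ H y -> gen g y <= 0) ->
  forall k C s y, cyl C s y ->
  pr (C `&` hit_within S H h k s) <= pr C * (g y + k%:R * (2 * step_const * h ^+ 2)).
Proof.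
move=> h01 g01 gH gS; have /andP[h0 _] := h01.
have c0 : 0 <= 2 * step_const * h ^+ 2.
  by apply: mulr_ge0; [apply: mulr_ge0 => //; exact: step_const_ge0|exact: exprn_ge0].
have trivial k C s y : cyl C s y -> H y \/ (~ S y \/ k = 0%N) ->
    pr (C `&` hit_within S H h k s) <= pr C * (g y + k%:R * (2 * step_const * h ^+ 2)).
  move=> cC; have mC := cyl_measurable _ _ _ cC.
  have [Hy _|nHy] := pselect (H y).
    apply: (@le_trans _ _ (pr C)).
      by apply: pr_le => //; exact: (measurableI _ _ mC (measurable_hit_within _ _ _ _ _)).
    by rewrite ler_peMr ?pr_ge0 // gH // lerDl mulr_ge0.
  case=> // H2; rewrite (_ : _ `&` _ = set0).
    rewrite pr_set0; apply: mulr_ge0; first exact: pr_ge0.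
    by apply: addr_ge0; [case/andP: (g01 y)|exact: mulr_ge0].
  apply/seteqP; split => // w [Cw [[|i] [ik Hi Si]]].
    by apply: nHy; move: Hi; rewrite mul0r addr0 (cyl_sub _ _ _ cC _ Cw).
  case: H2 => [nS|k0]; last by rewrite k0 in ik.
  by apply: nS; have := Si 0%N isT; rewrite mul0r addr0 (cyl_sub _ _ _ cC _ Cw).
elim=> [|k IH] C s y cC; first by apply: trivial => //; right; right.
have [Hy|nHy] := pselect (H y); first by apply: trivial => //; left.
have [Sy|nSy] := pselect (S y); last by apply: trivial => //; right; left.
have mC := cyl_measurable _ _ _ cC.
(* The start is not in H, so the hit occurs at a step i + 1 and the event restarts one mesh step
   later. *)
have sub : C `&` hit_within S H h k.+1 s `<=` C `&` hit_within S H h k (s + h).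
  move=> w [Cw [[|i] [ik Hi Si]]].
    by exfalso; apply: nHy; move: Hi; rewrite mul0r addr0 (cyl_sub _ _ _ cC _ Cw).
  split => //; exists i; split => //.
    by move: Hi; rewrite -natr1 mulrDl mul1r addrA addrAC.
  by move=> j ji; have := Si j.+1 ji; rewrite -natr1 mulrDl mul1r addrA addrAC.
apply: (le_trans (pr_le P _ _ _ _ sub)).
- exact: (measurableI _ _ mC (measurable_hit_within _ _ _ _ _)).
- exact: (measurableI _ _ mC (measurable_hit_within _ _ _ _ _)).
have := cyl_step C s y h g 1 (k%:R * (2 * step_const * h ^+ 2)) _ cC h01
  (measurable_hit_within S H h k (s + h)) g01 ler01 (mulr_ge0 (ler0n _ _) c0).
move=> /(_ _)/le_trans; apply.
  move=> z; rewrite mul1r [leRHS]mulrC.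
  by apply: IH; exact: (cyl_next _ _ _ _ _ cC h0).
rewrite ler_wpM2l ?pr_ge0 // mul1r -(natr1 k).
have gle := gS y Sy nHy.
have : h * gen g y <= 0 by rewrite mulr_ge0_le0.
lra.
Qed.

Lemma pr_stay S g (h kap eta M : R) : 0 <= h <= 1 -> 0 < eta ->
  (forall y, 0 <= g y <= 1) ->
  (forall y, S y -> gen g y <= kap * g y) ->
  forall k, (forall j, (j <= k)%N -> expR (kap * (j%:R * h)) <= M) ->
  forall C s y, cyl C s y ->
  pr (C `&` (stay S h k s `&` at_time (s + k%:R * h) [set z | eta <= g z])) <=
  pr C * (expR (kap * (k%:R * h)) / eta * g y + k%:R * ((M / eta + 1) * step_const * h ^+ 2)).
Proof.
move=> h01 eta0 g01 gS.
have mE k s : measurable (stay S h k s `&` at_time (s + k%:R * h) [set z | eta <= g z]).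
  by apply: measurableI; [exact: measurable_stay|exact: measurable_at].
elim=> [|k IH] HM C s y cC; have mC := cyl_measurable _ _ _ cC.
  rewrite mul0r mulr0 expR0 addr0 mul0r addr0 mul1r.
  have [gy|gy] := leP eta (g y).
    apply: (@le_trans _ _ (pr C)).
      by apply: pr_le => //; apply: measurableI => //; have := mE 0%N s; rewrite mul0r addr0.
    by rewrite ler_peMr ?pr_ge0 // mulrC ler_pdivlMr ?mul1r.
  rewrite (_ : _ `&` _ = set0).
    rewrite pr_set0; apply: mulr_ge0; first exact: pr_ge0.
    by apply: mulr_ge0; [rewrite invr_ge0 ltW|case/andP: (g01 y)].
  apply/seteqP; split => // w [Cw [_]]; rewrite /at_time /= (cyl_sub _ _ _ cC _ Cw).
  by rewrite leNgt gy.
have M0 : 0 <= M by apply: le_trans (HM 0%N isT); rewrite expR_ge0.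
have c0 : 0 <= (M / eta + 1) * step_const * h ^+ 2.
  apply: mulr_ge0; last by apply: exprn_ge0; case/andP: h01.
  by apply: mulr_ge0; [rewrite addr_ge0 ?divr_ge0 // ltW|exact: step_const_ge0].
set E := stay _ _ _ _ `&` _.
have mE1 : measurable E by exact: mE.
have [Sy|nSy] := pselect (S y); last first.
  rewrite (_ : C `&` E = set0).
    rewrite pr_set0; apply: mulr_ge0; first exact: pr_ge0.
    apply: addr_ge0; last exact: mulr_ge0.
    by apply: mulr_ge0; [rewrite divr_ge0 ?expR_ge0 ?ltW|case/andP: (g01 y)].
  apply/seteqP; split => // w [Cw [/(_ 0%N isT)]].
  by rewrite mul0r addr0 (cyl_sub _ _ _ cC _ Cw).
have sub : C `&` E `<=` C `&` (stay S h k (s + h) `&` at_time (s + h + k%:R * h) [set z | eta <= g z]).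
  move=> w [Cw [st fi]]; split => //; split.
    by move=> i ik; have := st i.+1 ik; rewrite -natr1 mulrDl mul1r addrA addrAC.
  by move: fi; rewrite /at_time -natr1 mulrDl mul1r addrA addrAC.
apply: (le_trans (pr_le P _ _ _ _ sub)).
- exact: measurableI.
- by apply: measurableI.
have a0 : 0 <= expR (kap * (k%:R * h)) / eta by rewrite divr_ge0 ?expR_ge0 ?ltW.
have := cyl_step C s y h g (expR (kap * (k%:R * h)) / eta)
  (k%:R * ((M / eta + 1) * step_const * h ^+ 2)) _ cC h01
  (mE k (s + h)) g01 a0 (mulr_ge0 (ler0n _ _) c0).
move=> /(_ _)/le_trans; apply.
  move=> z; rewrite [leRHS]mulrC; apply: IH.
    by move=> j jk; apply: HM; rewrite leqW.
  by apply: (cyl_next _ _ _ _ _ cC); case/andP: h01.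
rewrite ler_wpM2l ?pr_ge0 //.
have -> : kap * (k.+1%:R * h) = kap * (k%:R * h) + kap * h by rewrite -natr1; ring.
rewrite expRD.
have g0 : 0 <= g y by case/andP: (g01 y).
have h0 : 0 <= h by case/andP: h01.
(* The inequality 1 + kap * h <= exp(kap * h) holds for both signs of kap; g >= 0 allows multiplying
   by it. *)
have A1 : g y + h * gen g y <= expR (kap * h) * g y.
  apply: (@le_trans _ _ ((1 + kap * h) * g y)).
    by have ? := ler_wpM2l h0 (gS y Sy); lra.
  by rewrite ler_wpM2r // expR_ge1Dx.
have A2 : expR (kap * (k%:R * h)) / eta * (g y + h * gen g y) <=
    expR (kap * (k%:R * h)) / eta * (expR (kap * h) * g y) by rewrite ler_wpM2l.
have A3 : (expR (kap * (k%:R * h)) / eta + 1) * step_const * h ^+ 2 <=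
   (M / eta + 1) * step_const * h ^+ 2.
  have HMk := HM k (leqnSn k).
  apply: ler_wpM2r; first exact: exprn_ge0.
  apply: ler_wpM2r; first exact: step_const_ge0.
  by rewrite lerD2r; apply: ler_wpM2r => //; rewrite invr_ge0 ltW.
rewrite -(natr1 k) mulrDl mul1r.
have -> : expR (kap * (k%:R * h)) * expR (kap * h) / eta * g y =
   expR (kap * (k%:R * h)) / eta * (expR (kap * h) * g y) by ring.
move: A2 A3; lra.
Qed.

(** * Dyadic times *)

(* Paths are inspected at dyadic times only; right-continuity of the paths is used
   just once, in [real_time_limit]. *)
Definition mesh (m : nat) : R := (2 ^+ m)^-1.
Definition dy (m i : nat) : R := i%:R * mesh m.

Lemma mesh_gt0 m : 0 < mesh m.
Proof. by rewrite /mesh invr_gt0 exprn_gt0. Qed.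

Lemma mesh_le1 m : mesh m <= 1.
Proof. by rewrite /mesh invf_le1 ?exprn_gt0 // exprn_ege1 // ler1n. Qed.

Lemma mesh01 m : 0 <= mesh m <= 1.
Proof. by rewrite mesh_le1 ltW ?mesh_gt0. Qed.

Lemma meshD m p : mesh (m + p) * 2 ^+ p = mesh m.
Proof.
by rewrite /mesh exprD invfM -mulrA mulVf ?mulr1 // expf_neq0.
Qed.

Lemma mesh_mul m : (2 ^ m)%:R * mesh m = 1.
Proof. by rewrite /mesh natrX mulfV // expf_neq0. Qed.

Lemma mesh_small (c e : R) : 0 < e -> exists m0, forall m, (m0 <= m)%N -> c * mesh m <= e.
Proof.
move=> e0; exists (Num.bound (`|c| / e)) => m m0m.
have lt : `|c| / e < m%:R.
  by apply: (lt_le_trans (archi_boundP _)); rewrite ?ler_nat // divr_ge0 // ltW.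
have m2 : m%:R <= 2 ^+ m :> R by rewrite -natrX ler_nat ltnW // ltn_expl.
rewrite /mesh ler_pdivrMr ?exprn_gt0 //.
apply: (le_trans (ler_norm c)).
rewrite mulrC -ler_pdivrMr //; exact: (le_trans (ltW lt) m2).
Qed.

Lemma le_mesh (a b c : R) m0 :
  (forall m, (m0 <= m)%N -> a <= b + c * mesh m) -> a <= b.
Proof.
move=> H; apply/ler_addgt0Pr => e e0.
have [m1 Hm1] := mesh_small c e e0.
have := H (maxn m0 m1) (leq_maxl _ _).
by have := Hm1 (maxn m0 m1) (leq_maxr _ _) => ? ?; lra.
Qed.

Lemma dy_ge0 m i : 0 <= dy m i.
Proof. by rewrite mulr_ge0 // ltW // mesh_gt0. Qed.

Lemma dy_nat m k : dy m (k * 2 ^ m) = k%:R.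
Proof. by rewrite /dy natrM -mulrA mesh_mul mulr1. Qed.

Lemma dy_refine m p i : dy m i = dy (m + p) (i * 2 ^ p).
Proof. by rewrite /dy natrM natrX -mulrA [2 ^+ p * _]mulrC meshD. Qed.

Lemma dyD m i m' i' : dy m i + dy m' i' = dy (m + m') (i * 2 ^ m' + i' * 2 ^ m).
Proof.
by rewrite (dy_refine m m') (dy_refine m' m) addnC -mulrDl -natrD.
Qed.

Lemma dyB m i m' i' : dy m i <= dy m' i' ->
  dy m' i' = dy m i + dy (m + m') (i' * 2 ^ m - i * 2 ^ m').
Proof.
rewrite (dy_refine m m') (dy_refine m' m) addnC.
rewrite /dy ler_pM2r ?mesh_gt0 // ler_nat => le.
by rewrite -mulrDl -natrD subnKC.
Qed.

Definition forever S s : set T := [set w | forall m i, S (X (s + dy m i) w)].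
Definition ever H s : set T := [set w | exists m i, H (X (s + dy m i) w)].

Lemma measurable_forever S s : measurable (forever S s).
Proof.
have -> : forever S s = \bigcap_m \bigcap_i at_time (s + dy m i) S.
  by apply/seteqP; split => w; [move=> H m _ i _; exact: H|move=> H m i; exact: (H m I i I)].
by do 2 (apply: bigcap_measurableType => ? _); exact: measurable_at.
Qed.

Lemma measurable_ever H s : measurable (ever H s).
Proof.
have -> : ever H s = \bigcup_m \bigcup_i at_time (s + dy m i) H.
  by apply/seteqP; split => w; [move=> [m [i Hi]]; exists m => //; exists i|move=> [m _ [i _ Hi]]; exists m, i].
by do 2 (apply: bigcupT_measurable => ?); exact: measurable_at.
Qed.

(** The horizon m and the resolution 2^-m improve together, so a single index exhausts all dyadic
    times. *)
Definition hit_dy H s (m : nat) : set T := hit_within setT H (mesh m) (m * 2 ^ m) s.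

Lemma hit_dy_homo H s : {homo hit_dy H s : m p / (m <= p)%N >-> m `<=` p}.
Proof.
move=> m p mp w [i [im Hi _]]; exists (i * 2 ^ (p - m))%N; split => //.
  have -> : (p * 2 ^ p)%N = (p * 2 ^ m * 2 ^ (p - m))%N by rewrite -mulnA -expnD subnKC.
  by rewrite leq_mul2r (leq_trans im) ?orbT // leq_mul2r mp orbT.
move: Hi; rewrite -/(dy m i) -/(dy p _).
by have := dy_refine m (p - m) i; rewrite subnKC // => ->.
Qed.

Lemma everE H s : ever H s = \bigcup_m hit_dy H s m.
Proof.
apply/seteqP; split => w; last by move=> [m _ [i [_ Hi _]]]; exists m, i.
(* Level m + i is fine enough to contain the time, and its horizon exceeds i >= i * 2^-m. *)
move=> [m [i Hi]]; pose p := (m + i)%N; exists p => //.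
exists (i * 2 ^ i)%N; split => //.
  by apply: leq_mul; rewrite ?leq_addl // leq_pexp2l // leq_addl.
by move: Hi; rewrite (dy_refine m i) /dy.
Qed.

(** The maximal inequality for a nonnegative supermartingale: the error of [pr_hit_within]
    disappears as the mesh is refined at a fixed horizon, and only then does the horizon grow. *)
Lemma pr_ever C s y H g : cyl C s y -> (forall y, 0 <= g y <= 1) ->
  (forall y, H y -> g y = 1) -> (forall y, ~ H y -> gen g y <= 0) ->
  pr (C `&` ever H s) <= pr C * g y.
Proof.
move=> cC g01 gH gen0; rewrite everE setI_bigcupr.
have mC := cyl_measurable _ _ _ cC.
have mh m : measurable (hit_dy H s m) by exact: measurable_hit_within.
apply: pr_bigcup_le => [m|m p mp|m].
- exact: measurableI.
- by apply: setIS; exact: hit_dy_homo.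
(* Horizon m with mesh p: m * 2^p steps, each costing O(2^-2p), add up to O(m * 2^-p). *)
apply: (le_mesh _ _ (pr C * (m%:R * (2 * step_const))) m) => p mp.
have sub : C `&` hit_dy H s m `<=`
    C `&` hit_within setT H (mesh p) (m * 2 ^ p) s.
  apply: setIS => w [i [im Hi _]]; exists (i * 2 ^ (p - m))%N; split => //.
    have -> : (m * 2 ^ p)%N = (m * 2 ^ m * 2 ^ (p - m))%N by rewrite -mulnA -expnD subnKC.
    by rewrite leq_mul2r im orbT.
  move: Hi; rewrite -/(dy m i) -/(dy p _).
  by have := dy_refine m (p - m) i; rewrite subnKC // => ->.
apply: (le_trans (pr_le P _ _ _ _ sub)).
- exact: measurableI.
- by apply: measurableI => //; exact: measurable_hit_within.
have := pr_hit_within setT H g (mesh p) (mesh01 p) g01 gH (fun y _ => gen0 y)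
  (m * 2 ^ p) C s y cC.
move/le_trans; apply.
have -> : pr C * g y + pr C * (m%:R * (2 * step_const)) * mesh p =
  pr C * (g y + m%:R * (2 * step_const) * mesh p) by ring.
rewrite ler_wpM2l ?pr_ge0 // lerD2l natrM expr2.
rewrite [leLHS](_ : _ = m%:R * (2 * step_const) * mesh p * ((2 ^ p)%:R * mesh p)); last by ring.
by rewrite mesh_mul mulr1.
Qed.

(** Any prescribed list of jumps is carried out, one jump per mesh step, with probability at least c
    per jump, uniformly in the state. The bound c <= 1/2 keeps 1 - c^K nonnegative in later uses. *)
Lemma push_const : exists m0 (c : R), 0 < c <= 1 / 2 /\
  forall C s y (js : seq 'I_n), cyl C s y ->
  exists C', [/\ cyl C' (s + (size js)%:R * mesh m0) (incrs y js), C' `<=` C &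
    c ^+ size js * pr C <= pr C'].
Proof.
(* A lower bound for all rates; the entry 1 is there to give c <= 1/2. *)
pose bm := Num.min 1 (Num.min b0 (Num.min b1 b2)).
have bm0 : 0 < bm by rewrite !lt_min ltr01 b0_gt0 b1_gt0.
have bm1 : bm <= 1 by rewrite ge_min lexx.
have bmv v : bm <= beta b0 b1 b2 v.
  by rewrite /bm /beta; case: ifP => _; [|case: ifP => _]; rewrite !ge_min lexx ?orbT.
(* The mesh h is so fine that the Taylor error is at most half of the first-order term h * bm, which
   leaves c = h * bm / 2. *)
have [m0 /(_ m0 (leqnn _)) Hm0] := mesh_small (taylor_const b0 b1 b2 (n := n)) (bm / 2) (divr_gt0 bm0 (ltr0n R 2)).
have me0 := mesh_gt0 m0; have me1 := mesh_le1 m0.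
pose c := mesh m0 * bm / 2.
have cE : c = mesh m0 * bm / 2 by [].
have c0 : 0 < c by rewrite divr_gt0 ?mulr_gt0.
clearbody c; exists m0, c; split.
  by rewrite c0 cE ler_pM2r ?invr_gt0 // mulr_ile1 // ltW.
move=> C s y js; elim: js C s y => [|j js IH] C s y cC.
  by exists C; split => //; rewrite ?expr0 ?mul1r // mul0r addr0.
have cC1 := cyl_next _ _ _ _ (incr y j) cC (ltW me0).
have [C' [cC' sub le]] := IH _ _ _ cC1.
exists C'; split.
- by move: cC'; rewrite /= -(natr1 (size js)) mulrDl mul1r addrA addrAC.
- by move=> w /sub [].
apply: le_trans le; rewrite exprSr -mulrA.
apply: ler_wpM2l; first by rewrite exprn_ge0 // ltW.
rewrite (cyl_markov _ _ _ _ _ cC (ltW me0)) mulrC ler_wpM2l ?pr_ge0 // cE.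
have := Ptrans_taylor b0 b1 b2 b0_gt0 b1_gt0 b2_gt0 (mesh m0) y (incr y j) (mesh01 m0).
rewrite Qpow1_incr eq_sym (negbTE (incr_neq _ _)) add0r ler_norml => /andP[H _].
have H2 : mesh m0 * bm <= mesh m0 * beta b0 b1 b2 (Vj y j) by rewrite ler_wpM2l // ltW.
have H3 : (taylor_const b0 b1 b2 (n := n)) * mesh m0 * mesh m0 <= bm / 2 * mesh m0.
  by rewrite ler_wpM2r // ltW.
by move: H; rewrite expr2 => H; lra.
Qed.

Definition eventually_in S : set T :=
  [set w | exists N : nat, forall m i, N%:R <= dy m i -> S (X (dy m i) w)].

(** * Absorption, transience and speeds *)

Section Absorption.
Variables (Wk G : set (state n)) (g : state n -> R) (K : nat).
Hypothesis g01 : forall y, 0 <= g y <= 1.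
Hypothesis gG : forall y, ~ G y -> g y = 1.
Hypothesis gen_g : forall y, G y -> gen g y <= 0.
Hypothesis Wk_push : forall y, Wk y ->
  exists2 js : seq 'I_n, size js = K & g (incrs y js) <= 1 / 2.

(** The failure of the dichotomy: arbitrarily late visits to [Wk] and arbitrarily late exits from
    [G]. *)
Let alternating s : set T := [set w | forall N : nat,
  (exists m i, N%:R <= dy m i /\ Wk (X (s + dy m i) w)) /\
  (exists m i, N%:R <= dy m i /\ ~ G (X (s + dy m i) w))].

Let measurable_alternating s : measurable (alternating s).
Proof.
have -> : alternating s = \bigcap_(N : nat)
   ((\bigcup_m \bigcup_(i in [set i | N%:R <= dy m i]) at_time (s + dy m i) Wk) `&`
    (\bigcup_m \bigcup_(i in [set i | N%:R <= dy m i]) at_time (s + dy m i) (~` G))).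
  apply/seteqP; split => w.
    move=> H N _; have [[m [i [h1 h2]]] [m' [i' [h1' h2']]]] := H N.
    by split; [exists m => //; exists i|exists m' => //; exists i'].
  move=> H N; have [[m _ [i h1 h2]] [m' _ [i' h1' h2']]] := H N I.
  by split; [exists m, i|exists m', i'].
apply: bigcap_measurableType => N _.
by apply: measurableI; do 2 (apply: bigcup_measurable => ? _); exact: measurable_at.
Qed.

(** A tail event survives a shift of its starting time, so it can be re-examined after any
    conditioning. *)
Let alternating_shift s m0 i0 : alternating s `<=` alternating (s + dy m0 i0).
Proof.
move=> w H N.
have le : dy m0 i0 <= (N + i0)%:R.
  rewrite natrD /dy; apply: (@le_trans _ _ i0%:R); last by rewrite lerDr.
  by rewrite ler_piMr // mesh_le1.
have shift m i : (N + i0)%:R <= dy m i -> exists m' i', N%:R <= dy m' i' /\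
   s + dy m i = s + dy m0 i0 + dy m' i'.
  move=> Nle; have E := dyB _ _ _ _ (le_trans le Nle).
  exists (m0 + m)%N, (i * 2 ^ m0 - i0 * 2 ^ m)%N; rewrite -addrA -E; split => //.
  have : i0%:R * mesh m0 <= i0%:R by rewrite ler_piMr // mesh_le1.
  move: Nle; rewrite natrD {1}E -/(dy m0 i0); lra.
have [[m [i [h1 h2]]] [m' [i' [h1' h2']]]] := H (N + i0)%N.
split.
  by have [p [j [? E]]] := shift _ _ h1; exists p, j; rewrite -E.
by have [p [j [? E]]] := shift _ _ h1'; exists p, j; rewrite -E.
Qed.

(* Push to g <= 1/2; from there the complement of G is hit with probability at most 1/2. *)
Let alternating_weak : exists q : R, 0 < q < 1 /\ forall C s z, cyl C s z -> Wk z ->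
  pr (C `&` alternating s) <= q * pr C.
Proof.
have [m0 [c [/andP[c0 c1] push]]] := push_const.
(* The push succeeds with probability at least c^K, and given success at least half of the mass
   never leaves [G]. *)
exists (1 - c ^+ K / 2); split.
  have cK0 : 0 < c ^+ K by rewrite exprn_gt0.
  have cK1 : c ^+ K <= 1 by rewrite exprn_ile1 ?ltW //; lra.
  by apply/andP; split; lra.
move=> C s z cC Wz; have mC := cyl_measurable _ _ _ cC.
have [js sz gle] := Wk_push z Wz.
have [C' [cC' sub le]] := push C s z js cC.
have mC' := cyl_measurable _ _ _ cC'.
have mA := measurable_alternating s.
have mCA := measurableI _ _ mC mA.
rewrite (pr_setID P _ C' mCA mC').
have H1 : pr (C `&` alternating s `&` C') <= pr C' * (1 / 2).
  apply: (@le_trans _ _ (pr (C' `&` ever (~` G) (s + (size js)%:R * mesh m0)))).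
    apply: pr_le => //; first exact: measurableI.
      by apply: measurableI => //; exact: measurable_ever.
    move=> w [[_ Aw] C'w]; split => //.
    have [_ [m [i [_ nG]]]] := alternating_shift s m0 (size js) w Aw 0%N.
    by exists m, i.
  apply: (le_trans (pr_ever _ _ _ (~` G) g cC' g01 gG _)).
    by move=> y /contrapT; exact: gen_g.
  by rewrite ler_wpM2l ?pr_ge0.
have H2 : pr ((C `&` alternating s) `\` C') <= pr C - pr C'.
  rewrite (pr_setID P C C' mC mC') (_ : C `&` C' = C'); last exact/setIidPr.
  rewrite addrC addKr; apply: pr_le; [exact: measurableD|exact: measurableD|].
  by move=> w [[]].
move: le; rewrite sz; lra.
Qed.

(** Alternation forces a visit to [Wk], and at the first visit on the mesh the bound of
    [alternating_weak] applies. The induction on the number of steps, with [pr_partition] over the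
    next state, does the work of the strong Markov property. *)
Let alternating_le : exists q : R, 0 < q < 1 /\ forall C s y, cyl C s y ->
  pr (C `&` alternating s) <= q * pr C.
Proof.
have [q [/[dup] q01 /andP[q0 q1] weak]] := alternating_weak; exists q; split => // C s y cC.
have mA s' : measurable (alternating s') by exact: measurable_alternating.
have mh h k s' : measurable (hit_within setT Wk h k s') by exact: measurable_hit_within.
have main m : forall k C s y, cyl C s y ->
    pr (C `&` (alternating s `&` hit_within setT Wk (mesh m) k s)) <= q * pr C.
  have trivial k C' s' y' : cyl C' s' y' -> Wk y' \/ k = 0%N ->
      pr (C' `&` (alternating s' `&` hit_within setT Wk (mesh m) k s')) <= q * pr C'.
    move=> cC'; have mC' := cyl_measurable _ _ _ cC'.
    have [Wy _|nWy] := pselect (Wk y').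
      apply: le_trans (weak _ _ _ cC' Wy); apply: pr_le; last by apply: setIS => w [].
        by apply: measurableI => //; exact: measurableI.
      exact: measurableI.
    case=> // ->; rewrite (_ : _ `&` _ = set0) ?pr_set0 ?mulr_ge0 ?pr_ge0 ?ltW //.
    apply/seteqP; split => // w [Cw [_ [i [i0 Wi _]]]]; apply: nWy; move: Wi.
    by move: i0; rewrite leqn0 => /eqP ->; rewrite mul0r addr0 (cyl_sub _ _ _ cC' _ Cw).
  elim=> [|k IH] C' s' y' cC'; first by apply: (trivial _ _ _ _ cC'); right.
  have [Wy|nWy] := pselect (Wk y'); first by apply: (trivial _ _ _ _ cC'); left.
  have mC' := cyl_measurable _ _ _ cC'.
  have h0 : 0 <= mesh m by rewrite ltW // mesh_gt0.
  apply: (@le_trans _ _ (pr (C' `&` (alternating (s' + mesh m) `&`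
     hit_within setT Wk (mesh m) k (s' + mesh m))))).
    apply: pr_le.
    - by apply: measurableI => //; exact: measurableI.
    - by apply: measurableI => //; exact: measurableI.
    move=> w [Cw [Aw [[|i] [ik Wi _]]]].
      by exfalso; apply: nWy; move: Wi; rewrite mul0r addr0 (cyl_sub _ _ _ cC' _ Cw).
    split => //; split.
      by have := alternating_shift s' m 1 w Aw; rewrite /dy mul1r.
    by exists i; split => //; move: Wi; rewrite -(natr1 i) mulrDl mul1r addrA addrAC.
  apply: (pr_partition P _ (X (s' + mesh m))) => //.
  - exact: measurableI.
  - by move=> v; exact: measurable_eq_at.
  - exact: (ltW q0).
  - by move=> v; apply: (IH _ _ v); exact: (cyl_next _ _ _ _ _ cC' h0).
have mC := cyl_measurable _ _ _ cC.
have -> : C `&` alternating s = \bigcup_m (C `&` (alternating s `&` hit_dy Wk s m)).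
  rewrite -setI_bigcupr -setI_bigcupr -everE; congr (_ `&` _).
  apply/esym/setIidPl => w Aw; have [[m [i [_ Wi]]] _] := Aw 0%N.
  by exists m, i.
apply: pr_bigcup_le => [m|m p mp|m].
- by apply: measurableI => //; apply: measurableI => //; exact: mh.
- by apply: setIS; apply: setIS; exact: hit_dy_homo.
- exact: (main m _ _ _ _ cC).
Qed.

(* The event [alternating 0] is approximated from outside by events [part N M]
   about finitely many times, given which it has conditional probability at most
   q < 1; hence it is null. *)
Lemma absorption : {ae P, forall w, eventually_in G w \/ eventually_in (~` Wk) w}.
Proof.
have [q [/andP[q0 q1] Hq]] := alternating_le.
have mA := measurable_alternating 0.
(* The whole path on the mesh M up to time M; fixing its value is a cylinder event ending at time
   M. *)
pose vec M w : {ffun 'I_(M * 2 ^ M).+1 -> state n} := [ffun i : 'I_(M * 2 ^ M).+1 => X (dy M i) w].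
have vecE M v : [set w | vec M w = v] =
    [set w | forall i, (i <= M * 2 ^ M)%N -> X (dy M i) w = v (inord i)].
  apply/seteqP; split => w /=.
    by move=> <- i iM; rewrite ffunE inordK.
  by move=> H; apply/ffunP => i; rewrite ffunE H ?inord_val // -ltnS.
have vec_cyl M v : cyl [set w | vec M w = v] (dy M (M * 2 ^ M)) (v (inord (M * 2 ^ M))).
  exists (M * 2 ^ M)%N, (dy M), (fun i => v (inord i)); split => //.
  - exact: dy_ge0.
  - by move=> i _; apply: ler_wpM2r; rewrite ?ler_nat // ltW // mesh_gt0.
pose part N M : set T := [set w |
  (exists i, [/\ (i <= M * 2 ^ M)%N, N%:R <= dy M i & Wk (X (dy M i) w)]) /\
  (exists i, [/\ (i <= M * 2 ^ M)%N, N%:R <= dy M i & ~ G (X (dy M i) w)])].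
have mpart N M : measurable (part N M).
  have -> : part N M =
     (\bigcup_(i in [set i | (i <= M * 2 ^ M)%N /\ N%:R <= dy M i]) at_time (dy M i) Wk) `&`
     (\bigcup_(i in [set i | (i <= M * 2 ^ M)%N /\ N%:R <= dy M i]) at_time (dy M i) (~` G)).
    apply/seteqP; split => w.
      by move=> [[i [? ? ?]] [j [? ? ?]]]; split; [exists i|exists j].
    by move=> [[i [? ?] ?] [j [? ?] ?]]; split; [exists i|exists j].
  by apply: measurableI; apply: bigcup_measurable => i _; exact: measurable_at.
have part_homo N : {homo part N : m p / (m <= p)%N >-> m `<=` p}.
  move=> m p mp.
  have up (S : set (state n)) w :
      (exists i, [/\ (i <= m * 2 ^ m)%N, N%:R <= dy m i & S (X (dy m i) w)]) ->
      (exists i, [/\ (i <= p * 2 ^ p)%N, N%:R <= dy p i & S (X (dy p i) w)]).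
    move=> [i [im Ni Si]]; exists (i * 2 ^ (p - m))%N.
    have -> : dy p (i * 2 ^ (p - m)) = dy m i by rewrite (dy_refine m (p - m)) subnKC.
    split => //.
    have -> : (p * 2 ^ p)%N = (p * 2 ^ m * 2 ^ (p - m))%N by rewrite -mulnA -expnD subnKC.
    by rewrite leq_mul2r (leq_trans im) ?orbT // leq_mul2r mp orbT.
  by move=> w [H1 H2]; split; [exact: up _ _ H1|exact: up (~` G) _ H2].
have in_part N w : alternating 0 w -> exists M, part N M w.
  move=> /(_ N) [[m [i]]]; rewrite add0r => -[h1 h2] [m' [i']].
  rewrite add0r => -[h1' h2'].
  have fit (S : set (state n)) a j : N%:R <= dy a j -> S (X (dy a j) w) ->
     exists M, exists k, [/\ (k <= M * 2 ^ M)%N, N%:R <= dy M k & S (X (dy M k) w)].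
    move=> Na Sa; exists (a + j)%N, (j * 2 ^ j)%N; rewrite -dy_refine; split => //.
    by apply: leq_mul; rewrite ?leq_addl // leq_pexp2l // leq_addl.
  have [M HM] := fit Wk _ _ h1 h2; have [M' HM'] := fit (~` G) _ _ h1' h2'.
  exists (maxn M M').
  have lift (S : set (state n)) a : (a <= maxn M M')%N ->
      (exists i, [/\ (i <= a * 2 ^ a)%N, N%:R <= dy a i & S (X (dy a i) w)]) ->
      (exists i, [/\ (i <= maxn M M' * 2 ^ maxn M M')%N, N%:R <= dy (maxn M M') i &
        S (X (dy (maxn M M') i) w)]).
    move=> aM [k [ka Nk Sk]]; exists (k * 2 ^ (maxn M M' - a))%N.
    rewrite (_ : dy _ _ = dy a k); last by rewrite (dy_refine a (maxn M M' - a)) subnKC.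
    split => //.
    have -> : (maxn M M' * 2 ^ maxn M M')%N =
       (maxn M M' * 2 ^ a * 2 ^ (maxn M M' - a))%N by rewrite -mulnA -expnD subnKC.
    by rewrite leq_mul2r (leq_trans ka) ?orbT // leq_mul2r aM orbT.
  by split; [exact: lift _ _ (leq_maxl _ _) HM|exact: lift (~` G) _ (leq_maxr _ _) HM'].
(* [vec M] decides membership in [part N M], which is thus a disjoint union of cylinder events; on
   each one the alternation, shifted to time M, has conditional probability at most q. *)
have key N M : pr (part N M `&` alternating 0) <= q * pr (part N M).
  apply: (pr_partition P _ (vec M)) => //; last first.
  - move=> v; have [[w [pw vw]]|no] := pselect (exists w, part N M w /\ vec M w = v).
      have sub : [set w | vec M w = v] `<=` part N M.
        move=> w' w'v; have eqX i : (i <= M * 2 ^ M)%N -> X (dy M i) w' = X (dy M i) w.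
          move=> iM; have : vec M w' (inord i) = vec M w (inord i) by rewrite w'v vw.
          by rewrite !ffunE inordK.
        move: pw => [[i [? ? ?]] [j [? ? ?]]].
        by split; [exists i|exists j]; rewrite eqX.
      have -> : part N M `&` [set w | vec M w = v] = [set w | vec M w = v] by exact/setIidPr.
      apply: le_trans (Hq _ _ _ (vec_cyl M v)).
      have mv := cyl_measurable _ _ _ (vec_cyl M v).
      apply: pr_le; [exact: measurableI|exact: measurableI|].
      apply: setIS => w' /(alternating_shift 0 M (M * 2 ^ M)).
      by rewrite add0r.
    have -> : part N M `&` [set w | vec M w = v] = set0.
      by apply/seteqP; split => // w [pw vw]; apply: no; exists w.
    by rewrite set0I pr_set0 mulr0.
  - exact: (ltW q0).
  - by move=> v; exact: (cyl_measurable _ _ _ (vec_cyl M v)).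
pose U N := \bigcup_M part N M.
have mU N : measurable (U N) by apply: bigcupT_measurable.
have UA N : pr (alternating 0) <= q * pr (U N).
  have -> : alternating 0 = \bigcup_M (part N M `&` alternating 0).
    apply/seteqP; split => w; last by case=> M _ [].
    by move=> Aw; have [M pM] := in_part N w Aw; exists M.
  apply: pr_bigcup_le => [M|m p mp|M].
  - exact: measurableI.
  - by apply: setSI; exact: part_homo.
  apply: (le_trans (key N M)); rewrite ler_pM2l //.
  by apply: pr_le => // w pw; exists M.
have capU : \bigcap_N U N `<=` alternating 0.
  move=> w H N; have [M _ [[i [_ ? ?]] [j [_ ? ?]]]] := H N I.
  by split; [exists M, i|exists M, j]; rewrite add0r.
(* Each [U N] has probability at least pr (alternating 0) / q, and their decreasing intersection
   lies inside [alternating 0]. With q < 1 the probability must be 0. *)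
have : pr (alternating 0) / q <= pr (\bigcap_N U N).
  apply: pr_bigcap_decr => // [m p mp|N].
    move=> w [M _ [[i [? le1 ?]] [j [? le2 ?]]]]; exists M => //.
    by split; [exists i|exists j]; split => //;
       rewrite ?(le_trans _ le1) ?(le_trans _ le2) // ler_nat.
  by rewrite ler_pdivrMr // mulrC.
have mcap : measurable (\bigcap_N U N) by apply: bigcap_measurableType.
have := pr_le P _ _ mcap mA capU.
move=> le1 le2; have : pr (alternating 0) <= q * pr (alternating 0).
  by rewrite mulrC -ler_pdivrMr // (le_trans le2).
move=> le3; have neg : P.-negligible (alternating 0).
  apply: pr_negligible => //; rewrite leNgt; apply/negP => pos.
  have : q * pr (alternating 0) < pr (alternating 0) by rewrite gtr_pMl.
  by rewrite ltNge le3.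
apply: negligibleS neg => w /= /not_orP[nG nW] N; split.
  move: nW => /forallNP/(_ N)/existsNP[m /existsNP[i /not_implyP[le /contrapT Wi]]].
  by exists m, i; rewrite add0r.
move: nG => /forallNP/(_ N)/existsNP[m /existsNP[i /not_implyP[le nGi]]].
by exists m, i; rewrite add0r.
Qed.

End Absorption.

(** * Truncation and transience *)

Lemma gen_le_scale g (f : state n -> R) (a : R) y :
  (forall j, g (incr y j) - g y <= a * (f (incr y j) - f y)) ->
  gen g y <= a * gen f y.
Proof.
move=> H; rewrite /generator mulr_sumr; apply: ler_sum => j _.
by rewrite mulrCA ler_wpM2l // ltW // beta_gt0.
Qed.

Lemma gen_le0 g y : (forall j, g (incr y j) <= g y) -> gen g y <= 0.
Proof.
move=> H; apply: sumr_le0 => j _.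
by rewrite mulr_ge0_le0 ?subr_le0 // ltW // beta_gt0.
Qed.

(** Makes f admissible for the [0,1]-valued estimates. Below level a the minimum can only reduce the
    value after a jump; above it the function is already maximal, so its drift is at most 0. *)
Definition truncate (f : state n -> R) (a : R) : state n -> R :=
  fun y => Num.min 1 (f y / a).

Lemma truncate01 (f : state n -> R) a : 0 < a -> (forall y, 0 <= f y) ->
  forall y, 0 <= truncate f a y <= 1.
Proof.
move=> a0 f0 y; rewrite /truncate ge_min lexx andbT le_min ler01.
by rewrite divr_ge0 // ltW.
Qed.

Lemma truncate1 (f : state n -> R) a y : 0 < a -> a <= f y -> truncate f a y = 1.
Proof. by move=> a0 af; rewrite /truncate min_l // ler_pdivlMr ?mul1r. Qed.

Lemma gen_truncate_le (f : state n -> R) a y : 0 < a -> f y <= a ->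
  gen (truncate f a) y <= a^-1 * gen f y.
Proof.
move=> a0 fa; apply: gen_le_scale => j.
have -> : truncate f a y = f y / a.
  by rewrite /truncate min_r // ler_pdivrMr ?mul1r.
have : truncate f a (incr y j) <= f (incr y j) / a by rewrite /truncate ge_min lexx orbT.
by move=> ?; lra.
Qed.

Lemma gen_truncate_le0 (f : state n -> R) a y : 0 < a -> a <= f y ->
  gen (truncate f a) y <= 0.
Proof.
move=> a0 af; apply: gen_le0 => j; rewrite (truncate1 _ _ y a0 af).
by rewrite /truncate ge_min lexx.
Qed.

Section Transience.
Variables (A : set (state n)) (f : state n -> R).
Hypothesis f_ge0 : forall y, 0 <= f y.
Hypothesis gen_f : forall y, A y -> gen f y <= 0.
Hypothesis f_push : forall lam : R, exists K : nat, forall y, A y ->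
  exists2 js : seq 'I_n, size js = K & lam <= f (incrs y js).

(** In each period of length h the K pushes lift f to [lam] with probability at least c^K. The r + 1
    observation times enclose r such periods, hence the exponent r. *)
Let pr_stay_bounded lam m0 c K (h := K%:R * mesh m0) B :
  B = A `&` [set y | f y < lam] -> 0 < c <= 1 / 2 ->
  (forall C s y (js : seq 'I_n), cyl C s y ->
  exists C', [/\ cyl C' (s + (size js)%:R * mesh m0) (incrs y js), C' `<=` C &
    c ^+ size js * pr C <= pr C']) ->
  (forall y, A y -> exists2 js : seq 'I_n, size js = K & lam <= f (incrs y js)) ->
  forall r C s y, cyl C s y ->
  pr (C `&` stay B h r.+1 s) <= (1 - c ^+ K) ^+ r * pr C.
Proof.
move=> BE /andP[c0 c1] push fK.
have h0 : 0 <= h by rewrite mulr_ge0 // ltW // mesh_gt0.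
have cK0 : 0 <= 1 - c ^+ K.
  by rewrite subr_ge0 exprn_ile1 ?ltW //; lra.
have mS k s : measurable (stay B h k s) by exact: measurable_stay.
elim=> [|r IH] C s y cC; have mC := cyl_measurable _ _ _ cC.
  by rewrite expr0 mul1r; apply: pr_le => //; exact: measurableI.
have [By|nBy] := pselect (B y); last first.
  rewrite (_ : _ `&` _ = set0); first by rewrite pr_set0 mulr_ge0 ?exprn_ge0 ?pr_ge0.
  apply/seteqP; split => // w [Cw /(_ 0%N isT)].
  by rewrite mul0r addr0 (cyl_sub _ _ _ cC _ Cw).
pose D := C `&` at_time (s + h) B.
have mD : measurable D by apply: measurableI => //; exact: measurable_at.
have DC : pr D <= (1 - c ^+ K) * pr C.
  have [js sz le] := fK y ltac:(by move: By; rewrite BE => -[]).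
  have [C' [cC' sub]] := push C s y js cC.
  have mC' := cyl_measurable _ _ _ cC'.
  rewrite sz mulrBl mul1r => le'.
  have HD : pr D <= pr (C `\` C').
    apply: pr_le => //; first exact: measurableD.
    move=> w [Cw Bw]; split => // C'w; move: Bw; rewrite /at_time /= BE => -[_ /=].
    have := cyl_sub _ _ _ cC' _ C'w; rewrite sz /= -/h => ->.
    by rewrite ltNge le.
  have := pr_setID P C C' mC mC'; rewrite (_ : C `&` C' = C'); last exact/setIidPr.
  by move=> E; move: HD le'; rewrite E => ? ?; lra.
apply: (@le_trans _ _ (pr (D `&` stay B h r.+1 (s + h)))).
  apply: pr_le; [exact: measurableI|exact: measurableI|].
  move=> w [Cw st]; split.
    by split => //; have := st 1%N isT; rewrite mul1r.
  by move=> i ir; have := st i.+1 ir; rewrite -(natr1 i) mulrDl mul1r addrA addrAC.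
apply: (@le_trans _ _ ((1 - c ^+ K) ^+ r * pr D)); last first.
  by rewrite exprSr -mulrA ler_wpM2l // exprn_ge0.
apply: (pr_partition P _ (X (s + h))) => //; last first.
- move=> v; have [Bv|nBv] := pselect (B v).
    have -> : D `&` [set w | X (s + h) w = v] = C `&` [set w | X (s + h) w = v].
      apply/seteqP; split => w [] => [[Cw _] xv|Cw xv]; split => //; split => //.
      by rewrite /at_time /= xv.
    by apply: IH; exact: (cyl_next _ _ _ _ _ cC h0).
  have -> : D `&` [set w | X (s + h) w = v] = set0.
    by apply/seteqP; split => // w [[_ Bw] xv]; apply: nBv; rewrite -xv.
  by rewrite set0I pr_set0 mulr0.
- by rewrite exprn_ge0.
- by move=> v; exact: measurable_eq_at.
Qed.

(* Staying in A forever forces f to reach every level lam, which costs f y / lam. *)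
Let pr_forever_le0 C s y : cyl C s y -> pr (C `&` forever A s) <= 0.
Proof.
move=> cC; have mC := cyl_measurable _ _ _ cC.
have mF : measurable (forever A s) by exact: measurable_forever.
have [m0 [c [c01 push]]] := push_const.
apply/ler_addgt0Pr => e e0; rewrite add0r.
(* Chosen so that f y / lam <= e; the summand 1 keeps [lam] positive. *)
pose lam := (f y + 1) / e.
have fy1 : 0 < f y + 1 by rewrite ltr_wpDl.
have lam0 : 0 < lam by rewrite divr_gt0.
have [K fK] := f_push lam.
pose B := A `&` [set y | f y < lam].
pose H := [set y | lam <= f y].
pose h := K%:R * mesh m0.
have /andP[c0 c1] := c01.
have q0 : 0 <= 1 - c ^+ K by rewrite subr_ge0 exprn_ile1 ?ltW //; lra.
have q1 : 1 - c ^+ K < 1 by rewrite gtrBl exprn_gt0.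
apply: (@le_trans _ _ (pr C * truncate f lam y)); last first.
  apply: (@le_trans _ _ (truncate f lam y)).
    by apply: ler_piMl; [case/andP: (truncate01 f lam lam0 f_ge0 y)|exact: pr_le1].
  rewrite /truncate ge_min; apply/orP; right.
  rewrite /lam invf_div mulrA ler_pdivrMr // mulrC ler_pM2l //; lra.
apply: (le_geometric _ _ (pr C) _ q0 q1) => r.
apply: (le_mesh _ _ (pr C * (r%:R * h * (2 * step_const))) m0) => m m0m.
(* The number of fine mesh steps in r push periods; m >= m0 puts the ends of the periods on the fine
   mesh. *)
pose k := (r * K * 2 ^ (m - m0))%N.
have kE i : dy m (i * K * 2 ^ (m - m0)) = i%:R * h.
  by rewrite /h mulrA -natrM -/(dy m0 (i * K)) (dy_refine m0 (m - m0)) subnKC.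
have mh : measurable (hit_within A H (mesh m) k s) by exact: measurable_hit_within.
have ms : measurable (stay B h r.+1 s) by exact: measurable_stay.
(* Either the level [lam] is reached on the mesh by time r * h, or f is below it at all the times 0,
   h, ..., r * h. *)
have sub : C `&` forever A s `<=`
    (C `&` hit_within A H (mesh m) k s) `|` (C `&` stay B h r.+1 s).
  move=> w [Cw Fw]; have [hw|nhw] := pselect (hit_within A H (mesh m) k s w).
    by left.
  right; split => // i ir.
  have E := kE i; rewrite -E; split; first exact: Fw.
  rewrite /= ltNge; apply/negP => le; apply: nhw.
  exists (i * K * 2 ^ (m - m0))%N; split => //; last by move=> j _; exact: Fw.
  by rewrite leq_mul2r leq_mul2r -ltnS ir !orbT.
apply: (le_trans (pr_le P _ _ _ _ sub)).
- exact: measurableI.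
- by apply: measurableU; exact: measurableI.
apply: (le_trans (prU_le P _ _ _ _)); [exact: measurableI|exact: measurableI|].
have genA z : A z -> ~ H z -> gen (truncate f lam) z <= 0.
  move=> Az /negP; rewrite -ltNge => /ltW fz.
  apply: (le_trans (gen_truncate_le f lam z lam0 fz)).
  by apply: mulr_ge0_le0; [rewrite invr_ge0 ltW|exact: gen_f].
have H1 := pr_hit_within A H (truncate f lam) (mesh m) (mesh01 m)
   (truncate01 f lam lam0 f_ge0) (fun z => truncate1 f lam z lam0) genA k C s y cC.
have H2 := pr_stay_bounded lam m0 c K B erefl c01 push fK r C s y cC.
apply: (le_trans (lerD H1 H2)).
have E : k%:R * mesh m = r%:R * h by rewrite -(kE r).
have -> : k%:R * (2 * step_const * mesh m ^+ 2) = (r%:R * h) * (2 * step_const) * mesh m.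
  by rewrite -E; ring.
by rewrite le_eqVlt; apply/orP; left; apply/eqP; ring.
Qed.

Lemma transience : {ae P, forall w, ~ eventually_in A w}.
Proof.
have negl N : P.-negligible (forever A (N%:R)).
  have mF : measurable (forever A N%:R) by exact: measurable_forever.
  apply: pr_negligible => //; rewrite -[forever _ _]setTI -[leRHS](mul0r (pr setT)).
  apply: (pr_partition P _ (X N%:R)) => // v; first exact: measurable_eq_at.
  by rewrite setTI mul0r; apply: pr_forever_le0; apply: cyl_at; rewrite ler0n.
apply: (negligibleS _ (negligible_bigcup negl)) => w /= /contrapT [N HN].
exists N => // m i; rewrite -(dy_nat m N) dyD; apply: HN.
by rewrite -dyD dy_nat lerDl dy_ge0.
Qed.
End Transience.

(** * Exponential bounds and the law of large numbers *)

Lemma pr_forever_at S g (kap eta : R) : 0 < eta ->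
  (forall y, 0 <= g y <= 1) -> (forall y, S y -> gen g y <= kap * g y) ->
  forall (t : nat) C s y, cyl C s y ->
  pr (C `&` (forever S s `&` at_time (s + t%:R) [set z | eta <= g z])) <=
  pr C * (expR (kap * t%:R) / eta * g y).
Proof.
move=> eta0 g01 gS t C s y cC; have mC := cyl_measurable _ _ _ cC.
pose M := expR (`|kap| * t%:R).
have mB : measurable (at_time (s + t%:R) [set z | eta <= g z]) by exact: measurable_at.
have mf : measurable (forever S s) by exact: measurable_forever.
apply: (le_mesh _ _ (pr C * (t%:R * ((M / eta + 1) * step_const))) 0) => m _.
pose k := (t * 2 ^ m)%N.
have kE : k%:R * mesh m = t%:R by rewrite -/(dy m k) dy_nat.
have HM j : (j <= k)%N -> expR (kap * (j%:R * mesh m)) <= M.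
  move=> jk; rewrite ler_expR.
  have j0 : 0 <= j%:R * mesh m by rewrite mulr_ge0 // ltW // mesh_gt0.
  apply: (@le_trans _ _ (`|kap| * (j%:R * mesh m))); first by rewrite ler_wpM2r // ler_norm.
  by rewrite ler_wpM2l // -kE ler_wpM2r ?ler_nat // ltW // mesh_gt0.
have ms : measurable (stay S (mesh m) k s) by exact: measurable_stay.
have H := pr_stay S g (mesh m) kap eta M (mesh01 m) eta0 g01 gS k HM C s y cC.
rewrite kE in H.
apply: (@le_trans _ _ (pr (C `&` (stay S (mesh m) k s `&` at_time (s + t%:R) [set z | eta <= g z])))).
  apply: pr_le.
  - by apply: measurableI => //; exact: measurableI.
  - by apply: measurableI => //; exact: measurableI.
  by move=> w [Cw [Fw Bw]]; split => //; split => // i _; exact: (Fw m i).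
apply: (le_trans H); rewrite le_eqVlt; apply/orP; left; apply/eqP.
have -> : k%:R * ((M / eta + 1) * step_const * mesh m ^+ 2) =
  t%:R * ((M / eta + 1) * step_const) * mesh m by rewrite -kE; ring.
ring.
Qed.

(** Markov's inequality gives probabilities of order exp((kap - a) t), and Borel-Cantelli concludes.
    The alternative concerns boundedness: above the truncation level the drift is only known to be
    at most 0, which fits under kap when kap >= 0; a function with G <= 1 is used untruncated, with
    any sign of kap. *)
Lemma growth S (G : state n -> R) (kap a : R) : (forall y, 0 <= G y) ->
  (forall y, S y -> gen G y <= kap * G y) ->
  0 <= kap \/ (forall y, G y <= 1) -> kap < a ->
  {ae P, forall w, eventually_in S w ->
     exists K : nat, forall k, (K <= k)%N -> G (X k%:R w) < expR (a * k%:R)}.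
Proof.
move=> G0 genG alt ka.
have bound (lam : R) (t : nat) C s y : 0 < lam -> cyl C s y ->
  pr (C `&` (forever S s `&` at_time (s + t%:R) [set z | lam <= G z])) <=
  pr C * (expR (kap * t%:R) / lam * G y).
  move=> lam0 cC; have mC := cyl_measurable _ _ _ cC.
  case: alt => [kap0|G1]; last first.
    by apply: (pr_forever_at S G kap lam) => // z; rewrite G0 G1.
  have mf : measurable (forever S s) by exact: measurable_forever.
  have gent z : S z -> gen (truncate G lam) z <= kap * truncate G lam z.
    move=> Sz; have [le|/ltW le] := leP (G z) lam.
      apply: (le_trans (gen_truncate_le _ _ _ lam0 le)).
      rewrite /truncate min_r; last by rewrite ler_pdivrMr ?mul1r.
      by rewrite mulrA [leRHS]mulrC ler_pM2l ?invr_gt0 // genG.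
    apply: (le_trans (gen_truncate_le0 _ _ _ lam0 le)).
    by rewrite truncate1 // mulr1.
  have := pr_forever_at S (truncate G lam) kap 1 ltr01 (truncate01 G lam lam0 G0) gent t C s y cC.
  move=> H; apply: (@le_trans _ _ (pr (C `&` (forever S s `&`
      at_time (s + t%:R) [set z | 1 <= truncate G lam z])))).
    apply: pr_le.
    - by apply: measurableI => //; apply: measurableI => //; exact: measurable_at.
    - by apply: measurableI => //; apply: measurableI => //; exact: measurable_at.
    by move=> w [Cw [Fw Bw]]; split => //; split => //; rewrite /at_time /= truncate1.
  apply: (le_trans H); rewrite divr1 ler_wpM2l ?pr_ge0 //.
  rewrite -mulrA ler_wpM2l ?expR_ge0 // mulrC /truncate ge_min.
  by rewrite lexx orbT.
(* Freezing the integer entry time N and the state y there leaves countably many exceptional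
   sets. *)
pose bad N y t : set T := [set w | X N%:R w = y] `&`
  (forever S N%:R `&` at_time (N%:R + t%:R) [set z | expR (a * (N + t)%:R) <= G z]).
have negl N y : P.-negligible (lim_sup_set (bad N y)).
  apply: (@pr_limsup_geometric _ _ _ P _
    (pr [set w | X N%:R w = y] * (expR (- (a * N%:R)) * G y)) (expR (kap - a))).
  - by rewrite expR_ge0 expR_lt1 subr_lt0.
  - move=> t; apply: measurableI; first exact: measurable_eq_at.
    by apply: measurableI; [exact: measurable_forever|exact: measurable_at].
  move=> t; have cN := cyl_at _ y (ler0n R N).
  apply: (le_trans (bound _ t _ _ _ (expR_gt0 _) cN)).
  rewrite -[leRHS]mulrA ler_wpM2l ?pr_ge0 // [leRHS]mulrAC ler_wpM2r //.
  rewrite -expRM_natr -expRN -!expRD ler_expR natrD.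
  by rewrite le_eqVlt; apply/orP; left; apply/eqP; ring.
have neg2 : P.-negligible (\bigcup_N \bigcup_y lim_sup_set (bad N y)).
  by apply: negligible_bigcup => N; exact: negligible_countable_bigcup.
apply: negligibleS neg2 => w /= /not_implyP[[N HN] /forallNP HK].
exists N => //; exists (X N%:R w) => // M _.
have /existsNP[k /not_implyP[Mk /negP]] := HK (N + M)%N.
rewrite -leNgt => le; exists (k - N)%N => /=; first lia.
split => //; split.
  move=> m i; rewrite -(dy_nat m N) dyD; apply: HN.
  by rewrite -dyD dy_nat lerDl dy_ge0.
by rewrite /at_time -natrD /= subnKC //; lia.
Qed.

(** From 1 - u <= exp(-u), exp(u) is at most 1/(1 - u), and (1 - u)(1 + u + 2u^2) = 1 + u^2 (1 - 2u)
    >= 1. *)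
Lemma expR_le_quad (u : R) : u <= 1 / 2 -> expR u <= 1 + u + 2 * u ^+ 2.
Proof.
move=> u2; have := expR_ge1Dx (- u); rewrite expRN => H.
have p1 : 0 < 1 - u by lra.
have e0 := expR_gt0 u.
have : (1 - u) * expR u <= 1.
  by rewrite -ler_pdivlMr // div1r.
move=> H1; have H2 : 1 <= (1 - u) * (1 + u + 2 * u ^+ 2).
  have : 0 <= u ^+ 2 * (1 - 2 * u) by rewrite mulr_ge0 ?sqr_ge0 //; lra.
  by rewrite !expr2 => ?; lra.
by rewrite -(ler_pM2l p1) (le_trans H1).
Qed.

(* e^u <= 1 + u + 2 u^2 turns the drift of f into an exponential growth rate of e^(theta f). *)
Lemma gen_expR (f : state n -> R) (theta L : R) y : 0 <= L ->
  (forall j, `|f (incr y j) - f y| <= L) -> `|theta| * L <= 1 / 2 ->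
  gen (fun z => expR (theta * f z)) y <=
  (theta * gen f y + theta ^+ 2 * (2 * L ^+ 2 * (n%:R * (b0 + b1 + b2)))) * expR (theta * f y).
Proof.
move=> L0 fL tL; rewrite mulrC /generator.
have -> : theta * (\sum_(j < n) beta b0 b1 b2 (Vj y j) * (f (incr y j) - f y)) +
   theta ^+ 2 * (2 * L ^+ 2 * (n%:R * (b0 + b1 + b2))) =
   \sum_(j < n) (theta * (beta b0 b1 b2 (Vj y j) * (f (incr y j) - f y)) +
     theta ^+ 2 * (2 * L ^+ 2 * (b0 + b1 + b2))).
  rewrite big_split /= -mulr_sumr sumr_const card_ord -mulr_natl; congr (_ + _); ring.
rewrite mulr_sumr; apply: ler_sum => j _.
set D := f (incr y j) - f y.
have -> : expR (theta * f (incr y j)) - expR (theta * f y) =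
    expR (theta * f y) * (expR (theta * D) - 1).
  by rewrite mulrBr mulr1 -expRD; congr (expR _ - _); rewrite /D; ring.
rewrite mulrCA ler_wpM2l ?expR_ge0 //.
have bp := beta_gt0 b0 b1 b2 b0_gt0 b1_gt0 b2_gt0 (Vj y j).
have bl := beta_le b0 b1 b2 b0_gt0 b1_gt0 b2_gt0 (Vj y j).
set b := beta _ _ _ _ in bp bl *.
have DL : `|theta * D| <= `|theta| * L by rewrite normrM; apply: ler_wpM2l => //; exact: fL.
have q := expR_le_quad (theta * D) (le_trans (ler_norm _) (le_trans DL tL)).
have D2 : D ^+ 2 <= L ^+ 2 by rewrite -[D ^+ 2]real_normK ?num_real // ler_sqr ?nnegrE //; exact: fL.
have H1 : b * (expR (theta * D) - 1) <= b * (theta * D + 2 * (theta * D) ^+ 2).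
  by apply: ler_wpM2l; [exact: ltW|lra].
apply: (le_trans H1).
have -> : b * (theta * D + 2 * (theta * D) ^+ 2) = theta * (b * D) + theta ^+ 2 * (2 * (b * D ^+ 2)) by ring.
rewrite lerD2l ler_wpM2l ?sqr_ge0 // -mulrA ler_wpM2l //.
by rewrite mulrC ler_pM ?sqr_ge0 // ltW.
Qed.

Lemma deviation S (f : state n -> R) (L c del : R) : 0 < L -> 0 <= c -> 0 < del ->
  (forall y, 0 <= f y) -> (forall y j, `|f (incr y j) - f y| <= L) ->
  (forall y, S y -> gen f y = c) ->
  {ae P, forall w, eventually_in S w -> exists K : nat, forall k, (K <= k)%N ->
     `|f (X k%:R w) - c * k%:R| < del * k%:R}.
Proof.
move=> L0 c0 del0 f0 fL genf.
pose Q := 2 * L ^+ 2 * (n%:R * (b0 + b1 + b2)).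
have Q0 : 0 <= Q.
  apply: mulr_ge0; first by apply: mulr_ge0 => //; exact: sqr_ge0.
  by apply: mulr_ge0 => //; move: b0_gt0 b1_gt0 b2_gt0 => ? ? ?; lra.
(* The first bound makes the quadratic estimate of the exponential applicable; the second keeps th^2
   * Q below th * del. *)
pose th := Num.min ((2 * L)^-1) (del / (2 * (Q + 1))).
have th0 : 0 < th by rewrite /th lt_min invr_gt0 divr_gt0 ?mulr_gt0 // ltr_wpDl.
have thL : th * L <= 1 / 2.
  apply: (@le_trans _ _ ((2 * L)^-1 * L)); first by rewrite ler_pM2r // /th ge_min lexx.
  by rewrite invfM -mulrA mulVf ?gt_eqF // mulr1 mul1r.
have thQ : th ^+ 2 * Q < th * del.
  rewrite expr2 -mulrA ltr_pM2l //.
  apply: (@le_lt_trans _ _ (del / (2 * (Q + 1)) * Q)).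
    by rewrite ler_wpM2r // /th ge_min lexx orbT.
  rewrite mulrAC ltr_pdivrMr ?mulr_gt0 ?ltr_wpDl // ltr_pM2l //; lra.
have Lup y j : `|f (incr y j) - f y| <= L by exact: fL.
have ntL : `|th| * L <= 1 / 2 by rewrite gtr0_norm.
have ntL' : `|- th| * L <= 1 / 2 by rewrite normrN gtr0_norm.
(* A Chernoff bound on each side. The upper one has a nonnegative rate; the rate of the lower one
   may be negative, but exp(- th f) <= 1 because f >= 0, so each fits one alternative of
   [growth]. *)
have up := growth S (fun z => expR (th * f z)) (th * c + th ^+ 2 * Q) (th * (c + del))
  (fun z => expR_ge0 _).
have lo := growth S (fun z => expR (- th * f z)) (- th * c + th ^+ 2 * Q) (- th * (c - del))
  (fun z => expR_ge0 _).
have {}up : {ae P, forall w, eventually_in S w ->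
     exists K : nat, forall k, (K <= k)%N -> expR (th * f (X k%:R w)) < expR (th * (c + del) * k%:R)}.
  apply: up; last lra.
    by move=> y Sy; have := gen_expR f th L y (ltW L0) (Lup y) ntL; rewrite genf.
  left; apply: addr_ge0; first by apply: mulr_ge0 => //; exact: ltW.
  by apply: mulr_ge0 => //; exact: sqr_ge0.
have {}lo : {ae P, forall w, eventually_in S w ->
     exists K : nat, forall k, (K <= k)%N -> expR (- th * f (X k%:R w)) < expR (- th * (c - del) * k%:R)}.
  apply: lo; last lra.
    by move=> y Sy; have := gen_expR f (- th) L y (ltW L0) (Lup y) ntL'; rewrite genf // sqrrN.
  by right=> y; rewrite -expR0 ler_expR mulNr oppr_le0 mulr_ge0 // ltW.
apply: filterS2 up lo => w up lo ev.
have [K1 H1] := up ev; have [K2 H2] := lo ev.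
exists (maxn K1 K2) => k; rewrite geq_max => /andP[/H1 + /H2].
rewrite !ltr_expR -!mulrA !mulNr ltrN2 !ltr_pM2l // => ? ?.
by rewrite ltr_norml; apply/andP; split; lra.
Qed.

Lemma law_of_large_numbers S (f : state n -> R) (L c : R) : 0 < L -> 0 <= c ->
  (forall y, 0 <= f y) -> (forall y j, `|f (incr y j) - f y| <= L) ->
  (forall y, S y -> gen f y = c) ->
  {ae P, forall w, eventually_in S w ->
     f (X k%:R w) / k%:R @[k --> \oo] --> c}.
Proof.
move=> L0 c0 f0 fL genf.
have H : {ae P, forall w, forall p : nat, eventually_in S w ->
    exists K : nat, forall k, (K <= k)%N ->
    `|f (X k%:R w) - c * k%:R| < p.+1%:R^-1 * k%:R}.
  by apply: ae_foralln => p; apply: (deviation S f L c).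
apply: filterS H => w Hw ev; apply/cvgrPdist_lt => e e0.
have [p pe] : exists p : nat, p.+1%:R^-1 < e.
  exists (Num.bound e^-1); rewrite invf_plt ?posrE //.
  by apply: (lt_trans (archi_boundP _)); rewrite ?invr_ge0 ?ltW // ltr_nat.
have [K HK] := Hw p ev; exists K.+1 => // k /= Kk.
have k0 : 0 < k%:R :> R by rewrite ltr0n (leq_ltn_trans (leq0n K) Kk).
have := HK k (ltnW Kk); rewrite -ltr_pdivrMr // => lt; apply: lt_trans pe.
apply: le_lt_trans lt; rewrite distrC.
have -> : f (X k%:R w) / k%:R - c = (f (X k%:R w) - c * k%:R) / k%:R.
  by rewrite mulrBl mulfK // gt_eqF.
by rewrite normrM normfV (gtr0_norm k0).
Qed.

(** A decrease between two dyadic times would be a transition outside the support of [Ptrans]; there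
    are countably many pairs of times and of states. *)
Lemma monotone_path : {ae P, forall w, forall m i m' i',
  dy m i <= dy m' i' -> forall j, (X (dy m i) w j <= X (dy m' i') w j)%N}.
Proof.
do 4 (apply: ae_foralln => ?).
set s := dy _ _; set t := dy _ _.
have [st|nst] := pselect (s <= t); last by apply: aeW => w.
pose bad (yz : state n * state n) : set T :=
  if [forall j, yz.1 j <= yz.2 j]%N then set0
  else [set w | X s w = yz.1] `&` [set w | X (s + (t - s)) w = yz.2].
have negl yz : P.-negligible (bad yz).
  rewrite /bad; case: ifPn => [_|nle]; first exact: negligible_set0.
  apply: pr_negligible; first by apply: measurableI; exact: measurable_eq_at.
  rewrite (cyl_markov _ s yz.1) ?subr_ge0 //; last by apply: cyl_at; exact: dy_ge0.
  by rewrite Ptrans_supp // mulr0.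
apply: negligibleS (negligible_countable_bigcup P _ _ negl) => w /= /not_implyP[_ /existsNP[j /negP nle]].
exists (X s w, X t w) => //; rewrite /bad /=; case: ifPn => [/forallP/(_ j)|_].
  by rewrite (negbTE nle).
by split => //=; rewrite subrKC.
Qed.

Lemma gen_seq (s : seq 'I_n) g y : uniq s ->
  (forall j, j \notin s -> g (incr y j) = g y) ->
  gen g y = \sum_(j <- s) bt (Vj y j) * (g (incr y j) - g y).
Proof.
move=> us gs; rewrite /generator (bigID (mem s)) /= [X in _ + X]big1 => [|j js].
  by rewrite addr0 big_uniq.
by rewrite gs // subrr mulr0.
Qed.

(** * Persistence of local extrema *)

Section Peak.
Hypotheses (b10 : b1 < b0) (b20 : b2 < b0).

(** The gambler's-ruin ratio: the height difference grows at rate b0 and shrinks at a rate of at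
    most max(b1, b2), since a neighbour of a strict peak has at least one higher neighbour. *)
Let rho : R := Num.max b1 b2 / b0.

Let rho01 : 0 < rho < 1.
Proof. by rewrite /rho divr_gt0 ?lt_max ?b1_gt0 // ltr_pdivrMr // mul1r gt_max b10 b20. Qed.

Let gen_peak_decay (i : 'I_n) (k : nat) y : k = i \/ k = i.+2 -> strict_peak i y ->
  gen (fun z => rho ^+ (z i - coord z k)) y <= 0.
Proof.
move=> ki peak; have /andP[r0 r1] := rho01.
have ki' : (k == i.+1) = false by case: ki => ->; [exact: ltn_eqF|exact: gtn_eqF].
have ck : (coord y k < y i)%N by case: ki => ->; case: peak.
(* Next to the boundary only the peak itself moves, so the difference can only grow. *)
have [[l kl]|k0] := coordP (n := n) k; last first.
  rewrite (gen_seq [:: i]) // => [|j]; last first.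
    by rewrite inE => ji; rewrite incrE !k0 eq_sym (negbTE ji) addn0.
  rewrite big_seq1; apply: mulr_ge0_le0; first exact: ltW (bt_gt0 _).
  rewrite subr_le0 !k0 incrE eqxx !subn0 addn1 exprSr.
  by apply: ler_piMr; [exact: exprn_ge0 (ltW r0)|exact: ltW].
have li : l != i by apply/eqP => E; move: ki'; rewrite kl E eqxx.
rewrite (gen_seq [:: i; l]); last first.
- move=> j; rewrite !inE negb_or => /andP[ji jl].
  rewrite incrE coord_incr kl eqSS ![_ == val j]eq_sym.
  by rewrite ![_ == nat_of_ord _](inj_eq val_inj) eq_sym (negbTE ji) (negbTE jl) !addn0.
- by rewrite /= inE eq_sym li.
rewrite big_cons big_seq1 !incrE !coord_incr ki' eqxx kl eqxx addn0.
rewrite (eq_sym i) (negbTE li) !addn0 /= !addn1 subnS.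
have -> : bt (Vj y i) = b0 by rewrite strict_peak_Vj.
have bl : bt (Vj y l) <= b0 * rho.
  rewrite /rho mulrC divfK ?gt_eqF //.
  have nb : (l.+1 = i :> nat) \/ (l = i.+1 :> nat).
    by case: ki => E; [left|right]; move: kl; rewrite E // => -[].
  have := neighbor_of_peak_Vj y i l peak nb.
  by rewrite /beta; case: (Vj y l) => [|[|v]] //= _; rewrite le_max lexx ?orbT.
move: ck; rewrite kl coordE => ck.
have [e eE] : exists e, (y i - y l = e.+1)%N.
  by exists (y i - y l).-1; rewrite prednK // subn_gt0.
rewrite subSn ?(ltnW ck) // eE /= !exprS.
have -> : b0 * (rho * (rho * rho ^+ e) - rho * rho ^+ e) +
   bt (Vj y l) * (rho ^+ e - rho * rho ^+ e) =
   rho ^+ e * (1 - rho) * (bt (Vj y l) - b0 * rho) by ring.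
apply: mulr_ge0_le0; last by rewrite subr_le0.
by apply: mulr_ge0; [exact: exprn_ge0 (ltW r0)|rewrite subr_ge0 ltW].
Qed.

Lemma peak_absorption i : {ae P, forall w,
  eventually_in (strict_peak i) w \/ eventually_in (~` weak_peak i) w}.
Proof.
have /andP[r0 r1] := rho01.
pose f z : R := rho ^+ (z i - coord z i) + rho ^+ (z i - coord z i.+2).
have f0 z : 0 <= f z by rewrite addr_ge0 // exprn_ge0 // ltW.
(* Two such terms stay below the threshold 1/2 of [absorption]; from a weak peak, K jumps of the
   centre make both differences at least K. *)
have [K HK] : exists K, rho ^+ K <= 1 / 4.
  have cv := @cvg_expr R rho; rewrite ger0_norm ?ltW // in cv.
  have /cvgrPdist_le/(_ (1 / 4)) := cv r1.
  move=> /(_ _)[|K _ HK]; first by lra.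
  by exists K; have := HK K (leqnn _); rewrite /= sub0r normrN ger0_norm // exprn_ge0 // ltW.
apply: (absorption (weak_peak i) (strict_peak i) (truncate f 1) K).
- exact: truncate01.
- move=> y /not_andP npeak; apply: truncate1 => //.
  rewrite /f; case: npeak => /negP; rewrite -leqNgt -subn_eq0 => /eqP ->.
    by rewrite expr0 lerDl exprn_ge0 // ltW.
  by rewrite expr0 lerDr exprn_ge0 // ltW.
- move=> y peak; have [le|/ltW le] := leP (f y) 1; last exact: gen_truncate_le0.
  apply: (le_trans (gen_truncate_le _ _ _ ltr01 le)); rewrite invr1 mul1r.
  have -> : gen f y = gen (fun z => rho ^+ (z i - coord z i)) y +
                      gen (fun z => rho ^+ (z i - coord z i.+2)) y.
    by rewrite /generator -big_split /=; apply: eq_bigr => j _; rewrite /f; ring.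
  by rewrite -[leRHS]addr0; apply: lerD; apply: gen_peak_decay => //; [left|right].
- move=> y [wl wr]; exists (nseq K i); first by rewrite size_nseq.
  have cE k : k != i.+1 -> coord (incrs y (nseq K i)) k = coord y k.
    move=> ki; elim: (K) (y) => //= m IH z.
    by rewrite IH coord_incr (negbTE ki) addn0.
  rewrite /truncate ge_min divr1; apply/orP; right.
  rewrite /f !cE ?neq_ltn ?leqnn ?orbT //.
  rewrite incrsE count_nseq /= eqxx mul1n.
  have pw a : (a <= y i)%N -> rho ^+ (y i + K - a) <= 1 / 4.
    move=> ai; rewrite -addnBAC // exprD; apply: le_trans HK.
    by apply: ler_piMl; [exact: exprn_ge0 (ltW r0)|apply: exprn_ile1; exact: ltW].
  by have := pw _ wl; have := pw _ wr => ? ?; lra.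
Qed.

End Peak.

Section Pit.
Hypotheses (b20 : b2 < b0) (b21 : b2 < b1).

(** Here the roles are reversed: the pit closes the gap at rate b2, while each neighbour, having at
    most one higher neighbour, widens it at rate b0 or b1. *)
Let rho : R := b2 / Num.min b0 b1.

Let min_gt0 : 0 < Num.min b0 b1.
Proof. by rewrite lt_min b0_gt0. Qed.

Let rho01 : 0 < rho < 1.
Proof. by rewrite /rho divr_gt0 // ltr_pdivrMr // mul1r lt_min b20. Qed.

Let gen_pit_decay (i l : 'I_n) y : (l.+1 = i :> nat) \/ (l = i.+1 :> nat) -> strict_pit i y ->
  gen (fun z => rho ^+ (z l - z i)) y <= 0.
Proof.
move=> li pit; have /andP[r0 r1] := rho01.
have neq : l != i.
  by rewrite -val_eqE /=; case: li => [<-|->]; rewrite neq_ltn leqnn ?orbT.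
have lt : (y i < y l)%N.
  by case: li pit => E [pl pr]; [move: pl; rewrite -E coordE|move: pr; rewrite -E coordE].
rewrite (gen_seq [:: i; l]); last first.
- move=> j; rewrite !inE negb_or => /andP[ji jl].
  by rewrite !incrE (eq_sym i) (eq_sym l) (negbTE ji) (negbTE jl) !addn0.
- by rewrite /= inE eq_sym neq.
rewrite big_cons big_seq1 !incrE !eqxx (eq_sym i) (negbTE neq) !addn0 !addn1 subnS.
have -> : bt (Vj y i) = b2 by rewrite strict_pit_Vj.
have bl : b2 <= bt (Vj y l) * rho.
  rewrite /rho mulrA ler_pdivlMr // mulrC ler_pM2r //.
  have := neighbor_of_pit_Vj y i l pit li.
  by rewrite /beta; case: (Vj y l) => [|[|v]] //= _; rewrite ge_min lexx ?orbT.
have [e eE] : exists e, (y l - y i = e.+1)%N.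
  by exists (y l - y i).-1; rewrite prednK // subn_gt0.
rewrite subSn ?(ltnW lt) // eE /= !exprS.
have -> : b2 * (rho ^+ e - rho * rho ^+ e) +
   bt (Vj y l) * (rho * (rho * rho ^+ e) - rho * rho ^+ e) =
   rho ^+ e * (1 - rho) * (b2 - bt (Vj y l) * rho) by ring.
apply: mulr_ge0_le0; last by rewrite subr_le0.
by apply: mulr_ge0; [exact: exprn_ge0 (ltW r0)|rewrite subr_ge0 ltW].
Qed.

(** A pit is deepened by raising both of its neighbours, K times each; hence both must be true
    sites. *)
Lemma pit_absorption (l i r : 'I_n) : l.+1 = i :> nat -> i.+1 = r :> nat ->
  {ae P, forall w,
  eventually_in (strict_pit i) w \/ eventually_in (~` weak_pit i) w}.
Proof.
move=> li ir; have /andP[r0 r1] := rho01.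
have cl z : coord z i = z l by rewrite -li coordE.
have cr z : coord z i.+2 = z r by rewrite ir coordE.
pose f z : R := rho ^+ (z l - z i) + rho ^+ (z r - z i).
have f0 z : 0 <= f z by rewrite addr_ge0 // exprn_ge0 // ltW.
have [K HK] : exists K, rho ^+ K <= 1 / 4.
  have cv := @cvg_expr R rho; rewrite ger0_norm ?ltW // in cv.
  have /cvgrPdist_le/(_ (1 / 4)) := cv r1.
  move=> /(_ _)[|K _ HK]; first by lra.
  by exists K; have := HK K (leqnn _); rewrite /= sub0r normrN ger0_norm // exprn_ge0 // ltW.
apply: (absorption (weak_pit i) (strict_pit i) (truncate f 1) (K + K)).
- exact: truncate01.
- move=> y /not_andP npit; apply: truncate1 => //.
  rewrite /f -cl -cr; case: npit => /negP; rewrite -leqNgt -subn_eq0 => /eqP ->.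
    by rewrite expr0 lerDl exprn_ge0 // ltW.
  by rewrite expr0 lerDr exprn_ge0 // ltW.
- move=> y pit; have [le|/ltW le] := leP (f y) 1; last exact: gen_truncate_le0.
  apply: (le_trans (gen_truncate_le _ _ _ ltr01 le)); rewrite invr1 mul1r.
  have -> : gen f y = gen (fun z => rho ^+ (z l - z i)) y +
                      gen (fun z => rho ^+ (z r - z i)) y.
    by rewrite /generator -big_split /=; apply: eq_bigr => j _; rewrite /f; ring.
  by rewrite -[leRHS]addr0; apply: lerD; apply: gen_pit_decay => //; [left|right].
- move=> y [wl wr]; exists (nseq K l ++ nseq K r); first by rewrite size_cat !size_nseq.
  rewrite /truncate ge_min divr1; apply/orP; right.
  have ne1 : (l == i) = false by rewrite -val_eqE /= -li ltn_eqF.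
  have ne2 : (r == i) = false by rewrite -val_eqE /= -ir gtn_eqF.
  have ne3 : (r == l) = false by rewrite -val_eqE /= -ir -li gtn_eqF // ltnW.
  rewrite /f !incrsE !count_cat !count_nseq /= !eqxx ne1 ne2 (eq_sym l) ne3 !mul0n !mul1n.
  have pw a : (y i <= a)%N -> rho ^+ (a + K - y i) <= 1 / 4.
    move=> ai; rewrite -addnBAC // exprD; apply: le_trans HK.
    by apply: ler_piMl; [exact: exprn_ge0 (ltW r0)|apply: exprn_ile1; exact: ltW].
  rewrite !addn0 !add0n.
  by have := pw _ wl; have := pw _ wr; rewrite cl cr => ? ?; lra.
Qed.

End Pit.

(** * Patterns that cannot persist *)

(** Off the diagonal the two rates b1 cancel exactly in the drift of the distance; on it both jumps
    would increase the distance, which is why equality is excluded. Raising the higher site reaches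
    any level. *)
Lemma pair_transience (p q : 'I_n) : p != q ->
  {ae P, forall w, ~ eventually_in
     [set y : state n | [/\ y p <> y q, Vj y p = 1%N & Vj y q = 1%N]] w}.
Proof.
move=> pq.
apply: (transience _ (fun y => (ndist (y p) (y q))%:R)) => // [y [ne Vp Vq]|lam].
  rewrite (gen_seq [:: p; q]); last first.
  - move=> j; rewrite !inE negb_or => /andP[jp jq].
    by rewrite !incrE (eq_sym p) (eq_sym q) (negbTE jp) (negbTE jq) !addn0.
  - by rewrite /= inE pq.
  rewrite big_cons big_seq1 Vp Vq !incrE !eqxx (eq_sym q) (negbTE pq) !addn0 !addn1.
  have zero e : e%:R - e.+1%:R + (e.+2%:R - e.+1%:R) = 0 :> R by rewrite -!natr1; ring.
  rewrite -mulrDr.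
  case: (ltngtP (y p) (y q)) ne => // [lt|gt] _.
    by have [e [-> -> ->]] := ndist_lt _ _ lt; rewrite zero mulr0.
  rewrite ![ndist _ (y q)]ndistC [ndist _ (y q).+1]ndistC.
  by have [e [-> -> ->]] := ndist_lt _ _ gt; rewrite addrC zero mulr0.
pose K := Num.bound `|lam|.
have Kle : lam <= K%:R.
  by apply: (le_trans (ler_norm lam)); exact: ltW (archi_boundP (normr_ge0 lam)).
exists K => y [ne _ _].
case: (ltngtP (y p) (y q)) ne => // [lt|gt] _.
  exists (nseq K q); first by rewrite size_nseq.
  rewrite !incrsE !count_nseq /= eqxx (eq_sym q) (negbTE pq) mul0n mul1n addn0.
  apply: (le_trans Kle); rewrite ler_nat /ndist.
  by apply: leq_trans (leq_addl _ _); rewrite addnC -addnBA ?leq_addr // ltnW.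
exists (nseq K p); first by rewrite size_nseq.
rewrite !incrsE !count_nseq /= eqxx (negbTE pq) mul0n mul1n addn0.
apply: (le_trans Kle); rewrite ler_nat /ndist.
by apply: leq_trans (leq_addr _ _); rewrite addnC -addnBA ?leq_addr // ltnW.
Qed.

Let L u v : R := ln (lyap u v)%:R.

Let lyapR_gt0 u v : 0 < (lyap u v)%:R :> R.
Proof. by rewrite ltr0n lyap_gt0. Qed.

Let L_ge0 u v : 0 <= L u v.
Proof. by rewrite ln_ge0 // ler1n lyap_gt0. Qed.

Let LC u v : L u v = L v u.
Proof. by rewrite /L lyapC. Qed.

Let le_L u v u' v' : (u <= u')%N -> (v <= v')%N -> L u v <= L u' v'.
Proof. by move=> uu vv; rewrite ler_ln ?posrE // ler_nat leq_lyap. Qed.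

Let L2 (A B D : nat * nat) :
  (lyap A.1 A.2 * lyap B.1 B.2 <= lyap D.1 D.2 ^ 2)%N ->
  L A.1 A.2 + L B.1 B.2 <= 2 * L D.1 D.2.
Proof.
move=> H; rewrite [2 * _]mulr_natl -lnXn // -lnM ?posrE //.
by rewrite ler_ln ?posrE ?mulr_gt0 ?exprn_gt0 // -natrM -natrX ler_nat.
Qed.

Let L3 (A B C D : nat * nat) :
  (lyap A.1 A.2 * lyap B.1 B.2 * lyap C.1 C.2 <= lyap D.1 D.2 ^ 3)%N ->
  L A.1 A.2 + L B.1 B.2 + L C.1 C.2 <= 3 * L D.1 D.2.
Proof.
move=> H; rewrite [3 * _]mulr_natl -lnXn // -!lnM ?posrE ?mulr_gt0 //.
by rewrite ler_ln ?posrE ?mulr_gt0 ?exprn_gt0 // -!natrM -natrX ler_nat.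
Qed.

Let L_big (lam : R) : exists K : nat, forall u v, (K <= u)%N -> lam <= L u v.
Proof.
exists (Num.bound (expR lam)) => u v Ku.
rewrite -(expRK lam) ler_ln ?posrE ?expR_gt0 //.
apply: (le_trans (ltW (archi_boundP (expR_ge0 _)))); rewrite ler_nat.
apply: (leq_trans Ku); rewrite /lyap leq_max; apply/orP; right.
have : (u <= u ^ 2)%N by case: (u) => // u'; rewrite expnS leq_pmulr // expn_gt0.
move=> le; apply: (leq_trans le); apply: (leq_trans (leq_addr (v ^ 2) _)).
by rewrite leq_pmull.
Qed.

(** Write b1 = b0 + (b1 - b0): under equal rates b0 the drift is controlled by [lyap_peak], and the
    surplus rate belongs to outer jumps, which lower L. *)
Let drift_peak a c : b0 <= b1 ->
  b1 * (L a c.+1 - L a.+1 c.+1) + (b0 * (L a.+2 c.+2 - L a.+1 c.+1) +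
  b1 * (L a.+1 c - L a.+1 c.+1)) <= 0.
Proof.
move=> b01.
have H := L3 (a.+2, c.+2) (a, c.+1) (a.+1, c) (a.+1, c.+1) (lyap_peak a c).
have H1 := le_L a c.+1 a.+1 c.+1 (leqnSn _) (leqnn _).
have H2 := le_L a.+1 c a.+1 c.+1 (leqnn _) (leqnSn _).
have : b0 * (L a.+2 c.+2 + L a c.+1 + L a.+1 c - 3 * L a.+1 c.+1) <= 0.
  by apply: mulr_ge0_le0; [exact: ltW|rewrite subr_le0].
have : (b1 - b0) * ((L a c.+1 - L a.+1 c.+1) + (L a.+1 c - L a.+1 c.+1)) <= 0.
  apply: mulr_ge0_le0; first by rewrite subr_ge0.
  by move: H1 H2 => ? ?; lra.
by move=> ? ?; lra.
Qed.

Let drift_peak_flat a : b0 <= b1 ->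
  b1 * (L a 0 - L a.+1 0) + b0 * (L a.+2 1 - L a.+1 0) <= 0.
Proof.
move=> b01.
have H := L2 (a.+2, 1%N) (a, 0%N) (a.+1, 0%N) (lyap_peak_flat a).
have H1 := le_L a 0 a.+1 0 (leqnSn _) (leqnn _).
have : b0 * (L a.+2 1 + L a 0 - 2 * L a.+1 0) <= 0.
  by apply: mulr_ge0_le0; [exact: ltW|rewrite subr_le0].
have : (b1 - b0) * (L a 0 - L a.+1 0) <= 0.
  by apply: mulr_ge0_le0; [rewrite subr_ge0|rewrite subr_le0].
by move=> ? ?; lra.
Qed.

Let drift_slope a : b1 * (L a 0 - L a.+1 0) + b1 * (L a.+2 0 - L a.+1 0) <= 0.
Proof.
have H := L2 (a.+2, 0%N) (a, 0%N) (a.+1, 0%N) (lyap_slope a).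
have : b1 * (L a.+2 0 + L a 0 - 2 * L a.+1 0) <= 0.
  by apply: mulr_ge0_le0; [exact: ltW|rewrite subr_le0].
by move=> ?; lra.
Qed.

(** Now the surplus b2 - b1 belongs to the jump of the centre, which lowers both differences and
    hence L. *)
Let drift_pit a c : b1 <= b2 ->
  b1 * (L a.+2 c.+1 - L a.+1 c.+1) + (b2 * (L a c - L a.+1 c.+1) +
  b1 * (L a.+1 c.+2 - L a.+1 c.+1)) <= 0.
Proof.
move=> b12.
have H := L3 (a, c) (a.+2, c.+1) (a.+1, c.+2) (a.+1, c.+1) (lyap_pit a c).
have H1 := le_L a c a.+1 c.+1 (leqnSn _) (leqnSn _).
have : b1 * (L a c + L a.+2 c.+1 + L a.+1 c.+2 - 3 * L a.+1 c.+1) <= 0.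
  by apply: mulr_ge0_le0; [exact: ltW|rewrite subr_le0].
have : (b2 - b1) * (L a c - L a.+1 c.+1) <= 0.
  by apply: mulr_ge0_le0; [rewrite subr_ge0|rewrite subr_le0].
by move=> ? ?; lra.
Qed.

Let drift_pit_flat a :
  b1 * (L a.+2 0 - L a.+1 0) + (b1 * (L a 0 - L a.+1 0) +
  b1 * (L a.+1 1 - L a.+1 0)) <= 0.
Proof.
have H := L3 (a.+2, 0%N) (a, 0%N) (a.+1, 1%N) (a.+1, 0%N) (lyap_pit_flat a).
have : b1 * (L a.+2 0 + L a 0 + L a.+1 1 - 3 * L a.+1 0) <= 0.
  by apply: mulr_ge0_le0; [exact: ltW|rewrite subr_le0].
by move=> ?; lra.
Qed.

Let gen3 (p q r : 'I_n) g y : p.+1 = q :> nat -> q.+1 = r :> nat ->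
  (forall j, j != p -> j != q -> j != r -> g (incr y j) = g y) ->
  gen g y = bt (Vj y p) * (g (incr y p) - g y) +
   (bt (Vj y q) * (g (incr y q) - g y) + bt (Vj y r) * (g (incr y r) - g y)).
Proof.
move=> pq qr gj; rewrite (gen_seq [:: p; q; r]); last first.
- by move=> j; rewrite !inE !negb_or => /and3P[*]; apply: gj.
- rewrite /= !inE -!val_eqE /= -qr -pq !negb_or.
  by rewrite !neq_ltn !ltnS !leqnn leqnSn.
by rewrite !big_cons big_nil addr0.
Qed.

Section Triple.
Variables (p q r : 'I_n).
Hypotheses (pq : p.+1 = q :> nat) (qr : q.+1 = r :> nat).

Let neqs : ((p == q) = false) * ((q == p) = false) * ((q == r) = false) *
  ((r == q) = false) * ((p == r) = false) * ((r == p) = false).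
Proof.
have h1 : (p < q)%N by rewrite -pq.
have h2 : (q < r)%N by rewrite -qr.
have h3 := ltn_trans h1 h2.
by rewrite -!val_eqE /= (ltn_eqF h1) (gtn_eqF h1) (ltn_eqF h2) (gtn_eqF h2) (ltn_eqF h3) (gtn_eqF h3).
Qed.

Let Vp y : Vj y p = ((y p < coord y p)%N + (y p < y q)%N)%N.
Proof.
have cq : coord y p.+2 = y q by rewrite pq coordE.
by rewrite VjE cq.
Qed.

Let Vq y : Vj y q = ((y q < y p)%N + (y q < y r)%N)%N.
Proof.
have cp : coord y q = y p by rewrite -pq coordE.
have cr : coord y q.+2 = y r by rewrite qr coordE.
by rewrite VjE cp cr.
Qed.

Let Vr y : Vj y r = ((y r < y q)%N + (y r < coord y r.+2)%N)%N.
Proof.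
have cq : coord y r = y q by rewrite -qr coordE.
by rewrite VjE cq.
Qed.

(** The side conditions give p (or r) rate exactly b1 whenever it lies below q. When it does not,
    the truncated difference is 0 and stays 0 after its jump, so its rate drops out. Five orderings
    remain: a peak, and a slope and a flat peak with their mirror images. *)
Lemma hill_transience : b0 <= b1 ->
  {ae P, forall w, ~ eventually_in
    [set y : state n | [/\ (y p < y q)%N || (y r < y q)%N,
       (y p < y q)%N -> (coord y p <= y p)%N &
       (y r < y q)%N -> (coord y r.+2 <= y r)%N]] w}.
Proof.
move=> b01; pose f y := L (y q - y p) (y q - y r).
apply: (transience _ f) => [y|y [hill lp lr]|lam]; first exact: L_ge0.
  rewrite (gen3 p q r) // => [|j jp jq jr]; last first.
    by rewrite /f !incrE !(eq_sym _ j) (negbTE jp) (negbTE jq) (negbTE jr) !addn0.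
  have fp : f (incr y p) = L (y q - y p).-1 (y q - y r).
    by rewrite /f !incrE eqxx !neqs !addn0 addn1 subnS.
  have fr : f (incr y r) = L (y q - y p) (y q - y r).-1.
    by rewrite /f !incrE eqxx !neqs !addn0 addn1 subnS.
  have fq : f (incr y q) = L ((y q).+1 - y p) ((y q).+1 - y r).
    by rewrite /f !incrE eqxx !neqs !addn0 addn1.
  rewrite fp fq fr {fp fq fr} /f Vp Vq Vr.
  have pos (m k : nat) : (k < m)%N -> exists e, (m - k)%N = e.+1.
    by move=> km; exists (m - k).-1; rewrite prednK // subn_gt0.
  have zero (m k : nat) : (m <= k)%N -> (m - k)%N = 0%N by rewrite -subn_eq0 => /eqP.
  case: (ltngtP (y p) (y q)) hill lp => [ltp _ /(_ isT) lp|gtp|eqp];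
  case: (ltngtP (y r) (y q)) lr => [ltr' lr|gtr' _|eqr _] //.
  - have -> : (y p < coord y p)%N = false by rewrite ltnNge lp.
    have -> : (y r < coord y r.+2)%N = false by rewrite ltnNge lr.
    have [u uE] := pos _ _ ltp; have [v vE] := pos _ _ ltr'.
    by rewrite !subSn ?(ltnW ltp) ?(ltnW ltr') // uE vE; exact: drift_peak.
  - have -> : (y p < coord y p)%N = false by rewrite ltnNge lp.
    have [u uE] := pos _ _ ltp.
    rewrite (zero _ _ (ltnW gtr')) (zero _ _ gtr') subrr mulr0 addr0.
    by rewrite subSn ?(ltnW ltp) // uE; exact: drift_slope.
  - have -> : (y p < coord y p)%N = false by rewrite ltnNge lp.
    have [u uE] := pos _ _ ltp.
    rewrite eqr subnn subSnn subrr mulr0 addr0.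
    by rewrite subSn ?(ltnW ltp) // uE; exact: drift_peak_flat.
  - have -> : (y r < coord y r.+2)%N = false by rewrite ltnNge lr.
    have [v vE] := pos _ _ ltr'; move=> _ _.
    rewrite (zero _ _ (ltnW gtp)) (zero _ _ gtp) subrr mulr0 add0r addrC.
    by rewrite subSn ?(ltnW ltr') // vE !(LC 0); exact: drift_slope.
  - have -> : (y r < coord y r.+2)%N = false by rewrite ltnNge lr.
    have [v vE] := pos _ _ ltr'; move=> _ _.
    rewrite -eqp subnn subSnn eqp subrr mulr0 add0r addrC.
    rewrite subSn ?(ltnW ltr') // vE !(LC 0) (LC 1); exact: drift_peak_flat.
have [K HK] := L_big lam; exists K => y [hill _ _].
exists (nseq K q); first by rewrite size_nseq.
rewrite /f !incrsE !count_nseq /= eqxx !neqs mul0n mul1n !addn0.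
case/orP: hill => lt; last rewrite LC.
  by apply: HK; rewrite -addnBAC ?leq_addl // ltnW.
by apply: HK; rewrite -addnBAC ?leq_addl // ltnW.
Qed.

(** Unlike for hills, the side conditions include equality: when p is level with q, a jump of p
    changes the difference from 0 to 1, so its rate matters and must be b1. *)
Lemma valley_transience : b1 <= b2 ->
  {ae P, forall w, ~ eventually_in
    [set y : state n | [/\ (y q < y p)%N || (y q < y r)%N,
       (y q <= y p)%N -> (y p < coord y p)%N &
       (y q <= y r)%N -> (y r < coord y r.+2)%N]] w}.
Proof.
move=> b12; pose f y := L (y p - y q) (y r - y q).
apply: (transience _ f) => [y|y [valley lp lr]|lam]; first exact: L_ge0.
  rewrite (gen3 p q r) // => [|j jp jq jr]; last first.
    by rewrite /f !incrE !(eq_sym _ j) (negbTE jp) (negbTE jq) (negbTE jr) !addn0.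
  have fp : f (incr y p) = L ((y p).+1 - y q) (y r - y q).
    by rewrite /f !incrE eqxx !neqs !addn0 addn1.
  have fr : f (incr y r) = L (y p - y q) ((y r).+1 - y q).
    by rewrite /f !incrE eqxx !neqs !addn0 addn1.
  have fq : f (incr y q) = L (y p - y q).-1 (y r - y q).-1.
    by rewrite /f !incrE eqxx !neqs !addn0 addn1 !subnS.
  rewrite fp fq fr {fp fq fr} /f Vp Vq Vr.
  have pos (m k : nat) : (k < m)%N -> exists e, (m - k)%N = e.+1.
    by move=> km; exists (m - k).-1; rewrite prednK // subn_gt0.
  have zero (m k : nat) : (m <= k)%N -> (m - k)%N = 0%N by rewrite -subn_eq0 => /eqP.
  case: (ltngtP (y q) (y p)) valley lp => [ltp _ /(_ isT) lp|gtp|eqp];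
  case: (ltngtP (y q) (y r)) lr => [ltr' /(_ isT) lr|gtr' _|eqr /(_ isT) lr] //.
  - rewrite lp lr.
    have [u uE] := pos _ _ ltp; have [v vE] := pos _ _ ltr'.
    by rewrite !subSn ?(ltnW ltp) ?(ltnW ltr') // uE vE; exact: drift_pit.
  - rewrite lp; have [u uE] := pos _ _ ltp.
    rewrite (zero _ _ (ltnW gtr')) (zero _ _ gtr') subrr mulr0 addr0 addrC.
    by rewrite subSn ?(ltnW ltp) // uE; exact: drift_slope.
  - rewrite lp lr; have [u uE] := pos _ _ ltp.
    rewrite -eqr subnn subSnn.
    by rewrite subSn ?(ltnW ltp) // uE; exact: drift_pit_flat.
  - rewrite lr; have [v vE] := pos _ _ ltr'; move=> _ _.
    rewrite (zero _ _ (ltnW gtp)) (zero _ _ gtp) subrr mulr0 add0r.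
    by rewrite subSn ?(ltnW ltr') // vE !(LC 0); exact: drift_slope.
  - rewrite lr; have [v vE] := pos _ _ ltr'; move=> _ /(_ isT) ->.
    rewrite -eqp subnn subSnn subSn ?(ltnW ltr') // vE !(LC 0) (LC 1).
    by rewrite addrC -addrA addrCA; exact: drift_pit_flat.
have [K HK] := L_big lam; exists K => y [valley _ _].
case/orP: valley => lt.
  exists (nseq K p); first by rewrite size_nseq.
  rewrite /f !incrsE !count_nseq /= eqxx !neqs mul0n mul1n !addn0.
  by apply: HK; rewrite -addnBAC ?leq_addl // ltnW.
exists (nseq K r); first by rewrite size_nseq.
rewrite /f !incrsE !count_nseq /= eqxx !neqs mul0n mul1n !addn0 LC.
by apply: HK; rewrite -addnBAC ?leq_addl // ltnW.
Qed.

End Triple.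

(** * Speeds of single sites and of two-site blocks *)

Lemma site_speed (i : 'I_n) v : {ae P, forall w,
  eventually_in [set y : state n | Vj y i = v] w ->
  (X k%:R w i)%:R / k%:R @[k --> \oo] --> bt v}.
Proof.
apply: (law_of_large_numbers _ (fun y => (y i)%:R) 1) => //.
- exact: ltW.
- by move=> y j; rewrite incrE natrD addrAC subrr add0r normr_nat lern1 leq_b1.
- move=> y Vv; rewrite (gen_seq [:: i]) // => [|j].
    by rewrite big_seq1 Vv incrE eqxx natrD addrAC subrr add0r mulr1.
  by rewrite inE incrE => ji; rewrite eq_sym (negbTE ji) addn0.
Qed.

Section Block.
Variables (p q : 'I_n) (bh bl : R).
Hypotheses (pq : p.+1 = q :> nat) (bh_gt0 : 0 < bh) (bhl : bh <= bl).

Let npq : (p == q) = false.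
Proof. by rewrite -val_eqE /= -pq ltn_eqF. Qed.

Let nqp : (q == p) = false.
Proof. by rewrite eq_sym npq. Qed.

(** [bl] is the rate of the lower site and [bh] that of the higher one; at a tie both have rate
    [bh]. Case (i) uses (b0, b1) and case (iii) uses (b1, b2). *)
Definition block : set (state n) := [set y |
  bt (Vj y p) = (if (y p < y q)%N then bl else bh) /\
  bt (Vj y q) = (if (y q < y p)%N then bl else bh)].

Let gen2 g y : (forall j, j != p -> j != q -> g (incr y j) = g y) ->
  gen g y = bt (Vj y p) * (g (incr y p) - g y) + bt (Vj y q) * (g (incr y q) - g y).
Proof.
move=> gj; rewrite (gen_seq [:: p; q]).
- by rewrite !big_cons big_nil addr0.
- by rewrite /= inE npq.
- by move=> j; rewrite !inE negb_or => /andP[*]; exact: gj.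
Qed.

Let D (y : state n) : R := (y p)%:R - (y q)%:R.

Let D_p y : D (incr y p) = D y + 1.
Proof. by rewrite /D !incrE eqxx nqp addn0 natrD addrAC. Qed.

Let D_q y : D (incr y q) = D y - 1.
Proof. by rewrite /D !incrE eqxx npq addn0 natrD opprD addrA. Qed.

Let D_other y j : j != p -> j != q -> D (incr y j) = D y.
Proof. by move=> jp jq; rewrite /D !incrE !(eq_sym _ j) (negbTE jp) (negbTE jq) !addn0. Qed.

(** With a = exp(th) and both rates equal to [bh] this would be an equality. The surplus bl - bh
    pulls the difference towards 0 and contributes (a - 1)(E' - E/a) <= 0. *)
Let cosh_drift (E E' a : R) : 1 <= a -> E' <= a^-1 * E ->
  bh * (a * E + a^-1 * E' - (E + E')) + bl * (a^-1 * E + a * E' - (E + E')) <=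
  bh * (a + a^-1 - 2) * (E + E').
Proof.
move=> a1 EE; have a0 : 0 < a by rewrite (lt_le_trans _ a1).
have H : (bl - bh) * ((a - 1) * (E' - a^-1 * E)) <= 0.
  apply: mulr_ge0_le0; first by rewrite subr_ge0.
  by apply: mulr_ge0_le0; [rewrite subr_ge0|rewrite subr_le0].
have aa : a * a^-1 = 1 by rewrite mulfV ?gt_eqF.
have E1 : (a - 1) * (E' - a^-1 * E) = a * E' - E' - a * a^-1 * E + a^-1 * E by ring.
move: H; rewrite E1 aa mul1r => H.
rewrite -subr_le0.
have -> : bh * (a * E + a^-1 * E' - (E + E')) + bl * (a^-1 * E + a * E' - (E + E')) -
  bh * (a + a^-1 - 2) * (E + E') = (bl - bh) * (a * E' - E' - E + a^-1 * E) by ring.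
exact: H.
Qed.

Let gen_cosh (th : R) y : 0 < th -> block y ->
  gen (fun z => expR (th * D z) + expR (- (th * D z))) y <=
  bh * (expR th + (expR th)^-1 - 2) * (expR (th * D y) + expR (- (th * D y))).
Proof.
move=> th0 [Bp Bq].
rewrite gen2 => [|j jp jq]; last by rewrite D_other.
have a1 : 1 <= expR th by rewrite -expR0 ler_expR ltW.
rewrite D_p D_q Bp Bq.
pose a := expR th; pose E := expR (th * D y).
have -> : expR (th * (D y + 1)) = a * E by rewrite -expRD; congr expR; ring.
have -> : expR (- (th * (D y + 1))) = a^-1 * E^-1.
  by rewrite -!expRN -expRD; congr expR; ring.
have -> : expR (th * (D y - 1)) = a^-1 * E by rewrite -expRN -expRD; congr expR; ring.
have -> : expR (- (th * (D y - 1))) = a * E^-1 by rewrite -expRN -expRD; congr expR; ring.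
rewrite (expRN (th * D y)) -/E -/a.
case: (ltngtP (y p) (y q)) => [lt|gt|eqy].
- have EE : E <= a^-1 * E^-1.
    rewrite /a /E -!expRN -expRD ler_expR.
    have : (y p).+1%:R <= (y q)%:R :> R by rewrite ler_nat.
    rewrite -natr1 => H; have : th * (D y + 1) <= 0.
      by apply: mulr_ge0_le0; [exact: ltW|rewrite /D; lra].
    by move=> ?; lra.
  by have := cosh_drift E^-1 E a a1 EE => ?; lra.
- have EE : E^-1 <= a^-1 * E.
    rewrite /a /E -!expRN -expRD ler_expR.
    have : (y q).+1%:R <= (y p)%:R :> R by rewrite ler_nat.
    rewrite -natr1 => H; have : 0 <= th * (D y - 1).
      by apply: mulr_ge0; [exact: ltW|rewrite /D; lra].
    by move=> ?; lra.
  by have := cosh_drift E E^-1 a a1 EE => ?; lra.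
- have -> : E = 1 by rewrite /E /D eqy subrr mulr0 expR0.
  by rewrite invr1; lra.
Qed.

Let gap_small (del : R) : 0 < del -> {ae P, forall w, eventually_in block w ->
  exists K : nat, forall k, (K <= k)%N -> `|D (X k%:R w)| < del * k%:R}.
Proof.
move=> del0.
(* The growth rate is at most 4 * bh * th^2, and 8 * bh * th <= del makes this smaller than th *
   del. *)
pose th := Num.min (1 / 2) (del / (8 * bh)).
have th0 : 0 < th by rewrite /th lt_min !divr_gt0 ?mulr_gt0.
have th2 : th <= 1 / 2 by rewrite /th ge_min lexx.
have thd : 8 * bh * th <= del.
  rewrite mulrC -ler_pdivlMr ?mulr_gt0 //; by rewrite /th ge_min lexx orbT.
have kle : bh * (expR th + (expR th)^-1 - 2) < th * del.
  have q1 := expR_le_quad th th2.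
  have q2 : (expR th)^-1 <= 1 - th + 2 * th ^+ 2.
    by rewrite -expRN; have := expR_le_quad (- th); rewrite sqrrN; apply; lra.
  have : bh * (expR th + (expR th)^-1 - 2) <= bh * (4 * th ^+ 2).
    by apply: ler_wpM2l; [exact: ltW|lra].
  have : th * (8 * bh * th) <= th * del by apply: ler_wpM2l => //; exact: ltW.
  have : 0 < bh * th ^+ 2 by rewrite mulr_gt0 ?exprn_gt0.
  by rewrite expr2 => ? ? ?; lra.
have k0 : 0 <= bh * (expR th + (expR th)^-1 - 2).
  apply: mulr_ge0; first exact: ltW.
  by rewrite -expRN; move: (expR_ge1Dx th) (expR_ge1Dx (- th)) => ? ?; lra.
have G0 y : 0 <= expR (th * D y) + expR (- (th * D y)) by rewrite addr_ge0 ?expR_ge0.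
have := growth block (fun z => expR (th * D z) + expR (- (th * D z))) _ (th * del)
  G0 (fun y => gen_cosh th y th0) (or_introl k0) kle.
apply: filterS => w Hw ev; have [K HK] := Hw ev.
exists K => k /HK lt; rewrite -(ltr_pM2l th0) mulrA -ltr_expR.
apply: le_lt_trans lt.
have [d0|/ltW d0] := leP 0 (D (X k%:R w)).
  by rewrite (ger0_norm d0) lerDl expR_ge0.
by rewrite (ler0_norm d0) mulrN lerDr expR_ge0.
Qed.

Lemma block_speed : {ae P, forall w, eventually_in block w ->
  ((X k%:R w p)%:R / k%:R @[k --> \oo] --> 2 * bh * bl / (bh + bl)) /\
  ((X k%:R w q)%:R / k%:R @[k --> \oo] --> 2 * bh * bl / (bh + bl))}.
Proof.
have bl0 : 0 < bl by rewrite (lt_le_trans bh_gt0).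
have bs0 : 0 < bh + bl by rewrite addr_gt0.
pose th := (bl - bh) / (bh + bl).
have th0 : 0 <= th by rewrite divr_ge0 ?subr_ge0 // ltW.
have th1 : th <= 1 by rewrite ler_pdivrMr // mul1r; move: bh_gt0 => ?; lra.
pose f y : R := (y p)%:R + (y q)%:R + th * `|D y|.
pose c := 4 * bh * bl / (bh + bl).
have key : th * (bh + bl) = bl - bh by rewrite divfK ?gt_eqF.
have ck : c * (bh + bl) = 4 * bh * bl by rewrite divfK ?gt_eqF.
have LLN : {ae P, forall w, eventually_in block w ->
     f (X k%:R w) / k%:R @[k --> \oo] --> c}.
  (* A jump changes the sum by 1 and th * |D| by at most th <= 1. *)
  apply: (law_of_large_numbers _ f 2) => //.
  - by rewrite !mulr_ge0 ?invr_ge0 // ltW.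
  - by move=> y; rewrite /f addr_ge0 // mulr_ge0.
  - move=> y j; rewrite /f.
    have [->|jp] := eqVneq j p.
      rewrite D_p !incrE eqxx nqp addn0 natrD.
      have : `| `|D y + 1| - `|D y| | <= 1.
        by apply: (le_trans (ler_dist_dist _ _)); rewrite addrAC subrr add0r normr1.
      rewrite !ler_norml /= => /andP[? ?].
      have : 0 <= th * (1 - (`|D y + 1| - `|D y|)) by apply: mulr_ge0 => //; lra.
      have : 0 <= th * (1 + (`|D y + 1| - `|D y|)) by apply: mulr_ge0 => //; lra.
      by move=> ? ?; apply/andP; split; lra.
    have [->|jq] := eqVneq j q.
      rewrite D_q !incrE eqxx npq addn0 natrD.
      have : `| `|D y - 1| - `|D y| | <= 1.
        by apply: (le_trans (ler_dist_dist _ _)); rewrite addrAC subrr add0r normrN1.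
      rewrite !ler_norml /= => /andP[? ?].
      have : 0 <= th * (1 - (`|D y - 1| - `|D y|)) by apply: mulr_ge0 => //; lra.
      have : 0 <= th * (1 + (`|D y - 1| - `|D y|)) by apply: mulr_ge0 => //; lra.
      by move=> ? ?; apply/andP; split; lra.
    by rewrite D_other // !incrE !(eq_sym _ j) (negbTE jp) (negbTE jq) !addn0 subrr normr0.
  move=> y [Bp Bq]; rewrite gen2 => [|j jp jq]; last first.
    by rewrite /f D_other // !incrE !(eq_sym _ j) (negbTE jp) (negbTE jq) !addn0.
  rewrite Bp Bq /f D_p D_q !incrE !eqxx npq nqp !addn0 !natrD.
  (* After clearing the denominator the drift is (bl + bh)^2 - (bl - bh)^2 off the diagonal and 2 bh
     (bh + bl) + 2 bh (bl - bh) on it; both equal 4 bh bl, which is what fixes th. *)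
  apply: (mulIf (lt0r_neq0 bs0)); rewrite ck.
  case: (ltngtP (y p) (y q)) => [lt|gt|eqy].
  - have : (y p).+1%:R <= (y q)%:R :> R by rewrite ler_nat.
    rewrite -natr1 => H.
    rewrite !ler0_norm; [|rewrite /D; lra|rewrite /D; lra|rewrite /D; lra].
    rewrite (_ : _ * (bh + bl) = (bl + bh) ^+ 2 - (th * (bh + bl)) * (bl - bh)); last by rewrite /=; ring.
    by rewrite key; ring.
  - have : (y q).+1%:R <= (y p)%:R :> R by rewrite ler_nat.
    rewrite -natr1 => H.
    rewrite !ger0_norm; [|rewrite /D; lra|rewrite /D; lra|rewrite /D; lra].
    rewrite (_ : _ * (bh + bl) = (bl + bh) ^+ 2 - (th * (bh + bl)) * (bl - bh)); last by rewrite /=; ring.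
    by rewrite key; ring.
  - rewrite /D eqy subrr normr0 add0r sub0r normrN1 normr1.
    rewrite (_ : _ * (bh + bl) = 2 * bh * (bh + bl) + 2 * bh * (th * (bh + bl))); last by rewrite /=; ring.
    by rewrite key; ring.
have gap : {ae P, forall w, eventually_in block w -> D (X k%:R w) / k%:R @[k --> \oo] --> 0}.
  have H : {ae P, forall w, forall m : nat, eventually_in block w ->
    exists K : nat, forall k, (K <= k)%N -> `|D (X k%:R w)| < m.+1%:R^-1 * k%:R}.
    by apply: ae_foralln => m; exact: gap_small.
  apply: filterS H => w Hw ev; apply/cvgrPdist_lt => e e0.
  have [m me] : exists m : nat, m.+1%:R^-1 < e.
    exists (Num.bound e^-1); rewrite invf_plt ?posrE //.
    by apply: (lt_trans (archi_boundP _)); rewrite ?invr_ge0 ?ltW // ltr_nat.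
  have [K HK] := Hw m ev; exists K.+1 => // k /= Kk.
  have k0 : 0 < k%:R :> R by rewrite ltr0n (leq_ltn_trans (leq0n K) Kk).
  have := HK k (ltnW Kk); rewrite -ltr_pdivrMr // => lt; apply: lt_trans me.
  by rewrite sub0r normrN normrM normfV (gtr0_norm k0).
apply: filterS2 LLN gap => w Hf Hg ev.
have {}Hf := Hf ev; have {}Hg := Hg ev.
have Hn : `|D (X k%:R w)| / k%:R @[k --> \oo] --> 0.
  rewrite -(normr0 R); apply: cvg_trans (cvg_norm Hg).
  by apply: near_eq_cvg; apply: nearW => k; rewrite normrM normfV normr_nat.
pose g1 k := f (X k%:R w) / k%:R.
pose g2 k := D (X k%:R w) / k%:R.
pose g3 k := `|D (X k%:R w)| / k%:R.
(* The heights are recovered from x_p + x_q = f - th |D| and x_p - x_q = D. *)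
have sumE k : (X k%:R w p)%:R / k%:R = 2^-1 * (g1 k - th * g3 k + g2 k).
  by rewrite /g1 /g2 /g3 /f /D; move: (k%:R)^-1 `|_| => kk ab; field.
have difE k : (X k%:R w q)%:R / k%:R = 2^-1 * (g1 k - th * g3 k - g2 k).
  by rewrite /g1 /g2 /g3 /f /D; move: (k%:R)^-1 `|_| => kk ab; field.
have lp : 2^-1 * (g1 k - th * g3 k + g2 k) @[k --> \oo] --> 2^-1 * (c - th * 0 + 0).
  apply: cvgM; first exact: cvg_cst.
  by apply: cvgD => //; apply: cvgB => //; apply: cvgM => //; exact: cvg_cst.
have lq : 2^-1 * (g1 k - th * g3 k - g2 k) @[k --> \oo] --> 2^-1 * (c - th * 0 - 0).
  apply: cvgM; first exact: cvg_cst.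
  by apply: cvgB => //; apply: cvgB => //; apply: cvgM => //; exact: cvg_cst.
have -> : 2 * bh * bl / (bh + bl) = 2^-1 * (c - th * 0 + 0).
  by rewrite /c; field; rewrite gt_eqF.
split; first by under eq_fun do rewrite sumE; exact: lp.
by under eq_fun do rewrite difE; move: lq; rewrite oppr0.
Qed.

End Block.

(** * From integer times to real times *)

Lemma dy_dense (a b : R) : 0 <= a < b -> exists m i, a < dy m i < b.
Proof.
move=> /andP[a0 ab]; have ba : 0 < (b - a) / 2 by rewrite divr_gt0 ?subr_gt0.
have [m /(_ m (leqnn _))] := mesh_small 1 ((b - a) / 2) ba; rewrite mul1r => me.
have mp := mesh_gt0 m.
have q0 : 0 <= a / mesh m by rewrite divr_ge0 // ltW.
have /andP[lo hi] := truncn_itv q0.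
exists m, (Num.truncn (a / mesh m)).+1; apply/andP; split.
  by rewrite /dy -ltr_pdivrMr.
move: lo; rewrite ler_pdivlMr // /dy -natr1 mulrDl mul1r => ?.
by move: ba => ?; lra.
Qed.

(** With k the integer part of t, monotonicity squeezes X_t between X_k and X_(k+1), whose ratios to
    k and k+1 have the same limit. *)
Lemma real_time_limit w (i : 'I_n) (l : R) :
  (forall m j m' j', dy m j <= dy m' j' -> (X (dy m j) w i <= X (dy m' j') w i)%N) ->
  (X k%:R w i)%:R / k%:R @[k --> \oo] --> l ->
  (X t w i)%:R / t @[t --> +oo] --> l.
Proof.
move=> mono lim; have [_ rc _] := hX.
have between t k : k%:R <= t -> t < k.+1%:R ->
    (X k%:R w i <= X t w i <= X k.+1%:R w i)%N.
  move=> kt tk; have t0 : 0 <= t by rewrite (le_trans _ kt).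
  have [e e0 He] := rc w t t0.
  (* Right-continuity replaces X_t by its value at a dyadic time slightly after t and still before
     k+1, where monotonicity is known. *)
  have [|m [j /andP[tj]]] := dy_dense t (Num.min (t + e) k.+1%:R).
    by rewrite t0 lt_min ltrDl e0.
  rewrite lt_min => /andP[je jk].
  have <- : X (dy m j) w = X t w by apply: He; rewrite (ltW tj).
  rewrite -(dy_nat 0 k) -(dy_nat 0 k.+1); apply/andP; split; apply: mono; rewrite dy_nat.
    by rewrite (le_trans kt) // ltW.
  exact: ltW.
apply/cvgrPdist_lt => e e0.
have e2 : 0 < e / 2 by rewrite divr_gt0.
move/cvgrPdist_lt/(_ _ e2): lim => [K _ HK].
(* For k >= B one extra unit of time costs at most (e/2) * k, which absorbs the passage from k to
   k+1. *)
pose B := Num.bound (2 * (`|l| + e / 2) / e).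
have B0 : 0 <= 2 * (`|l| + e / 2) / e by rewrite divr_ge0 ?ltW // mulr_gt0 // ltr_wpDl.
pose M := (maxn K B).+1.
exists M%:R; split; first by rewrite realn.
move=> t Mt; have t0 : 0 < t by rewrite (lt_trans _ Mt) // ltr0n.
have /andP[kt tk] := truncn_itv (ltW t0).
set k := Num.truncn t in kt tk.
have Mk : (M <= k)%N.
  by rewrite -ltnS -(ltr_nat R); exact: lt_trans Mt tk.
have Kk : (K <= k)%N by apply: leq_trans Mk; rewrite leqW // leq_maxl.
have Bk : (B <= k)%N by apply: leq_trans Mk; rewrite leqW // leq_maxr.
have k0 : 0 < k%:R :> R by rewrite ltr0n (leq_trans _ Mk).
have k10 : 0 < k.+1%:R :> R by rewrite ltr0n.
have small : `|l| + e / 2 <= e / 2 * k%:R.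
  have : 2 * (`|l| + e / 2) / e < k%:R.
    by apply: (lt_le_trans (archi_boundP B0)); rewrite ler_nat.
  by rewrite ltr_pdivrMr // => ?; lra.
have /andP[lo hi] := between t k kt tk.
have := HK k Kk; have := HK k.+1 (leqW Kk); rewrite /= !ltr_norml.
set a := (X k%:R w i)%:R / k%:R; set a' := (X k.+1%:R w i)%:R / k.+1%:R.
move=> /andP[h1 h2] /andP[h3 h4].
have la := ler_norm l; have la' := ler_norm (- l); rewrite normrN in la'.
have aE : (X k%:R w i)%:R = a * k%:R by rewrite /a divfK ?gt_eqF.
have aE' : (X k.+1%:R w i)%:R = a' * k.+1%:R by rewrite /a' divfK ?gt_eqF.
have up : (X t w i)%:R <= a' * k.+1%:R by rewrite -aE' ler_nat.
have dn : a * k%:R <= (X t w i)%:R by rewrite -aE ler_nat.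
have a0 : 0 <= a by rewrite /a divr_ge0.
have a0' : 0 <= a' by rewrite /a' divr_ge0.
rewrite -natr1 in up tk.
have b1' : a' <= `|l| + e / 2 by lra.
have c1 : (X t w i)%:R < (l + e) * t.
  have : (l + e) * k%:R <= (l + e) * t.
    by rewrite ler_wpM2l //; lra.
  have : (a' - l - e / 2) * k%:R < 0.
    by rewrite nmulr_rlt0 // subr_lt0; lra.
  by move=> ? ?; lra.
have c2 : (l - e) * t < (X t w i)%:R.
  have H : (l - e / 2) * k%:R < a * k%:R by rewrite ltr_pM2r //; lra.
  have [le0|gt0] := leP (l - e) 0.
    have : (l - e) * t <= (l - e) * k%:R by rewrite ler_wnM2l.
    by move=> ?; lra.
  have : (l - e) * t <= (l - e) * (k%:R + 1) by rewrite ler_wpM2l // ltW.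
  by move=> ?; lra.
have d1 : (X t w i)%:R / t < l + e by rewrite ltr_pdivrMr.
have d2 : l - e < (X t w i)%:R / t by rewrite ltr_pdivlMr.
by apply/andP; split; [move: d1|move: d2] => ?; lra.
Qed.

Lemma eventually_inI S S' w : eventually_in S w -> eventually_in S' w -> eventually_in (S `&` S') w.
Proof.
move=> [N HN] [N' HN']; exists (maxn N N') => m i le; split.
  by apply: HN; apply: le_trans le; rewrite ler_nat leq_maxl.
by apply: HN'; apply: le_trans le; rewrite ler_nat leq_maxr.
Qed.

Lemma eventually_inS S S' w : S `<=` S' -> eventually_in S w -> eventually_in S' w.
Proof. by move=> SS [N HN]; exists N => m i /HN /SS. Qed.

Lemma eventually_in_ex S w : eventually_in S w -> exists y, S y.
Proof. by move=> [N HN]; exists (X (dy 0 N) w); apply: HN; rewrite -(dy_nat 0 N) expn0 muln1. Qed.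

Lemma sites_limit w (Lf : nat -> R) :
  (forall m i m' i', dy m i <= dy m' i' -> forall j, (X (dy m i) w j <= X (dy m' i') w j)%N) ->
  (forall i : 'I_n, (X k%:R w i)%:R / k%:R @[k --> \oo] --> Lf i) ->
  speed_limit (X^~ w) (fun i : 'I_n => Lf i) /\
  tup (fun i : 'I_n => Lf i) = map Lf (iota 0 n).
Proof.
move=> mono lim; split.
  by move=> i; apply: real_time_limit => // m j m' j' le; exact: mono.
by rewrite -val_enum_ord -map_comp.
Qed.

(** * The three regimes *)

Section HillCase.
Hypotheses (b20 : b2 < b0) (b01 : b0 <= b1).

Let b21 : b2 < b1. Proof. exact: lt_le_trans b01. Qed.

(** Persistent pits cut the row into gaps of one or two sites. As pits and boundary stay no higher
    than their neighbours, the rates inside a gap depend on that gap alone. *)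
Lemma hill_case : (0 < n)%N -> {ae P, forall w,
  exists l, speed_limit (X^~ w) l /\ E1 b0 b1 b2 (tup l)}.
Proof.
move=> n0.
have H1 : {ae P, forall w, forall i l r : 'I_n, l.+1 = i :> nat -> i.+1 = r :> nat ->
    eventually_in (strict_pit i) w \/ eventually_in (~` weak_pit i) w}.
  apply: ae_forall_countable => i; apply: ae_forall_countable => l.
  apply: ae_forall_countable => r; apply: ae_imply => li; apply: ae_imply => ir.
  exact: (pit_absorption b20 b21 l i r li ir).
have H2 : {ae P, forall w, forall p q r : 'I_n, p.+1 = q :> nat -> q.+1 = r :> nat ->
    ~ eventually_in [set y : state n | [/\ (y p < y q)%N || (y r < y q)%N,
       (y p < y q)%N -> (coord y p <= y p)%N &
       (y r < y q)%N -> (coord y r.+2 <= y r)%N]] w}.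
  apply: ae_forall_countable => p; apply: ae_forall_countable => q.
  apply: ae_forall_countable => r; apply: ae_imply => pq; apply: ae_imply => qr.
  exact: (hill_transience p q r pq qr b01).
have H3 : {ae P, forall w, forall p q : 'I_n, p.+1 = q :> nat ->
  eventually_in (block p q b0 b1) w ->
  ((X k%:R w p)%:R / k%:R @[k --> \oo] --> v2 b0 b1) /\
  ((X k%:R w q)%:R / k%:R @[k --> \oo] --> v2 b0 b1)}.
  apply: ae_forall_countable => p; apply: ae_forall_countable => q.
  by apply: ae_imply => pq; exact: (block_speed p q b0 b1 pq b0_gt0 b01).
have H4 : {ae P, forall w, forall (i : 'I_n) v,
  eventually_in [set y : state n | Vj y i = v] w ->
  (X k%:R w i)%:R / k%:R @[k --> \oo] --> bt v}.
  do 2 (apply: ae_forall_countable => ?); exact: site_speed.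
apply: filterS (filterI H1 (filterI H2 (filterI H3 (filterI H4 monotone_path)))).
move=> w [{}H1 [{}H2 [{}H3 [{}H4 mono]]]].
(* Positions past the right end count as pits (default [true]), since the boundary height 0 is never
   above a site; the left end is handled by the test k == 0. *)
pose m k := if insub k is Some i then `[< eventually_in (strict_pit (i : 'I_n)) w >] else true.
have mE (i : 'I_n) : m i = `[< eventually_in (strict_pit i) w >] by rewrite /m valK.
have mout k : (n <= k)%N -> m k by move=> nk; rewrite /m insubF // ltnNge nk.
have pitI (i : 'I_n) : m i -> eventually_in (strict_pit i) w by rewrite mE => /asboolP.
have npit (l i r : 'I_n) : l.+1 = i :> nat -> i.+1 = r :> nat -> ~~ m i ->
    eventually_in (~` weak_pit i) w.
  move=> li ir; rewrite mE => /asboolPn ne.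
  by case: (H1 i l r li ir).
(* This is the side condition of [hill_transience]: a site below its right neighbour that is not a
   weak pit must exceed its left one, and at the end the boundary height 0 supplies the
   inequality. *)
have npit_left (i j : 'I_n) : i.+1 = j :> nat -> ~~ m i ->
    eventually_in [set y : state n | (y i < y j)%N -> (coord y i <= y i)%N] w.
  move=> ij nm; case: (posnP i) => [i0|/ord_prev[l li]].
    by exists 0%N => ? ? _ _; rewrite i0.
  apply: eventually_inS (npit l i j li ij nm) => y nw /= lt.
  rewrite leqNgt; apply/negP => lt'; apply: nw; split; first exact: ltnW.
  by rewrite (coord_succ _ _ _ ij) ltnW.
have npit_right (i j : 'I_n) : j.+1 = i :> nat -> ~~ m i ->
    eventually_in [set y : state n | (y i < y j)%N -> (coord y i.+2 <= y i)%N] w.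
  move=> ji nm; case: (ltnP i.+1 n) => [/ord_next[r ir]|ni]; last first.
    by exists 0%N => ? ? _ _; rewrite coord_out.
  apply: eventually_inS (npit j i r ji ir nm) => y nw /= lt.
  rewrite leqNgt; apply/negP => lt'; apply: nw; split; last exact: ltnW.
  by rewrite (coord_pred _ _ _ ji) ltnW.
have adj (i j : 'I_n) : i.+1 = j :> nat -> m i -> ~~ m j.
  move=> ij /pitI evi; apply/negP => /pitI evj.
  have [y [[_ h1] [h2 _]]] := eventually_in_ex _ _ (eventually_inI _ _ _ evi evj).
  by move: h1 h2; rewrite (coord_succ _ _ _ ij) (coord_pred _ _ _ ij) => /ltn_trans/[apply]; rewrite ltnn.
have tri (p q r : 'I_n) : p.+1 = q :> nat -> q.+1 = r :> nat -> [|| m p, m q | m r].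
  move=> pq qr; apply/negPn; rewrite !negb_or; apply/negP => /and3P[np nq nr].
  apply: (H2 p q r pq qr).
  apply: eventually_inS (eventually_inI _ _ _ (npit p q r pq qr nq)
    (eventually_inI _ _ _ (npit_left p q pq np) (npit_right r q qr nr))).
  move=> y [nw [h1 h2]]; split => //.
  apply/negPn; rewrite negb_or -!leqNgt; apply/negP => /andP[le1 le2]; apply: nw.
  by split; rewrite ?(coord_pred _ _ _ pq) ?(coord_succ _ _ _ qr).
have left_low (i : 'I_n) : (i == 0%N :> nat) || m i.-1 ->
    eventually_in [set y : state n | (coord y i <= y i)%N] w.
  case: (posnP i) => [i0 _|i0]; first by exists 0%N => ? ? _; rewrite i0.
  have [l li] := ord_prev i i0; rewrite -li /= => /pitI; apply: eventually_inS => y [_].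
  by rewrite (coord_succ _ _ _ li) /= li (coord_pred _ _ _ li) => /ltnW.
have right_low (i : 'I_n) : m i.+1 ->
    eventually_in [set y : state n | (coord y i.+2 <= y i)%N] w.
  case: (ltnP i.+1 n) => [/ord_next[r ir]|ni _]; last first.
    by exists 0%N => ? ? _ /=; rewrite coord_out.
  rewrite ir => /pitI; apply: eventually_inS => y [+ _].
  by rewrite (coord_pred _ _ _ ir) /= -ir (coord_succ _ _ _ ir) => /ltnW.
have two (p q : 'I_n) : p.+1 = q :> nat -> (p == 0%N :> nat) || m p.-1 -> m q.+1 ->
    eventually_in (block p q b0 b1) w.
  move=> pq /left_low lp /right_low rq.
  apply: eventually_inS (eventually_inI _ _ _ lp rq) => y [/= h1 h2].
  rewrite /block /= !VjE (coord_succ _ _ _ pq) (coord_pred _ _ _ pq).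
  have -> : (y p < coord y p)%N = false by rewrite ltnNge h1.
  have -> : (y q < coord y q.+2)%N = false by rewrite ltnNge h2.
  by rewrite addn0; split; case: ifP.
pose Lf k := if m k then b2 else if ((k == 0%N) || m k.-1) && m k.+1 then b0 else v2 b0 b1.
have lims (i : 'I_n) : (X k%:R w i)%:R / k%:R @[k --> \oo] --> Lf i.
  rewrite /Lf; case: ifPn => mi.
    apply: (H4 i 2%N); apply: eventually_inS (pitI i mi) => y; exact: strict_pit_Vj.
  case: ifPn => [/andP[/left_low h1 /right_low h2]|].
    apply: (H4 i 0%N); apply: eventually_inS (eventually_inI _ _ _ h1 h2) => y [/= l1 l2].
    by rewrite VjE !ltnNge l1 l2.
  rewrite negb_and => /orP[|ni].
    (* Two adjacent unmarked sites form a block, because by [tri] the next position on either side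
       is a pit or lies past an end. *)
    rewrite negb_or -lt0n => /andP[i0 nl]; have [l li] := ord_prev i i0.
    rewrite -li /= in nl.
    apply: (H3 l i li _).2; apply: two => //.
      case: (posnP l) => [//|l0]; have [l' ll] := ord_prev l l0.
      have := tri l' l i ll li; rewrite (negbTE nl) (negbTE mi) !orbF.
      by rewrite -ll /= => ->.
    case: (ltnP i.+1 n) => [/ord_next[r ir]|ni]; last exact: mout.
    by have := tri l i r li ir; rewrite (negbTE nl) (negbTE mi) ir.
  have ilt : (i.+1 < n)%N by rewrite ltnNge; apply: contra ni => /mout.
  have [j ij] := ord_next i ilt; rewrite ij in ni.
  apply: (H3 i j ij _).1; apply: two => //.
    case: (posnP i) => [//|i0]; have [l li] := ord_prev i i0.
    have := tri l i j li ij; rewrite (negbTE ni) (negbTE mi) !orbF.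
    by rewrite -li /= => ->.
  case: (ltnP j.+1 n) => [/ord_next[r jr]|nj]; last exact: mout.
  by have := tri i j r ij jr; rewrite (negbTE ni) (negbTE mi) jr.
have [sl te] := sites_limit w Lf mono lims.
exists (fun i : 'I_n => Lf i); split; first exact: sl.
rewrite te; apply: (hill_blocks m Lf n b0 b2 (v2 b0 b1)) => //.
- have h : (n.-1 < n)%N by rewrite prednK.
  apply/negP => /(pitI (Ordinal h))/eventually_in_ex[y [_]].
  by rewrite coord_out //= prednK.
- move=> k kn; have h : (k < n)%N by apply: ltnW.
  apply/negP => /andP[mk mk1].
  by have := adj (Ordinal h) (Ordinal kn) erefl mk; rewrite mk1.
- move=> k kn; have h1 : (k.+1 < n)%N by apply: ltnW.
  by have := tri (Ordinal (ltnW h1)) (Ordinal h1) (Ordinal kn) erefl erefl.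
- by apply/negP => /(pitI (Ordinal n0))/eventually_in_ex[y []].
Qed.

End HillCase.

Section SignCase.
Hypotheses (b21 : b2 < b1) (b10 : b1 < b0).

Let b20 : b2 < b0. Proof. exact: lt_trans b10. Qed.

(** Every adjacent pair eventually keeps a strict order. The signs of the steps then fix all the
    numbers of higher neighbours, and hence the speeds. *)
Lemma sign_case : (0 < n)%N -> {ae P, forall w,
  exists l, speed_limit (X^~ w) l /\ E2 b0 b1 b2 n (tup l)}.
Proof.
move=> n0.
have H1 : {ae P, forall w, forall i : 'I_n,
    eventually_in (strict_peak i) w \/ eventually_in (~` weak_peak i) w}.
  by apply: ae_forall_countable => i; exact: (peak_absorption b10 b20 i).
have H2 : {ae P, forall w, forall i l r : 'I_n, l.+1 = i :> nat -> i.+1 = r :> nat ->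
    eventually_in (strict_pit i) w \/ eventually_in (~` weak_pit i) w}.
  apply: ae_forall_countable => i; apply: ae_forall_countable => l.
  apply: ae_forall_countable => r; apply: ae_imply => li; apply: ae_imply => ir.
  exact: (pit_absorption b20 b21 l i r li ir).
have H3 : {ae P, forall w, forall p q : 'I_n, p.+1 = q :> nat -> ~ eventually_in
     [set y : state n | [/\ y p <> y q, Vj y p = 1%N & Vj y q = 1%N]] w}.
  apply: ae_forall_countable => p; apply: ae_forall_countable => q.
  apply: ae_imply => pq; apply: (pair_transience p q).
  by rewrite -val_eqE /= -pq ltn_eqF.
have H4 : {ae P, forall w, forall (i : 'I_n) v,
  eventually_in [set y : state n | Vj y i = v] w ->
  (X k%:R w i)%:R / k%:R @[k --> \oo] --> bt v}.
  do 2 (apply: ae_forall_countable => ?); exact: site_speed.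
apply: filterS (filterI H1 (filterI H2 (filterI H3 (filterI H4 monotone_path)))).
move=> w [{}H1 [{}H2 [{}H3 [{}H4 mono]]]].
have order (p q : 'I_n) : p.+1 = q :> nat ->
    eventually_in [set y : state n | (y p < y q)%N] w \/
    eventually_in [set y : state n | (y q < y p)%N] w.
  move=> pq.
  case: (H1 p) => [ep|np].
    by right; apply: eventually_inS ep => y [_]; rewrite (coord_succ _ _ _ pq).
  case: (H1 q) => [eq|nq].
    by left; apply: eventually_inS eq => y [+ _]; rewrite (coord_pred _ _ _ pq).
  (* Either p is a persistent pit, which settles the order, or p is never a weak pit, so its outer
     neighbour is not higher while p is not above q. *)
  have [lt|lp] : eventually_in [set y : state n | (y p < y q)%N] w \/
      eventually_in [set y : state n | (y p <= y q)%N -> (coord y p <= y p)%N] w.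
    case: (posnP p) => [p0|/ord_prev[l lp]].
      by right; exists 0%N => ? ? _ _; rewrite p0.
    case: (H2 p l q lp pq) => [ep|npit]; [left|right].
      by apply: eventually_inS ep => y [_]; rewrite (coord_succ _ _ _ pq).
    apply: eventually_inS npit => y nw /= le.
    rewrite leqNgt; apply/negP => lt; apply: nw; split; first exact: ltnW.
    by rewrite (coord_succ _ _ _ pq).
  - by left.
  have [lt|rq] : eventually_in [set y : state n | (y q < y p)%N] w \/
      eventually_in [set y : state n | (y q <= y p)%N -> (coord y q.+2 <= y q)%N] w.
    case: (ltnP q.+1 n) => [/ord_next[r qr]|nq'].
      case: (H2 q p r pq qr) => [eq|npit]; [left|right].
        by apply: eventually_inS eq => y [+ _]; rewrite (coord_pred _ _ _ pq).
      apply: eventually_inS npit => y nw /= le.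
      rewrite leqNgt; apply/negP => lt; apply: nw; split; last exact: ltnW.
      by rewrite (coord_pred _ _ _ pq).
    by right; exists 0%N => ? ? _ _; rewrite coord_out.
  - by right.
  (* In the remaining case the lower of p and q has only the other above it, and the higher one, not
     being a weak peak, has a higher outer neighbour. Both then move at rate b1; a tie would make p
     a weak peak. *)
  exfalso; apply: (H3 p q pq).
  apply: eventually_inS (eventually_inI _ _ _ (eventually_inI _ _ _ np nq) (eventually_inI _ _ _ lp rq)).
  move=> y [[+ +] [/= h1 h2]]; rewrite /weak_peak /= (coord_pred _ _ _ pq) (coord_succ _ _ _ pq).
  rewrite !VjE (coord_pred _ _ _ pq) (coord_succ _ _ _ pq) => wp wq.
  case: (ltngtP (y p) (y q)) h1 h2 wp wq => [lt /(_ isT) h1 _ wp wq|gt _ /(_ isT) h2 wp wq|E /(_ isT) h1 _ wp wq].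
  - split=> //; first by move=> E; rewrite E ltnn in lt.
      by rewrite ltnNge h1.
    by rewrite ltnNge; apply/eqP; rewrite eqb1; apply/negP => le; apply: wq.
  - split=> //; first by move=> E; rewrite E ltnn in gt.
      by rewrite addn0 ltnNge; apply/eqP; rewrite eqb1; apply/negP => le; apply: wp.
    by rewrite [(_ < coord y q.+2)%N]ltnNge h2.
  - by exfalso; apply: wp.
pose s k := `[< exists p q : 'I_n, [/\ p = k :> nat, q = k.+1 :> nat &
  eventually_in [set y : state n | (y p < y q)%N] w] >].
have sT (p q : 'I_n) : p.+1 = q :> nat -> s p ->
    eventually_in [set y : state n | (y p < y q)%N] w.
  move=> pq /asboolP[p' [q' [pp qq]]].
  have qE : q' = q by apply: val_inj; rewrite /= qq.
  by rewrite (val_inj pp) qE.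
have sF (p q : 'I_n) : p.+1 = q :> nat -> ~~ s p ->
    eventually_in [set y : state n | (y q < y p)%N] w.
  move=> pq /asboolPn ns; case: (order p q pq) => // ev; exfalso; apply: ns.
  by exists p, q; split.
pose ix k := (((0 < k)%N && ~~ s k.-1) + ((k.+1 < n)%N && s k))%N.
have evV (i : 'I_n) : eventually_in [set y : state n | Vj y i = ix i] w.
  have evl : eventually_in [set y : state n |
      (y i < coord y i)%N = (0 < i)%N && ~~ s i.-1] w.
    case: (posnP i) => [i0|i0]; first by exists 0%N => ? ? _ /=; rewrite i0.
    have [l li] := ord_prev i i0; rewrite -li /=.
    case: (boolP (s l)) => sl.
      apply: eventually_inS (sT l i li sl) => y /= lt.
      by rewrite li (coord_pred _ _ _ li) ltnNge (ltnW lt).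
    apply: eventually_inS (sF l i li sl) => y /= lt.
    by rewrite li (coord_pred _ _ _ li) lt.
  have evr : eventually_in [set y : state n |
      (y i < coord y i.+2)%N = (i.+1 < n)%N && s i] w.
    case: ltnP => [/ord_next[r ir]|ni] /=; last first.
      by exists 0%N => ? ? _ /=; rewrite coord_out.
    case: (boolP (s i)) => si.
      by apply: eventually_inS (sT i r ir si) => y /=; rewrite (coord_succ _ _ _ ir).
    apply: eventually_inS (sF i r ir si) => y /= lt.
    by rewrite (coord_succ _ _ _ ir) ltnNge (ltnW lt).
  by apply: eventually_inS (eventually_inI _ _ _ evl evr) => y [/= h1 h2]; rewrite VjE h1 h2.
have [sl te] := sites_limit w (fun k => bt (ix k)) mono (fun i => H4 i _ (evV i)).
exists (fun i : 'I_n => bt (ix i)); split; first exact: sl.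
exists (mkseq ix n); rewrite size_mkseq; split => //.
- apply/allP => v /mapP[k _ ->]; rewrite /ix.
  by do 2 case: (_ && _).
- move=> k kn; have h : (k < n)%N by apply: ltnW.
  rewrite !nth_mkseq //; apply/negP => /eqP E.
  pose p := Ordinal h; pose q := Ordinal kn.
  (* The lower site of the pair has at least one higher neighbour and the other at most one, so
     equal counts are both 1, which [pair_transience] excludes. *)
  have E1 : ix k = 1%N /\ ix k.+1 = 1%N.
    move: E; rewrite /ix kn /=; case: (s k) => /=.
      by case: ((0 < k)%N && _); case: ((k.+2 < n)%N && _).
    by case: ((0 < k)%N && _); case: ((k.+2 < n)%N && _).
  have evp := evV p; have evq := evV q; rewrite /= E1.1 in evp; rewrite /= E1.2 in evq.
  apply: (H3 p q erefl); case: (order p q erefl) => ev.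
    apply: eventually_inS (eventually_inI _ _ _ ev (eventually_inI _ _ _ evp evq)).
    by move=> y [/= lt [-> ->]]; split => // E'; rewrite E' ltnn in lt.
  apply: eventually_inS (eventually_inI _ _ _ ev (eventually_inI _ _ _ evp evq)).
  by move=> y [/= lt [-> ->]]; split => // E'; rewrite E' ltnn in lt.
- have x0 : (ix 0%N <= 1)%N by rewrite /ix /= leq_b1.
  have xl : (ix n.-1 <= 1)%N by rewrite /ix prednK // ltnn addn0 leq_b1.
  by rewrite !nth_mkseq ?prednK // !neq_ltn !ltnS x0 xl.
- by rewrite te /mkseq -map_comp.
Qed.

End SignCase.

Section ValleyCase.
Hypotheses (b12 : b1 <= b2) (b20 : b2 < b0).

Let b10 : b1 < b0. Proof. exact: le_lt_trans b20. Qed.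

Lemma valley_case : (1 < n)%N -> {ae P, forall w,
  exists l, speed_limit (X^~ w) l /\ E3 b0 b1 b2 (tup l)}.
Proof.
move=> n1; have n0 : (0 < n)%N by apply: ltnW.
have H1 : {ae P, forall w, forall i : 'I_n,
    eventually_in (strict_peak i) w \/ eventually_in (~` weak_peak i) w}.
  by apply: ae_forall_countable => i; exact: (peak_absorption b10 b20 i).
have H2 : {ae P, forall w, forall p q r : 'I_n, p.+1 = q :> nat -> q.+1 = r :> nat ->
    ~ eventually_in [set y : state n | [/\ (y q < y p)%N || (y q < y r)%N,
       (y q <= y p)%N -> (y p < coord y p)%N &
       (y q <= y r)%N -> (y r < coord y r.+2)%N]] w}.
  apply: ae_forall_countable => p; apply: ae_forall_countable => q.
  apply: ae_forall_countable => r; apply: ae_imply => pq; apply: ae_imply => qr.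
  exact: (valley_transience p q r pq qr b12).
have H3 : {ae P, forall w, forall p q : 'I_n, p.+1 = q :> nat ->
  eventually_in (block p q b1 b2) w ->
  ((X k%:R w p)%:R / k%:R @[k --> \oo] --> v2inf b1 b2) /\
  ((X k%:R w q)%:R / k%:R @[k --> \oo] --> v2inf b1 b2)}.
  apply: ae_forall_countable => p; apply: ae_forall_countable => q.
  by apply: ae_imply => pq; exact: (block_speed p q b1 b2 pq b1_gt0 b12).
have H4 : {ae P, forall w, forall (i : 'I_n) v,
  eventually_in [set y : state n | Vj y i = v] w ->
  (X k%:R w i)%:R / k%:R @[k --> \oo] --> bt v}.
  do 2 (apply: ae_forall_countable => ?); exact: site_speed.
have H5 : {ae P, forall w, forall p q : 'I_n, p.+1 = q :> nat -> ~ eventually_in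
     [set y : state n | [/\ y p <> y q, Vj y p = 1%N & Vj y q = 1%N]] w}.
  apply: ae_forall_countable => p; apply: ae_forall_countable => q.
  apply: ae_imply => pq; apply: (pair_transience p q).
  by rewrite -val_eqE /= -pq ltn_eqF.
apply: filterS (filterI H1 (filterI H2 (filterI H3 (filterI H4 (filterI H5 monotone_path))))).
move=> w [{}H1 [{}H2 [{}H3 [{}H4 [{}H5 mono]]]]].
(* Outside the row there are no peaks (default [false]), so an end site that is not a peak has one
   higher neighbour at most and needs its own speed b1. *)
pose m k := if insub k is Some i then `[< eventually_in (strict_peak (i : 'I_n)) w >] else false.
have mE (i : 'I_n) : m i = `[< eventually_in (strict_peak i) w >] by rewrite /m valK.
have peakI (i : 'I_n) : m i -> eventually_in (strict_peak i) w by rewrite mE => /asboolP.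
have npeak (i : 'I_n) : ~~ m i -> eventually_in (~` weak_peak i) w.
  by rewrite mE => /asboolPn ne; case: (H1 i).
have adj (i j : 'I_n) : i.+1 = j :> nat -> m i -> ~~ m j.
  move=> ij /peakI evi; apply/negP => /peakI evj.
  have [y [[_ h1] [h2 _]]] := eventually_in_ex _ _ (eventually_inI _ _ _ evi evj).
  move: h1 h2; rewrite (coord_succ _ _ _ ij) (coord_pred _ _ _ ij) => /ltn_trans/[apply].
  by rewrite ltnn.
have tri (p q r : 'I_n) : p.+1 = q :> nat -> q.+1 = r :> nat -> [|| m p, m q | m r].
  move=> pq qr; apply/negPn; rewrite !negb_or; apply/negP => /and3P[/npeak np /npeak nq /npeak nr].
  apply: (H2 p q r pq qr).
  apply: eventually_inS (eventually_inI _ _ _ np (eventually_inI _ _ _ nq nr)).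
  move=> y [hp [hq hr]]; split.
  - apply/negPn; rewrite negb_or -!leqNgt; apply/negP => /andP[le1 le2]; apply: hq.
    by split; rewrite ?(coord_pred _ _ _ pq) ?(coord_succ _ _ _ qr).
  - move=> le; rewrite ltnNge; apply/negP => le'; apply: hp; split => //.
    by rewrite (coord_succ _ _ _ pq).
  - move=> le; rewrite ltnNge; apply/negP => le'; apply: hr; split => //.
    by rewrite (coord_pred _ _ _ qr).
(* Next to the boundary height 0, two sites that are never weak peaks satisfy y p < y q <
   [coord y q.+2]; both then move at rate b1 at distinct heights, contradicting
   [pair_transience]. *)
have first_two (p q : 'I_n) : p.+1 = q :> nat -> p = 0%N :> nat -> m p || m q.
  move=> pq p0; apply/negPn; rewrite negb_or; apply/negP => /andP[/npeak np /npeak nq].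
  apply: (H5 p q pq); apply: eventually_inS (eventually_inI _ _ _ np nq) => y [hp hq].
  have lt : (y p < y q)%N.
    rewrite ltnNge; apply/negP => le; apply: hp; split; first by rewrite p0.
    by rewrite (coord_succ _ _ _ pq).
  have lt' : (y q < coord y q.+2)%N.
    rewrite ltnNge; apply/negP => le; apply: hq; split => //.
    by rewrite (coord_pred _ _ _ pq) ltnW.
  split; first by move=> E; rewrite E ltnn in lt.
    have c0 : coord y p = 0%N by rewrite p0.
    by rewrite VjE c0 (coord_succ _ _ _ pq) lt.
  by rewrite VjE lt' (coord_pred _ _ _ pq) ltnNge (ltnW lt).
have last_two (p q : 'I_n) : p.+1 = q :> nat -> (n <= q.+1)%N -> m p || m q.
  move=> pq qn; apply/negPn; rewrite negb_or; apply/negP => /andP[/npeak np /npeak nq].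
  apply: (H5 p q pq); apply: eventually_inS (eventually_inI _ _ _ np nq) => y [hp hq].
  have lt : (y q < y p)%N.
    rewrite ltnNge; apply/negP => le; apply: hq; split; last by rewrite coord_out.
    by rewrite (coord_pred _ _ _ pq).
  have lt' : (y p < coord y p)%N.
    rewrite ltnNge; apply/negP => le; apply: hp; split => //.
    by rewrite (coord_succ _ _ _ pq) ltnW.
  split; first by move=> E; rewrite E ltnn in lt.
    by rewrite VjE lt' (coord_succ _ _ _ pq) ltnNge (ltnW lt).
  by rewrite VjE (coord_out y q.+2) // (coord_pred _ _ _ pq) lt.
have left_high (l i : 'I_n) : l.+1 = i :> nat -> m l ->
    eventually_in [set y : state n | (y i < coord y i)%N] w.
  move=> li /peakI; apply: eventually_inS => y [_].
  by rewrite (coord_succ _ _ _ li) /= (coord_pred _ _ _ li).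
have right_high (i r : 'I_n) : i.+1 = r :> nat -> m r ->
    eventually_in [set y : state n | (y i < coord y i.+2)%N] w.
  move=> ir /peakI; apply: eventually_inS => y [+ _].
  by rewrite (coord_pred _ _ _ ir) /= (coord_succ _ _ _ ir).
have two (l p q r : 'I_n) : l.+1 = p :> nat -> p.+1 = q :> nat -> q.+1 = r :> nat ->
    m l -> m r -> eventually_in (block p q b1 b2) w.
  move=> lp pq qr ml mr.
  apply: eventually_inS (eventually_inI _ _ _ (left_high l p lp ml) (right_high q r qr mr)).
  move=> y [/= h1 h2].
  rewrite /block /= !VjE h1 h2 (coord_succ _ _ _ pq) (coord_pred _ _ _ pq).
  by split; case: ifP.
pose Lf k := if m k then b0 else if (k == 0%N) || (k == n.-1) then b1 else
  if m k.-1 && m k.+1 then b2 else v2inf b1 b2.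
have lims (i : 'I_n) : (X k%:R w i)%:R / k%:R @[k --> \oo] --> Lf i.
  rewrite /Lf; case: ifPn => mi.
    apply: (H4 i 0%N); apply: eventually_inS (peakI i mi) => y; exact: strict_peak_Vj.
  case: (posnP i) => [i0|i0] /=.
    have i1n : (i.+1 < n)%N by rewrite i0.
    have [r ir] := ord_next i i1n.
    have mr : m r by have := first_two i r ir i0; rewrite (negbTE mi).
    apply: (H4 i 1%N); apply: eventually_inS (right_high i r ir mr) => y /= lt.
    by rewrite VjE lt i0.
  have [l li] := ord_prev i i0.
  case: (ltnP i.+1 n) => [in_|ni]; last first.
    have -> : (i == n.-1 :> nat) by rewrite eqn_leq -ltnS prednK // ltn_ord -ltnS prednK.
    have ml : m l by have := last_two l i li ni; rewrite (negbTE mi) orbF.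
    apply: (H4 i 1%N); apply: eventually_inS (left_high l i li ml) => y /= lt.
    by rewrite VjE lt coord_out.
  have -> : (i == n.-1 :> nat) = false by rewrite ltn_eqF // -ltnS prednK.
  have [r ir] := ord_next i in_.
  have t := tri l i r li ir.
  rewrite -li /= li ir.
  (* If l is no peak, then r is one; l is not the first site by [first_two], and the site before l
     is a peak by [tri]. Thus l and i form a block between two peaks. *)
  case: (boolP (m l)) => ml /=; last first.
    have mr : m r by move: t; rewrite (negbTE ml) (negbTE mi).
    case: (posnP l) => [l0|l0].
      by have := first_two l i li l0; rewrite (negbTE ml) (negbTE mi).
    have [l' ll] := ord_prev l l0.
    have ml' : m l' by have := tri l' l i ll li; rewrite (negbTE ml) (negbTE mi) !orbF.
    by apply: (H3 l i li _).2; exact: (two l' l i r).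
  case: (boolP (m r)) => mr.
    apply: (H4 i 2%N).
    apply: eventually_inS (eventually_inI _ _ _ (left_high l i li ml) (right_high i r ir mr)).
    by move=> y [/= h1 h2]; rewrite VjE h1 h2.
  case: (ltnP r.+1 n) => [/ord_next[r' rr]|nr]; last first.
    by have := last_two i r ir nr; rewrite (negbTE mr) (negbTE mi).
  have mr' : m r' by have := tri i r r' ir rr; rewrite (negbTE mr) (negbTE mi).
  by apply: (H3 i r ir _).1; exact: (two l i r r').
have [sl te] := sites_limit w Lf mono lims.
exists (fun i : 'I_n => Lf i); split; first exact: sl.
have madj k : (k.+1 < n)%N -> ~~ (m k && m k.+1).
  move=> kn; have h : (k < n)%N by apply: ltnW.
  apply/negP => /andP[mk mk1].
  by have := adj (Ordinal h) (Ordinal kn) erefl mk; rewrite mk1.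
have mtri k : (k.+2 < n)%N -> [|| m k, m k.+1 | m k.+2].
  move=> kn; have h1 : (k.+1 < n)%N by apply: ltnW.
  by have := tri (Ordinal (ltnW h1)) (Ordinal h1) (Ordinal kn) erefl erefl.
have mlast : m n.-2 || m n.-1.
  have h1 : (n.-1 < n)%N by rewrite prednK.
  have h2 : (n.-2 < n)%N by apply: leq_ltn_trans h1; exact: leq_pred.
  have e1 : n.-2.+1 = n.-1 by rewrite prednK // -ltnS prednK.
  by have := last_two (Ordinal h2) (Ordinal h1) e1; apply; rewrite /= prednK.
have LE k : (k < n)%N -> Lf k = if m k then b0 else
   if (k == 0%N) || (k == n.-1) then b1 else if m k.-1 && m k.+1 then b2 else v2inf b1 b2 by [].
have VB := valley_blocks m Lf n b0 b1 b2 (v2inf b1 b2) n1 madj mtri mlast LE.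
rewrite te.
have nE : n = n.-2.+2 by rewrite prednK ?prednK // -ltnS prednK.
(* The block recursion needs a peak to start from: the first peak is at index 0 or 1, which makes
   the left end piece empty or (b1). *)
case: (boolP (m 0%N)) => m0.
  have [bs [eR [hb he hE]]] := VB n.-1 0%N (prednK n0) m0.
  exists bs, [::], eR; split => //.
  by rewrite -[in LHS](prednK n0) /= hE /Lf m0.
have m1 : m 1%N.
  by have := first_two (Ordinal n0) (Ordinal n1) erefl erefl; rewrite /= (negbTE m0).
have [bs [eR [hb he hE]]] := VB n.-2 1%N (esym nE) m1.
exists bs, [:: b1], eR; split => //; first by rewrite eqxx orbT.
by rewrite [in LHS]nE /= hE /Lf m1 (negbTE m0) /=.
Qed.

End ValleyCase.

End CrystalProcess.

Theorem theorem5 (R : realType) (b0 b1 b2 : R) (n : nat)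
  (d : measure_display) (T : measurableType d) (P : probability T R)
  (X : R -> T -> state n) (x : state n) :
  (1 < n)%N -> 0 < b0 -> 0 < b1 -> 0 < b2 ->
  crystal_process b0 b1 b2 P X x ->
  [/\ (b2 < b0 <= b1 ->
        {ae P, forall w, exists l, speed_limit (X^~ w) l /\ E1 b0 b1 b2 (tup l)}),
      (b2 < b1 < b0 ->
        {ae P, forall w, exists l, speed_limit (X^~ w) l /\ E2 b0 b1 b2 n (tup l)}) &
      (b1 <= b2 < b0 ->
        {ae P, forall w, exists l, speed_limit (X^~ w) l /\ E3 b0 b1 b2 (tup l)})].
Proof.
move=> n1 b0_gt0 b1_gt0 b2_gt0 hX; have n0 := ltnW n1.
split=> /andP[lt1 lt2].
- exact: (hill_case b0 b1 b2 P X x b0_gt0 b1_gt0 b2_gt0 hX lt1 lt2 n0).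
- exact: (sign_case b0 b1 b2 P X x b0_gt0 b1_gt0 b2_gt0 hX lt1 lt2 n0).
- exact: (valley_case b0 b1 b2 P X x b0_gt0 b1_gt0 b2_gt0 hX lt1 lt2 n1).
Qed.
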